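(* Let $g\ge1$, let $\mathbb{X}^2=\mathbb{E}^2$ if $g=1$ and $\mathbb{X}^2=\mathbb{H}^2$ if $g\ge2$, and let $W_\infty$ be an oriented periodic alternating weave in $\mathbb{X}^2\times I$. Then any two minimal reduced alternating weaving motifs $D_{W_1}$, $D_{W_2}$ of $W_\infty$ (on $S_g$) have the same writhe: $w_r(D_{W_1})=w_r(D_{W_2})$.
   Context: Let $I=[-1,1]$. For $g\ge1$, $S_g$ is the closed orientable surface of genus $g$ ($S_1=T^2$), $\mathbb{X}^2=\mathbb{E}^2$ if $g=1$ and $\mathbb{X}^2=\mathbb{H}^2$ if $g\ge2$. $S_g=\mathbb{X}^2/\Lambda$ where $\Lambda$ is a lattice: for $g=1$, $\Lambda=\{xu+yv: x,y\in\mathbb{Z}\}$ for a basis $u,v$ of $\mathbb{E}^2$; for $g\ge2$, a discrete group generated by translations of $\mathbb{H}^2$ with quotient $S_g$. Threads. An essential closed curve component of a link in $S_g\times I$ lifts to infinite open curves called threads; a thread is unknotted if its projection to $\mathbb{X}^2$ has no self-crossing. For $g=1$, two components belong to the same set of threads if they are homotopic to the same $(p,q)$-torus knot. For $g\ge 2$, the projection of the lifted link to $\mathbb{H}^2$ is required to be isotopic to a quadrivalent kaleidoscopic tiling (obtained by repeatedly reflecting a convex hyperbolic polygon $P$ with $n\ge3$ edges in its sides); if $n$ is odd each edge of $P$ gets a different direction, if $n$ is even opposite edges get the same direction, reflections transport directions, and threads belong to the same set iff they have the same direction. Periodic weaves. Let $W\subset S_g\times I$ be a link all of whose components are essential closed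 curves lifting to unknotted threads (for $g=1$: each component is homotopic to a $(p_i,q_i)$-torus knot with $p_i,q_i$ coprime), and whose components belong to at least two distinct sets of threads. The lift $W_\infty$ of $W$ to $\mathbb{X}^2\times I$ is a periodic weave, and the diagram $D_W$ of $W$ on $S_g$ is a weaving motif. For a fixed lattice, motifs represent the same weave when they are related by finitely many Reidemeister moves $R_1,R_2,R_3$, isotopies of $S_g$ and Dehn twists of $S_g$. In an oriented weave the components are oriented and motifs carry the induced orientation. Minimal. For lattices of the same weave, write $\Lambda\subseteq\Lambda'$ when a unit cell of $\Lambda'$ is tiled by unit cells of $\Lambda$. A minimal lattice $\Lambda_{\min}$ is a periodic lattice of $W_\infty$ with $\Lambda_{\min}\subseteq\Lambda$ for every periodic lattice $\Lambda$ of $W_\infty$. A motif is minimal if it is a motif for $\Lambda_{\min}$. A motif is alternating if its crossings alternate between over and under along each component; a weave is alternating if it admits an alternating motif. A motif is reduced if its lift to $\mathbb{X}^2$ has no nugatory crossing, where a crossing is nugatory if two of the four local regions at it are part of the same region of the infinite diagram. The writhe $w_r(D)$ is the sum of the signs $\pm1$ of all crossings (usual sign convention). *)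

(* Defs.v *)
From HB Require Import structures.
From Stdlib Require Import Relations.Relation_Operators.
From mathcomp Require Import all_boot all_order all_algebra.
From mathcomp Require Import reals.

Set Implicit Arguments.
Unset Strict Implicit.
Unset Printing Implicit Defensive.

Import Order.TTheory GRing.Theory Num.Theory.

(******************************************************************************)
(* Oriented link diagrams on oriented surfaces, as combinatorial maps.        *)
(*                                                                            *)
(* A dart is a half-edge of the diagram, pointing away from a crossing. The   *)
(* darts at a crossing are permuted counterclockwise by ccw, and mate swaps   *)
(* the two halves of an edge. A finite map encodes, up to orientation-        *)
(* preserving homeomorphism, a diagram on a closed surface whose regions are  *)
(* discs; an infinite simply connected one encodes a diagram in the plane.    *)
(*                                                                            *)
(* The regions of every motif of a weave are discs: the components are        *)
(* essential and fill the surface (two distinct slopes on the torus, the      *)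
(* geodesics of a polygonal tiling in higher genus), and both properties      *)
(* depend only on their free homotopy classes.                                *)
(******************************************************************************)

Record diagram (dart : Type) := Diagram {
  ccw : dart -> dart;
  mate : dart -> dart;
  is_over : dart -> bool;  (* the dart lies on the over-strand of its crossing *)
  is_out : dart -> bool;   (* the orientation leaves the crossing along it *)
  ccw4 : forall d, iter 4 ccw d = d;
  ccw2_neq : forall d, iter 2 ccw d <> d;
  mateK : involutive mate;
  mate_neq : forall d, mate d <> d;
  over_ccw : forall d, is_over (ccw d) = ~~ is_over d;
  out_opposite : forall d, is_out (ccw (ccw d)) = ~~ is_out d;
  out_mate : forall d, is_out (mate d) = ~~ is_out d
}.

Section Diagram.

Context (T : Type) (D : diagram T).

Definition same_crossing (d e : T) : Prop := exists k, e = iter k (ccw D) d.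

(* The region on the left of d occupies the corner between d and ccw d. Its  *)
(* boundary, traversed with the region on the left, continues after d with   *)
(* face d; so the regions are the orbits of face.                            *)
Definition face (d : T) : T := iter 3 (ccw D) (mate D d).

(* Follow a thread along d, then straight through the next crossing. *)
Definition straight (d : T) : T := ccw D (ccw D (mate D d)).

Definition alternating_diagram : Prop :=
  forall d, is_over D (straight d) = ~~ is_over D d.

(* The k-th and the 0-th corner at the crossing of d are in the same region. *)
Definition nugatory (d : T) : Prop :=
  exists2 k, 0 < k < 4 & exists n, iter k (ccw D) d = iter n face d.

Definition no_nugatory_crossing : Prop := forall d, ~ nugatory d.

(* Edge walks from the crossing of x to the crossing of y. *)
Fixpoint walk (x : T) (w : seq T) (y : T) : Prop :=
  if w is d :: w' then same_crossing x d /\ walk (mate D d) w' y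
  else same_crossing x y.

Definition connected : Prop := forall x y, exists w, walk x w y.

Inductive contraction : seq T -> seq T -> Prop :=
| contract_backtrack w1 d w2 :
    contraction (w1 ++ [:: d; mate D d] ++ w2) (w1 ++ w2)
| contract_face w1 d n w2 : iter n face d = d ->
    contraction (w1 ++ traject face d n ++ w2) (w1 ++ w2).

Definition homotopic (x y : T) : seq T -> seq T -> Prop :=
  clos_refl_sym_trans (seq T) (fun w w' =>
    [/\ walk x w y, walk x w' y & contraction w w']).

Definition simply_connected : Prop :=
  connected /\ forall x w, walk x w x -> homotopic x x w [::].

Definition threads_open : Prop :=
  forall d n, 0 < n -> iter n straight d <> d.

(* A self-crossing thread comes back to a crossing along its other strand. *)
Definition threads_unknotted : Prop :=
  forall d n, iter n straight d <> ccw D d /\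
              iter n straight d <> iter 3 (ccw D) d.

End Diagram.

Definition diagram_morphism T T' (D : diagram T) (D' : diagram T')
    (f : T -> T') : Prop :=
  forall d, [/\ f (ccw D d) = ccw D' (f d), f (mate D d) = mate D' (f d),
                is_over D' (f d) = is_over D d & is_out D' (f d) = is_out D d].

Definition isomorphism T T' (D : diagram T) (D' : diagram T') (f : T -> T') :=
  bijective f /\ diagram_morphism D D' f.

(******************************************************************************)
(* Diagrams on S_g.                                                           *)
(******************************************************************************)

Record motif := Motif { dart : finType; motif_diagram :> diagram dart }.

(* Euler's formula V - E + F = 2 - 2 g. *)
Definition on_surface (g : nat) (D : motif) : Prop :=
  [/\ 0 < #|dart D|, connected D &
      fcard (ccw D) (dart D) + fcard (face D) (dart D) + 2 * g
      = fcard (mate D) (dart D) + 2].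

Definition alternating (D : motif) : Prop := alternating_diagram D.

(* Each crossing is counted at the outgoing dart of its over-strand, and is   *)
(* positive when the outgoing under-dart is the next one counterclockwise.    *)
Definition writhe (D : motif) : int :=
  (\sum_(d : dart D | is_over D d && is_out D d)
     (if is_out D (ccw D d) then 1 else -1))%R.

(* D' is obtained from D by deleting the crossings of the darts in K and      *)
(* joining their strands straight through; f includes the darts of D' in      *)
(* those of D. No component may disappear.                                    *)
Definition delete_crossings (D D' : motif) (K : dart D -> Prop) : Prop :=
  let through d := mate D (ccw D (ccw D d)) in
  exists f : dart D' -> dart D,
  [/\ injective f,
      forall d, (exists x, f x = d) <-> ~ K d,
      forall x, [/\ f (ccw D' x) = ccw D (f x),
                    is_over D (f x) = is_over D' x &
                    is_out D (f x) = is_out D' x],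
      forall d, exists k, ~ K (iter k through d) &
      forall x, exists2 k, f (mate D' x) = iter k through (mate D (f x)) &
        forall l, l < k -> K (iter l through (mate D (f x)))].

(* Removal of a monogon. *)
Definition R1 (D D' : motif) : Prop :=
  exists2 d : dart D, face D d = d & delete_crossings D' (same_crossing D d).

(* Removal of a bigon, one side of which is over at both ends or under at     *)
(* both ends.                                                                 *)
Definition R2 (D D' : motif) : Prop :=
  exists d : dart D,
  [/\ face D (face D d) = d, ~ same_crossing D d (face D d),
      is_over D (mate D d) = is_over D d &
      delete_crossings D' (fun e =>
        same_crossing D d e \/ same_crossing D (face D d) e)].

(* Slide a strand of the triangle with sides d, face d, face (face d) across  *)
(* the opposite crossing; some strand of the triangle is over, or under, at   *)
(* both of its crossings. The crossings and their darts are kept. Each strand *)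
(* now meets its two crossings in the opposite order: at one end of the       *)
(* strand, the new position of an inner dart e is that of the outer dart      *)
(* opposite to mate e. The involution s exchanges these positions.            *)
Definition R3 T (D D' : diagram T) : Prop :=
  exists (d : T) (s : T -> T),
  let inner e := exists2 k, k < 3 &
    e = iter k (face D) d \/ e = mate D (iter k (face D) d) in
  let outer e := inner (ccw D (ccw D e)) in
  [/\ [/\ iter 3 (face D) d = d,
          forall k l, k < l < 3 ->
            ~ same_crossing D (iter k (face D) d) (iter l (face D) d) &
          is_over D (mate D d) = is_over D d],
      [/\ forall e, inner e -> s e = ccw D (ccw D (mate D e)),
          forall e, outer e -> s e = mate D (ccw D (ccw D e)) &
          forall e, ~ inner e -> ~ outer e -> s e = e] &
      forall e, [/\ ccw D' e = ccw D e, mate D' e = s (mate D (s e)),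
                    is_over D' e = is_over D e & is_out D' e = is_out D e]].

(* Isomorphisms account for the isotopies and Dehn twists of S_g, which       *)
(* generate its orientation-preserving homeomorphisms.                        *)
Inductive motif_move : motif -> motif -> Prop :=
| move_homeo (D D' : motif) f : @isomorphism _ _ D D' f -> motif_move D D'
| move_R1 (D D' : motif) : R1 D D' -> motif_move D D'
| move_R2 (D D' : motif) : R2 D D' -> motif_move D D'
| move_R3 (T : finType) (D D' : diagram T) :
    R3 D D' -> motif_move (Motif D) (Motif D').

Definition motif_equiv (g : nat) : motif -> motif -> Prop :=
  clos_refl_sym_trans motif (fun D D' =>
    [/\ on_surface g D, on_surface g D' & motif_move D D']).

(******************************************************************************)
(* Lifts to the plane and lattices.                                           *)
(******************************************************************************)

(* U is the lift of D to the universal cover of its surface: p is a covering, *)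
(* so that the boundaries of the regions lift to closed curves.               *)
Definition lift T (U : diagram T) (D : motif) (p : T -> dart D) : Prop :=
  [/\ simply_connected U, diagram_morphism U D p,
      forall x, exists d, p d = x &
      forall d n, iter n (face D) (p d) = p d -> iter n (face U) d = d].

Definition reduced (D : motif) : Prop :=
  exists (T : Type) (U : diagram T) (p : T -> dart D),
    lift U p /\ no_nugatory_crossing U.

(* D is the quotient of the infinite diagram U by the group L of its          *)
(* symmetries; since the quotient map is a covering, L acts freely on the     *)
(* plane, that is, by translations.                                           *)
Definition lattice_quotient T (U : diagram T) (L : (T -> T) -> Prop)
    (D : motif) (p : T -> dart D) : Prop :=
  [/\ lift U p, forall t, L t -> isomorphism U U t &
      forall d e, p d = p e <-> exists2 t, L t & t d = e].

Definition periodic_lattice (g : nat) T (U : diagram T)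
    (L : (T -> T) -> Prop) : Prop :=
  exists (D : motif) (p : T -> dart D),
    on_surface g D /\ lattice_quotient U L p.

(* A unit cell of L' is tiled by unit cells of L exactly when the group of    *)
(* translations L' is contained in L.                                         *)
Definition lattice_le T (L L' : (T -> T) -> Prop) : Prop :=
  forall t, L' t -> L t.

Definition minimal_lattice (g : nat) T (U : diagram T)
    (L : (T -> T) -> Prop) : Prop :=
  periodic_lattice g U L /\
  forall g' L', periodic_lattice g' U L' -> lattice_le L L'.

Definition weaving_motif (g : nat) T (U : diagram T) (L : (T -> T) -> Prop)
    (D : motif) : Prop :=
  exists (D0 : motif) (p : T -> dart D0),
    [/\ on_surface g D0, lattice_quotient U L p & motif_equiv g D0 D].

Definition minimal_motif (g : nat) T (U : diagram T) (D : motif) : Prop :=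
  exists2 L, minimal_lattice g U L & weaving_motif g U L D.

Definition alternating_weave T (U : diagram T) : Prop :=
  exists g L D, weaving_motif g U L D /\ alternating D.

(******************************************************************************)
(* Weaves in E^2 x I.                                                         *)
(******************************************************************************)

(* tr x y is the translation by x u + y v, for a basis (u, v) of the lattice. *)
Definition lattice_basis T (L : (T -> T) -> Prop) (tr : int -> int -> T -> T) :=
  [/\ forall d, tr 0%R 0%R d = d,
      forall x y x' y' d, tr (x + x')%R (y + y')%R d = tr x y (tr x' y' d),
      forall x y d, tr x y d = d -> x = 0%R /\ y = 0%R &
      forall t, L t <-> exists x y, forall d, t d = tr x y d].

(* Going once around the component of p d, a thread is translated by          *)
(* a u + b v.                                                                 *)
Definition torus_knot T (U : diagram T) (D : motif) (p : T -> dart D)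
    (tr : int -> int -> T -> T) (d : T) (a b : int) : Prop :=
  iter (order (straight D) (p d)) (straight U) d = tr a b d.

(* The knots (a, b) and (-a, -b) differ only by their orientation. *)
Definition same_torus_knot (a b a' b' : int) : Prop :=
  (a = a' /\ b = b') \/ (a = - a' /\ b = - b')%R.

Definition torus_link_lift T (U : diagram T) : Prop :=
  exists (L : (T -> T) -> Prop) (D : motif) (p : T -> dart D)
    (tr : int -> int -> T -> T),
  [/\ on_surface 1 D, lattice_quotient U L p, lattice_basis L tr,
      forall d, exists a b, torus_knot U p tr d a b /\ coprimez a b &
      exists d a b d' a' b',
        [/\ torus_knot U p tr d a b, torus_knot U p tr d' a' b' &
            ~ same_torus_knot a b a' b']].

(******************************************************************************)
(* Weaves in H^2 x I, with H^2 the upper sheet of the hyperboloid.            *)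
(******************************************************************************)

Section Hyperbolic.

Local Open Scope ring_scope.

Context (R : realType).

Definition minkowski : 'M[R]_3 :=
  \matrix_(i, j) if i == j then (if i == ord_max then -1 else 1) else 0.

Definition hyperbolic_plane (x : 'rV[R]_3) : Prop :=
  (x *m minkowski *m x^T) 0 0 = -1 /\ 0 < x 0 ord_max.

(* Positive when z is on the left of the line from x to y. *)
Definition side_of (x y z : 'rV[R]_3) : R :=
  \det (\matrix_(k < 3) nth 0 [:: x; y; z] k).

(* v lists the vertices counterclockwise; ordS is the cyclic successor. *)
Definition convex_polygon n (v : 'I_n -> 'rV[R]_3) : Prop :=
  (forall i, hyperbolic_plane (v i)) /\
  (forall i j, j != i -> j != ordS i -> 0 < side_of (v i) (v (ordS i)) (v j)).

Definition in_polygon n (v : 'I_n -> 'rV[R]_3) (x : 'rV[R]_3) : Prop :=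
  hyperbolic_plane x /\ forall i, 0 <= side_of (v i) (v (ordS i)) x.

Definition in_interior n (v : 'I_n -> 'rV[R]_3) (x : 'rV[R]_3) : Prop :=
  hyperbolic_plane x /\ forall i, 0 < side_of (v i) (v (ordS i)) x.

Definition reflection (r : 'M[R]_3) (x y : 'rV[R]_3) : Prop :=
  [/\ r *m minkowski *m r^T = minkowski, x *m r = x, y *m r = y & r != 1%:M].

(* The isometry g stands for the tile P g; reflecting this tile in its i-th   *)
(* side gives the tile P (r i g).                                             *)
Inductive tile n (r : 'I_n -> 'M[R]_3) : 'M[R]_3 -> Prop :=
| tile_base : tile r 1%:M
| tile_reflect i g : tile r g -> tile r (r i *m g).

Definition kaleidoscopic n (v : 'I_n -> 'rV[R]_3) (r : 'I_n -> 'M[R]_3) :=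
  [/\ (3 <= n)%N, convex_polygon v,
      forall i, reflection (r i) (v i) (v (ordS i)),
      forall x, hyperbolic_plane x ->
        exists g y, [/\ tile r g, in_polygon v y & x = y *m g] &
      forall g x, tile r g -> in_interior v x -> in_interior v (x *m g) ->
        g = 1%:M].

(* The projection of U is the 1-skeleton of the tiling: the region on the     *)
(* left of d is the tile P (tl d), and d lies on its side of index sd d. An   *)
(* orientation-reversing isometry lists the sides of its tile clockwise.      *)
Definition tiling_projection n (r : 'I_n -> 'M[R]_3) T (U : diagram T)
    (tl : T -> 'M[R]_3) (sd : T -> 'I_n) : Prop :=
  [/\ forall d, tile r (tl d),
      forall d e, tl d = tl e -> sd d = sd e -> d = e,
      forall g i, tile r g -> exists d, tl d = g /\ sd d = i,
      forall d, tl (mate U d) = r (sd d) *m tl d /\ sd (mate U d) = sd d &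
      forall d, tl (face U d) = tl d /\
        sd (face U d) = if 0 < \det (tl d) then ordS (sd d)
                        else ord_pred (sd d)].

Definition direction n (i : 'I_n) : nat := if odd n then i : nat else (i %% n./2)%N.

Definition kaleidoscopic_link_lift T (U : diagram T) : Prop :=
  exists n (v : 'I_n -> 'rV[R]_3) (r : 'I_n -> 'M[R]_3)
    (tl : T -> 'M[R]_3) (sd : T -> 'I_n),
  [/\ kaleidoscopic v r, tiling_projection r U tl sd,
      exists2 h, (1 < h)%N & exists L, periodic_lattice h U L &
      exists d d', direction (sd d) <> direction (sd d')].

End Hyperbolic.

(* W is the infinite diagram of an oriented weave, in E^2 if g = 1 and in H^2 *)
(* if g >= 2.                                                                 *)
Definition periodic_weave (R : realType) (g : nat) T (W : diagram T) : Prop :=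
  [/\ threads_open W, threads_unknotted W &
      if g == 1 then torus_link_lift W else kaleidoscopic_link_lift R W].

(* Main.v *)
Require Import Defs.
From HB Require Import structures.
From Stdlib Require Import Relations.Relation_Operators.
From mathcomp Require Import all_boot all_order all_algebra.
From mathcomp Require Import boolp reals.
From mathcomp Require Import zify.
From mathcomp.algebra_tactics Require Import ring lra.


(* Two minimal lattices contain each other, so their quotient motifs are isomorphic
   and D1, D2 are related by Reidemeister moves on S_g. Write c for the number of
   crossings, w for the writhe and s_A, s_B for the numbers of regions whose corners
   are at over-darts, resp. under-darts. Two quantities are followed through the moves.

   The first is the Kauffman bracket twisted by a flat connection: a loop of a state
   counts only if its holonomy is trivial. In an alternating motif the loops of the
   all-A and all-B states bound regions, so for every flat connection the normalized
   bracket is O(a^(c + 2 s_A + 3 w)) as a grows and O(a^(-(c + 2 s_B - 3 w))) as a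
   tends to 0. For the connection of the universal cover both bounds are attained:
   switching one crossing of the state can only fail to lose a loop when a crossing of
   the lift is nugatory. Hence c + 2 s_A + 3 w and c + 2 s_B - 3 w are invariant.

   The second is an analogue of the signature, with the Gordon-Litherland correction:
   the maximum of 2 dim X - dim V + w over the subspaces X on which a quadratic form
   on the space V of functions of the regions is positive definite. For an alternating
   motif the form is the difference of two positive semidefinite forms, on the regions
   of the two kinds, with only the constants in their kernels; so the maximum is
   s_A - s_B + w - 2. The three invariants determine 4 w. *)

Set Implicit Arguments.
Unset Strict Implicit.
Unset Printing Implicit Defensive.

Import Order.TTheory GRing.Theory Num.Theory.

(** * Labelled pairings and loop counts *)

(** The obstacle is that [reduced] constrains only the lift: a crossing may be nugatory on S_g while
    its lift is not. It then meets one region at two opposite corners, and switching it cuts a loop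
    of the extreme state into two, so that a bracket counting all loops could lose its extreme term
    by cancellation. The two new loops are essential, and the holonomy discards them. A move does
    not determine the connection on the new diagram, so invariance is an existence statement: every
    connection has a partner with the same normalized bracket. The upper bound holds for all
    connections and the lower one for the universal cover, which compares growth in one direction;
    exchanging the motifs gives the other. Degrees alone cannot isolate the writhe: with Euler's
    formula c = s_A + s_B + 2g - 2 they are two equations in the unknowns s_A, s_B, w. This is the
    role of the quadratic form. It lives on all regions and not on one colour, so no checkerboard
    colouring has to be followed through the moves. The bracket is evaluated at rational numbers,
    and degrees become rates of growth. *)

Ltac atomic_term a :=
  match a with context[if _ then _ else _] => fail 1 | _ => idtac end.

(** Splits on the equality tests whose sides contain no further [if]; identities between glued arcs
    become equational and fall to [congruence]. *)
Ltac decide_eqs :=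
  repeat (match goal with |- context[?a == ?b] =>
            atomic_term a; atomic_term b; case: (a =P b) => ? end;
          rewrite /=; try (exfalso; congruence)).

Section Pairing.

Context (E : eqType) (G : groupType).

(* The arcs of a partially resolved diagram: opp exchanges the ends of an arc and lbl
   is the holonomy along it. The fixed points of opp are the ends already glued. *)
Record pairing := Pairing { opp : E -> E; lbl : E -> G }.

Implicit Types (p : pairing) (x y z u v : E).

Definition wfp p : Prop :=
  (forall z, opp p (opp p z) = z) /\
  (forall z, lbl p (opp p z) = (lbl p z)^-1)%g.

(** Gluing [x] to [y] fuses their arcs into one from [opp p x] to [opp p y], labelled by the
    product; [x] and [y] become fixed points. When [y] is [opp p x] the arc closes up and both its
    ends disappear. *)
Definition pjoin p x y : pairing := Pairing
  (fun z => if (z == x) || (z == y) then z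
            else if z == opp p x then opp p y
            else if z == opp p y then opp p x else opp p z)
  (fun z => if (z == x) || (z == y) then 1%g
            else if z == opp p x then (lbl p z * lbl p y)%g
            else if z == opp p y then (lbl p z * lbl p x)%g else lbl p z).

Lemma pairing_ext p q : opp p =1 opp q -> lbl p =1 lbl q -> p = q.
Proof. by case: p q => [m l] [m' l'] /= /funext -> /funext ->. Qed.

Lemma wfp_join p x y : wfp p -> opp p x != x -> opp p y != y ->
  wfp (pjoin p x y).
Proof.
move=> [mK lV] /eqP hx /eqP hy; split=> z /=; move: (mK x) (mK y) (mK z) => Kx Ky Kz.
  decide_eqs; congruence.
move: (lV x) (lV y) (lV z) => Lx Ly Lz.
decide_eqs; rewrite ?invg1 ?invgM //; try congruence.
all: subst; rewrite ?Lx ?Ly ?invgK //; congr (_ * lbl _ _)%g; congruence.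
Qed.

Lemma pjoin_sym p x y : wfp p -> pjoin p x y = pjoin p y x.
Proof.
move=> [mK _]; apply: pairing_ext => z /=; move: (mK x) (mK y) => Kx Ky;
  decide_eqs; congruence.
Qed.

Lemma pjoin_comm p x y u v : wfp p -> uniq [:: x; y; u; v] ->
  opp p x != x -> opp p y != y -> opp p u != u -> opp p v != v ->
  pjoin (pjoin p x y) u v = pjoin (pjoin p u v) x y.
Proof.
move=> [mK lV]; rewrite /= !inE !negb_or -!andbA => /and5P[xy xu xv yu /and3P[yv uv _]].
move=> /eqP hx /eqP hy /eqP hu /eqP hv.
move: xy xu xv yu yv uv; do 6! move/eqP=> ?.
apply: pairing_ext => z /=; move: (mK x) (mK y) (mK z) (mK u) (mK v) => Kx Ky Kz Ku Kv.
  decide_eqs; congruence.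
move: (lV x) (lV y) (lV u) (lV v) => Lx Ly Lu Lv.
by decide_eqs; try congruence; rewrite ?mulgA; try congruence.
Qed.

Definition live p : pred E := fun z => opp p z != z.

Lemma live_join p x y z : wfp p -> live p x -> live p y -> x != y ->
  live (pjoin p x y) z = [&& live p z, z != x & z != y].
Proof.
rewrite /live /= => -[mK _] /eqP hx /eqP hy /eqP xy; move: (mK x) (mK y) (mK z) => Kx Ky Kz.
by decide_eqs; apply/idP/idP => // /eqP; congruence.
Qed.

Definition loop p x y : bool := (opp p x == y) && (lbl p x == (1%g : G)).

(** A loop is noticed at the gluing that closes it, when its holonomy is the label of a single
    arc. *)
Fixpoint loop_count p (J : seq (E * E)) : nat :=
  if J is j :: J' then loop p j.1 j.2 + loop_count (pjoin p j.1 j.2) J' else 0.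

Definition pts (J : seq (E * E)) : seq E := flatten [seq [:: j.1; j.2] | j <- J].

Definition okl p (s : seq E) : bool := uniq s && all (live p) s.

Lemma pts_cat J J' : pts (J ++ J') = pts J ++ pts J'.
Proof. by rewrite /pts map_cat flatten_cat. Qed.

Lemma perm_pts J J' : perm_eq J J' -> perm_eq (pts J) (pts J').
Proof. by move=> h; apply: perm_flatten; apply: perm_map. Qed.

Lemma perm_okl p s s' : perm_eq s s' -> okl p s = okl p s'.
Proof. by move=> h; rewrite /okl (perm_uniq h) (perm_all _ h). Qed.

Lemma okl_join p x y s : wfp p -> okl p [:: x, y & s] -> okl (pjoin p x y) s.
Proof.
move=> wf /andP[/= /and3P[]]; rewrite inE negb_or => /andP[xy xs] ys us /and3P[lx ly ls].
rewrite /okl us; apply/allP => z zs; rewrite live_join //.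
rewrite (allP ls) //=; apply/andP; split; [apply: contraNneq xs | apply: contraNneq ys] => <-; exact: zs.
Qed.

Lemma okl_catl p s1 s2 : okl p (s1 ++ s2) -> okl p s1.
Proof. by rewrite /okl cat_uniq all_cat => /andP[/andP[-> _] /andP[-> _]]. Qed.

Lemma loop_sym p x y : wfp p -> loop p x y = loop p y x.
Proof.
move=> [mK lV]; rewrite /loop; case: eqP => [<-|nxy]; rewrite ?mK ?eqxx /= ?lV ?invg_eq1 //.
by case: eqP => // e; case: nxy; rewrite -e mK.
Qed.

Lemma loop_count_swap p x y u v J : wfp p -> okl p [:: x; y; u; v] ->
  loop_count p ((x, y) :: (u, v) :: J) = loop_count p ((u, v) :: (x, y) :: J).
Proof.
move=> wf /andP[Hu /and5P[lx ly lu lv _]] /=; rewrite !addnA pjoin_comm //.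
congr (_ + _); have [mK lV] := wf.
move: Hu; rewrite /= !inE !negb_or -!andbA => /and5P[xy xu xv yu /and3P[yv uv _]].
move: lx ly lu lv xy xu xv yu yv uv; rewrite /live; do 10! move/eqP=> ?.
move: (mK x) (mK y) (mK u) (mK v) => Kx Ky Ku Kv.
move: (lV x) (lV y) (lV u) (lV v) => Lx Ly Lu Lv.
rewrite /loop /=.
(* If the two gluings close one loop together, the two orders read its holonomy up to conjugation
   and inversion, which preserve triviality. *)
have inv1 (s t s' t' : G) : (s * t)%g = (1%g : G) -> s' = (s^-1)%g -> t' = (t^-1)%g ->
    (s' * t')%g = (1%g : G).
  move=> e -> ->; suff -> : s = t^-1%g by rewrite invgK mulgV.
  by rewrite -[LHS](mulgK t) e mul1g.
have inv2 (s t : G) : (s * t)%g = (1%g : G) -> (t * s)%g = (1%g : G).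
  by move=> e; rewrite -[s](mulgK t) e mul1g mulgV.
have ivK (s : G) : (s^-1^-1)%g = s by exact: invgK.
move: (ivK (lbl p x)) (ivK (lbl p y)) => *.
decide_eqs; try congruence; rewrite ?addn0 ?add0n //; exfalso.
all: match goal with n : not (@eq (Magma.sort _) _ _) |- _ => case: n end.
all: match goal with e : @eq (Magma.sort _) _ _ |- _ =>
       first [by apply: (inv1 _ _ _ _ e); congruence | by apply: (inv2 _ _ e)] end.
Qed.

Lemma wfp_joinl p x y s : wfp p -> okl p [:: x, y & s] -> wfp (pjoin p x y).
Proof. by move=> wf /andP[_ /and3P[? ? _]]; exact: wfp_join. Qed.

Lemma loop_count_front p J1 j J2 : wfp p -> okl p (pts (J1 ++ j :: J2)) ->
  loop_count p (J1 ++ j :: J2) = loop_count p (j :: J1 ++ J2).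
Proof.
case: j => u v; elim: J1 p => [|[x y] J1 IH] p wf ok //.
have ok2 : okl p (pts ((x, y) :: (u, v) :: J1 ++ J2)).
  rewrite -(perm_okl p (s := pts (((x, y) :: J1) ++ (u, v) :: J2))) //.
  by apply: perm_pts; rewrite perm_cons -cat1s perm_catCA.
rewrite -[RHS]loop_count_swap //; last exact: (@okl_catl p [:: x; y; u; v] (pts (J1 ++ J2)) ok2).
have wf' := wfp_joinl wf ok.
by rewrite /= IH //; exact: okl_join.
Qed.

Lemma perm_loop_count p J J' : wfp p -> okl p (pts J) -> perm_eq J J' -> loop_count p J = loop_count p J'.
Proof.
move=> wf; elim: J J' p wf => [|j J IH] J' p wf ok eJ.
  by case: J' eJ => // j J' /perm_size.
have := perm_mem eJ j; rewrite mem_head => /esym/splitPr jJ'.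
case: jJ' eJ => J1 J2 eJ.
rewrite loop_count_front //; last by rewrite -(perm_okl _ (perm_pts eJ)).
have wf' : wfp (pjoin p j.1 j.2) by exact: (wfp_joinl wf ok).
rewrite /= (IH (J1 ++ J2)) //; first exact: okl_join.
by rewrite -(perm_cons j) (perm_trans eJ) // -[j :: J2]cat1s perm_catCA.
Qed.

(** An arc with trivial label can be contracted. On the right, [pjoin p i i'] only erases that arc;
    the loop closed by it is not counted. *)
Lemma loop_count_slide p x y i i' J : wfp p -> okl p [:: x; y; i; i'] ->
  opp p i = i' -> lbl p i = 1%g ->
  loop_count p ((x, i) :: (i', y) :: J) = loop_count (pjoin p i i') ((x, y) :: J).
Proof.
move=> wf /andP[]; have [mK lV] := wf.
rewrite /= !inE !negb_or -!andbA => /and5P[xy xi xi' yi /and3P[yi' ii' _]] /and5P[].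
move: xy xi xi' yi yi' ii'; rewrite /live; do 10! move/eqP=> ?; move=> _ mi li.
have li' : lbl p i' = 1%g by rewrite -mi lV li invg1.
move: (mK x) (mK y) (mK i) (mK i') => Kx Ky Ki Ki'.
suff e : pjoin (pjoin p x i) i' y = pjoin (pjoin p i i') x y.
  rewrite /= e addnA; congr (_ + _); rewrite /loop /=.
  have -> : (opp p x == i) = false by apply/eqP; congruence.
  rewrite mi (_ : (i' == x) = false) 1?(_ : (i' == i) = false) 1?(_ : (i' == opp p x) = false);
    try by apply/eqP; congruence.
  rewrite ?eqxx /= li' mul1g (_ : (x == i) = false) 1?(_ : (x == i') = false)
    1?(_ : (x == opp p i') = false); try by apply/eqP; congruence.
  by [].
apply: pairing_ext => z; move: (mK z) => Kz /=; first by decide_eqs; congruence.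
by decide_eqs; rewrite ?li ?li' ?mulg1 ?mul1g; congruence.
Qed.

End Pairing.

Section PairingMaps.

Context (G : groupType).

Lemma loop_count_map (E1 E2 : eqType) (f : E1 -> E2) (p1 : pairing E1 G) (p2 : pairing E2 G) J :
  injective f -> (forall z, opp p2 (f z) = f (opp p1 z)) ->
  (forall z, lbl p2 (f z) = lbl p1 z) ->
  loop_count p2 [seq (f j.1, f j.2) | j <- J] = loop_count p1 J.
Proof.
move=> inj; elim: J p1 p2 => //= -[x y] J IH p1 p2 ho hl /=.
rewrite /loop ho hl (inj_eq inj); congr (_ + _); apply: IH => z /=.
  by rewrite !ho !(inj_eq inj); do !case: ifP => // _.
by rewrite !ho !hl !(inj_eq inj).
Qed.

Context (E : eqType).
Implicit Types (p : pairing E G) (x y z : E).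

Definition gauge (u : E -> G) p : pairing E G :=
  Pairing (opp p) (fun z => u z * lbl p z * (u (opp p z))^-1)%g.

Lemma loop_count_gauge u p J : wfp p -> (forall j, j \in J -> u j.1 = u j.2) ->
  okl p (pts J) -> loop_count (gauge u p) J = loop_count p J.
Proof.
elim: J p => //= -[x y] J IH p wf uJ ok /=.
have /= uxy := uJ (x, y) (mem_head _ _); have [mK _] := wf.
have uJ' j : j \in J -> u j.1 = u j.2 by move=> jJ; apply: uJ; rewrite inE jJ orbT.
rewrite -(IH (pjoin p x y) (wfp_joinl wf ok) uJ' (okl_join wf ok)).
congr addn; last first.
  congr (loop_count _ J).
  apply: pairing_ext => z //=.
  case: ifP => [/orP[] /eqP -> | /negbT]; rewrite ?mulg1 ?mulgV //.
  rewrite negb_or => /andP[zx zy].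
  case: (z =P opp p x) => [-> |_].
    by rewrite !mK uxy !mulgA mulgVK.
  case: (z =P opp p y) => [-> |_]; last by [].
  by rewrite !mK uxy !mulgA mulgVK.
congr nat_of_bool; rewrite /loop /=; case: eqP => //= ->; rewrite uxy.
by apply/eqP/eqP => [h | ->]; rewrite ?mulg1 ?mulgV // -[lbl p x](mulKg (u y)) -[(_ * lbl p x)%g](mulgK (u y)^-1)%g h mul1g invgK mulVg.
Qed.

(** The inner factors of the fused labels cancel because [b x = a y]; so the label of an arc made of
    several edges depends only on its two ends. *)
Lemma join_potential p x y (a b : E -> G) : wfp p -> okl p [:: x; y] ->
  b x = a y -> b y = a x ->
  (forall z, live p z -> lbl p z = a z * (b (opp p z))^-1)%g ->
  forall z, live (pjoin p x y) z ->
  lbl (pjoin p x y) z = (a z * (b (opp (pjoin p x y) z))^-1)%g.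
Proof.
move=> wf ok hx hy hl z; have [mK _] := wf.
case/andP: ok; rewrite /= inE andbT => xy /and3P[lx ly _].
rewrite live_join // => /and3P[lz zx zy] /=; rewrite (negPf zx) (negPf zy) /=.
by case: eqP => [-> | _]; [|case: eqP => [-> | _]]; rewrite !hl ?mK // /live ?mK 1?eq_sym // ?hx ?hy mulgA mulgVK.
Qed.

(** [iota] is the change of a datum along an arc: negation for over and under, the identity for a
    region. *)
Lemma join_invariant (Y : Type) (iota : Y -> Y) p x y (c : E -> Y) :
  wfp p -> okl p [:: x; y] -> iota (c y) = c x -> iota (c x) = c y ->
  (forall z, live p z -> c (opp p z) = iota (c z)) ->
  forall z, live (pjoin p x y) z -> c (opp (pjoin p x y) z) = iota (c z).
Proof.
move=> wf ok hx hy hc z; have [mK _] := wf.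
case/andP: ok; rewrite /= inE andbT => xy /and3P[lx ly _].
rewrite live_join // => /and3P[lz zx zy] /=; rewrite (negPf zx) (negPf zy) /=.
by case: eqP => [-> | _]; [|case: eqP => [-> | _]]; rewrite ?hc // ?hx ?hy.
Qed.

End PairingMaps.

(** * The bracket *)

(* The ends are in counterclockwise order, and the smoothing (c0 c1) (c2 c3) has weight
   a or a^-1 according to sgn. *)
Record crossing (E : Type) :=
  Crossing { sgn : bool; c0 : E; c1 : E; c2 : E; c3 : E }.

Definition smoothing (E : Type) (b : bool) (c : crossing E) : seq (E * E) :=
  if b then [:: (c0 c, c1 c); (c2 c, c3 c)] else [:: (c1 c, c2 c); (c3 c, c0 c)].

Arguments smoothing : simpl never.

Definition cpts (E : Type) (cs : seq (crossing E)) : seq E :=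
  flatten [seq [:: c0 c; c1 c; c2 c; c3 c] | c <- cs].

Definition map_crossing (E1 E2 : Type) (f : E1 -> E2) (c : crossing E1) :=
  Crossing (sgn c) (f (c0 c)) (f (c1 c)) (f (c2 c)) (f (c3 c)).

Definition rotate (E : Type) (c : crossing E) : crossing E :=
  Crossing (~~ sgn c) (c1 c) (c2 c) (c3 c) (c0 c).

Local Open Scope ring_scope.

Definition weight (a : rat) (b : bool) : rat := if b then a else a^-1.

Definition delta (a : rat) : rat := - (a ^+ 2 + a ^- 2).

(** Kauffman's state sum, unnormalized: every counted loop, the last one included, contributes
    [delta a]. [J] collects the gluings already chosen. *)
Fixpoint bracket (E : eqType) (G : groupType) (a : rat) (p : pairing E G)
    (cs : seq (crossing E)) (J : seq (E * E)) : rat :=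
  if cs is c :: cs' then
    weight a (sgn c) * bracket a p cs' (J ++ smoothing true c) +
    weight a (~~ sgn c) * bracket a p cs' (J ++ smoothing false c)
  else delta a ^+ loop_count p J.

Section Bracket.

Context (G : groupType) (a : rat).

Lemma bracket_map (E1 E2 : eqType) (f : E1 -> E2) (p1 : pairing E1 G) (p2 : pairing E2 G) cs J :
  injective f -> (forall z, opp p2 (f z) = f (opp p1 z)) ->
  (forall z, lbl p2 (f z) = lbl p1 z) ->
  bracket a p2 (map (map_crossing f) cs) [seq (f j.1, f j.2) | j <- J] = bracket a p1 cs J.
Proof.
move=> inj ho hl; elim: cs J => [|c cs IH] J /=; first by rewrite (loop_count_map J inj ho hl).
by rewrite -!IH !map_cat.
Qed.

Context (E : eqType).
Implicit Types (p : pairing E G) (x y z : E) (J : seq (E * E)) (c : crossing E) (cs : seq (crossing E)).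

Definition okb p cs J : bool := okl p (pts J ++ cpts cs).

Lemma cpts_cat cs cs' : cpts (cs ++ cs') = cpts cs ++ cpts cs'.
Proof. by rewrite /cpts map_cat flatten_cat. Qed.

Lemma okb_smoothing p c cs J b : okb p (c :: cs) J -> okb p cs (J ++ smoothing b c).
Proof.
rewrite /okb => ok; rewrite -(perm_okl _ (s := pts J ++ cpts (c :: cs))) //.
rewrite pts_cat -catA perm_cat2l /smoothing; case: b => //=.
by rewrite (perm_catCA [:: c0 c] [:: c1 c; c2 c; c3 c]).
Qed.

Lemma okb_perm p cs cs' J J' : perm_eq (pts J ++ cpts cs) (pts J' ++ cpts cs') ->
  okb p cs J = okb p cs' J'.
Proof. exact: perm_okl. Qed.

Lemma bracket_permJ p cs J J' : wfp p -> okb p cs J -> perm_eq J J' ->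
  bracket a p cs J = bracket a p cs J'.
Proof.
move=> wf; elim: cs J J' => [|c cs IH] J J' ok e /=.
  by rewrite (perm_loop_count wf _ e) //; move: ok; rewrite /okb cats0.
by congr (_ * _ + _ * _); apply: IH; rewrite ?perm_cat2r //; apply: okb_smoothing.
Qed.

Lemma bracket_join p cs J x y : 
  bracket a p cs ((x, y) :: J) = delta a ^+ loop p x y * bracket a (pjoin p x y) cs J.
Proof.
elim: cs J => [|c cs IH] J /=; first by rewrite exprD.
by rewrite !IH mulrDr !(mulrCA (delta a ^+ _)).
Qed.

Lemma bracket_swap p c c' cs J : wfp p -> okb p [:: c, c' & cs] J ->
  bracket a p [:: c, c' & cs] J = bracket a p [:: c', c & cs] J.
Proof.
move=> wf ok /=; rewrite !mulrDr !mulrA !addrA.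
have H b b' : bracket a p cs ((J ++ smoothing b c) ++ smoothing b' c') =
              bracket a p cs ((J ++ smoothing b' c') ++ smoothing b c).
  apply: bracket_permJ => //; first by do 2!apply: okb_smoothing.
  by rewrite -!catA perm_cat2l perm_catC.
by rewrite !H; ring.
Qed.

Lemma bracket_front p cs1 c cs2 J : wfp p -> okb p (cs1 ++ c :: cs2) J ->
  bracket a p (cs1 ++ c :: cs2) J = bracket a p (c :: cs1 ++ cs2) J.
Proof.
move=> wf; elim: cs1 J => [|c' cs1 IH] J ok //.
rewrite bracket_swap //; last first.
  rewrite -(@okb_perm _ ((c' :: cs1) ++ c :: cs2) _ J) // perm_cat2l.
  have -> : cpts ((c' :: cs1) ++ c :: cs2) = cpts (c' :: cs1) ++ cpts [:: c] ++ cpts cs2.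
    by rewrite cpts_cat.
  have -> : cpts [:: c, c' & cs1 ++ cs2] = cpts [:: c] ++ cpts (c' :: cs1) ++ cpts cs2.
    by rewrite -cpts_cat.
  by rewrite perm_catCA.
by rewrite [LHS]/= !IH //; exact: okb_smoothing.
Qed.

Lemma bracket_rotate p c cs J : wfp p -> okb p (c :: cs) J ->
  bracket a p (rotate c :: cs) J = bracket a p (c :: cs) J.
Proof.
move=> wf ok /=; rewrite negbK addrC; congr (_ * _ + _ * _).
apply: bracket_permJ => //; last by rewrite perm_cat2l (perm_catC [:: _] [:: _]).
rewrite -(@okb_perm _ (c :: cs) _ J) // pts_cat -catA perm_cat2l /smoothing /=.
by rewrite (perm_catCA [:: c0 c; c1 c] [:: c2 c; c3 c]).
Qed.

End Bracket.

Local Close Scope ring_scope.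

Lemma pts_cons (E : eqType) (j : E * E) J : pts (j :: J) = [:: j.1, j.2 & pts J].
Proof. by []. Qed.

Lemma pts_nil (E : eqType) : pts [::] = [::] :> seq E.
Proof. by []. Qed.

Lemma cpts_cons E (c : crossing E) cs :
  cpts (c :: cs) = [:: c0 c, c1 c, c2 c, c3 c & cpts cs].
Proof. by []. Qed.

Definition orient (E : Type) (b : bool) (x y : E) := if b then (x, y) else (y, x).

Arguments pts : simpl never.
Arguments cpts : simpl never.

Ltac solve_perm :=
  apply/permP => ?;
  rewrite /smoothing /orient /= ?(pts_cat, cpts_cat, pts_cons, cpts_cons, pts_nil) /=
    ?(count_cat, pts_cons, cpts_cons) /=; ring.

(** * Reidemeister moves on the bracket *)

Section Local.

Context (G : groupType) (a : rat) (E : eqType).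
Implicit Types (p : pairing E G) (x y z : E) (J : seq (E * E)) (c : crossing E) (cs : seq (crossing E)).

Local Notation br := (bracket a).

Lemma okl_perm_catl p s s' r : okl p s -> perm_eq s (s' ++ r) -> okl p s'.
Proof. by move=> ok e; apply: (@okl_catl _ _ p s' r); rewrite -(perm_okl _ e). Qed.

Lemma bracket_flip p cs x y J : wfp p -> br p cs ((x, y) :: J) = br p cs ((y, x) :: J).
Proof. by move=> wf; rewrite !bracket_join loop_sym // pjoin_sym. Qed.

Lemma bracket_loop p cs i i' J : opp p i = i' -> lbl p i = 1%g ->
  br p cs ((i, i') :: J) = (delta a * br (pjoin p i i') cs J)%R.
Proof. by move=> e l; rewrite bracket_join /loop e l !eqxx expr1. Qed.

Lemma bracket_slide p cs x y i i' J : wfp p -> okl p [:: x; y; i; i'] ->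
  opp p i = i' -> lbl p i = 1%g ->
  br p cs ((x, i) :: (i', y) :: J) = br (pjoin p i i') cs ((x, y) :: J).
Proof.
move=> wf ok e l; elim: cs J => [|c cs IH] J; last by rewrite /= !IH.
by rewrite /bracket loop_count_slide.
Qed.

Definition transp x y z := if z == x then y else if z == y then x else z.

Lemma transp_inj x y : injective (transp x y).
Proof.
by move=> u v; rewrite /transp; decide_eqs; congruence.
Qed.

(** A trivially labelled arc from [i] to [i'], continued by gluing [i'] to [y], is absorbed by
    giving the end [i] the name [y]. *)
Lemma bracket_rename p cs i i' y J : wfp p -> okl p [:: y; i; i'] ->
  opp p i = i' -> lbl p i = 1%g ->
  br p cs ((i', y) :: J) =
  br (pjoin p i i') (map (map_crossing (transp i y)) cs)
     [seq (transp i y j.1, transp i y j.2) | j <- J].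
Proof.
move=> [mK lV] /andP[]; rewrite /= !inE negb_or -!andbA andbT.
move=> /and3P[/eqP yi /eqP yi' /eqP ii'] /and3P[/eqP ly _ _] mi li.
move: (mK i) (mK y) => Ki Ky.
have li' : lbl p i' = 1%g by rewrite -mi lV li invg1.
rewrite bracket_join /loop (_ : (opp p i' == y) = false) ?mul1r; last by apply/eqP; congruence.
symmetry; apply: bracket_map; first exact: transp_inj.
  by move=> z; move: (mK z); rewrite /transp /=; decide_eqs; congruence.
by move=> z; move: (mK z); rewrite /transp /=; decide_eqs; subst; rewrite ?li ?li' ?mul1g ?mulg1 //; congruence.
Qed.

(** One smoothing cuts off the monogon as a loop, the other contracts it; for [b = true] the factor
    is a * delta a + a^-1 = - a^3. *)
Lemma bracket_R1 p b i i' x y cs J : (a != 0)%R -> wfp p -> okb p (Crossing b i i' x y :: cs) J ->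
  opp p i = i' -> lbl p i = 1%g ->
  br p (Crossing b i i' x y :: cs) J =
  (- (if b then a ^+ 3 else a ^- 3) * br (pjoin p i i') cs ((x, y) :: J))%R.
Proof.
move=> a0 wf ok e l.
have okb' := okb_smoothing _ ok.
rewrite [LHS]/=.
rewrite (@bracket_permJ _ _ _ p cs _ ((i, i') :: (x, y) :: J)) //; last solve_perm.
rewrite (@bracket_permJ _ _ _ p cs (_ ++ smoothing false _) ((y, i) :: (i', x) :: J)) //; last solve_perm.
rewrite bracket_loop // bracket_slide //; last first.
  by apply: (okl_perm_catl (r := pts J ++ cpts cs) ok); solve_perm.
rewrite bracket_flip; last first.
  by apply: (@wfp_joinl _ _ p i i' [::]) => //; apply: (okl_perm_catl (r := [:: x; y] ++ pts J ++ cpts cs) ok); solve_perm.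
by rewrite /weight /delta; case: b {ok okb'} => /=; field.
Qed.

(** [bracket_slide] with the two gluings anywhere in the list and in either orientation, as the
    states of a move present them. *)
Lemma bracket_slide_at b1 b2 p cs J0 x y i i' J : wfp p -> okb p cs J0 ->
  opp p i = i' -> lbl p i = 1%g ->
  perm_eq J0 [:: orient b1 x i, orient b2 i' y & J] ->
  [/\ br p cs J0 = br (pjoin p i i') cs ((x, y) :: J), wfp (pjoin p i i') &
      okb (pjoin p i i') cs ((x, y) :: J)].
Proof.
move=> wf ok e l pe.
have pe' : perm_eq (pts J0 ++ cpts cs) ([:: i; i'] ++ pts ((x, y) :: J) ++ cpts cs).
  have pe' := permP (perm_pts pe); apply/permP => P.
  move: pe'; rewrite /orient !pts_cons; case: b1 {pe}; case: b2 => /= pe'; rewrite !count_cat pe' /=; lia.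
have ok' : okl p [:: i; i'].
  by apply: okl_perm_catl ok pe'.
have wf' : wfp (pjoin p i i') by exact: (@wfp_joinl _ _ p i i' [::]).
split=> //; last by apply: okl_join => //; rewrite /okb (perm_okl _ pe') in ok.
have okx : okl p [:: x; y; i; i'].
  apply: (okl_perm_catl (r := pts J ++ cpts cs) ok); apply: (perm_trans pe').
  solve_perm.
rewrite (bracket_permJ a wf ok pe) -bracket_slide //.
have H1 J' : br p cs (orient b1 x i :: J') = br p cs ((x, i) :: J').
  by case: b1 {pe} => //; rewrite /= bracket_flip.
rewrite H1.
have ok2 : okb p cs [:: (x, i), orient b2 i' y & J].
  rewrite /okb -(perm_okl p (s := pts J0 ++ cpts cs)) // (permPl pe').
  by case: b2 {pe H1}; solve_perm.
rewrite (bracket_permJ (J' := [:: orient b2 i' y, (x, i) & J]) a wf ok2); last solve_perm.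
have -> : br p cs [:: orient b2 i' y, (x, i) & J] = br p cs [:: (i', y), (x, i) & J].
  by case: b2 {pe ok2}; rewrite //= bracket_flip.
apply: bracket_permJ => //; last solve_perm.
rewrite /okb -(perm_okl p (s := pts J0 ++ cpts cs)) // (permPl pe').
by solve_perm.
Qed.

End Local.

Arguments bracket_slide_at {G} a {E} b1 b2 {p cs J0} x y i i' J.

Lemma cpts_map (E1 E2 : Type) (f : E1 -> E2) cs :
  cpts (map (map_crossing f) cs) = map f (cpts cs).
Proof. by elim: cs => //= c cs IH; rewrite cpts_cons IH. Qed.

Section Reidemeister.

Context (G : groupType) (a : rat) (a0 : (a != 0)%R) (E : eqType).
Implicit Types (p : pairing E G) (x y z : E) (J : seq (E * E)) (c : crossing E) (cs : seq (crossing E)).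

Local Notation br := (bracket a).

Lemma pjoin_inner p x y z : wfp p -> opp p x = y -> z != x -> z != y ->
  (opp (pjoin p x y) z = opp p z) * (lbl (pjoin p x y) z = lbl p z).
Proof.
move=> [mK _] e /negPf zx /negPf zy /=; rewrite zx zy e zy /=.
by rewrite -e mK zx.
Qed.

Lemma okl_neq p x y s : okl p [:: x, y & s] -> x != y.
Proof. by case/andP=> /= /andP[]; rewrite inE negb_or => /andP[]. Qed.

Lemma bracket_R2 p b i1 i2 o1 o2 i1' i2' o1' o2' cs J : wfp p ->
  okb p [:: Crossing b i1 i2 o1 o2, Crossing (~~ b) i2' i1' o2' o1' & cs] J ->
  opp p i1 = i1' -> lbl p i1 = 1%g -> opp p i2 = i2' -> lbl p i2 = 1%g ->
  br p [:: Crossing b i1 i2 o1 o2, Crossing (~~ b) i2' i1' o2' o1' & cs] J =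
  br (pjoin (pjoin p i1 i1') i2 i2') cs [:: (o1, o1'), (o2, o2') & J].
Proof.
move=> wf ok e1 l1 e2 l2.
set c := Crossing b i1 i2 o1 o2; set c' := Crossing (~~ b) i2' i1' o2' o1'.
pose p1 := pjoin p i1 i1'.
have okb2 d d' : okb p cs ((J ++ smoothing d c) ++ smoothing d' c').
  by do 2!apply: okb_smoothing.
have n1 : i2 != i1.
  apply: (@okl_neq p i2 i1 (i1' :: [:: i2'; o1; o2; o1'; o2'] ++ pts J ++ cpts cs)).
  by rewrite -(perm_okl _ (s := pts J ++ cpts [:: c, c' & cs])) //; solve_perm.
have n2 : i2 != i1'.
  apply: (@okl_neq p i2 i1' (i1 :: [:: i2'; o1; o2; o1'; o2'] ++ pts J ++ cpts cs)).
  by rewrite -(perm_okl _ (s := pts J ++ cpts [:: c, c' & cs])) //; solve_perm.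
have [E2 L2] := pjoin_inner wf e1 n1 n2; rewrite e2 in E2; rewrite l2 in L2.
pose p2 := pjoin p1 i2 i2'.
have TT : br p cs ((J ++ smoothing true c) ++ smoothing true c') =
    (delta a * br p2 cs [:: (o1, o2), (o1', o2') & J])%R.
  have [|-> wf1 ok1] := bracket_slide_at a false false i2 i2' i1 i1'
    [:: (o1, o2), (o2', o1') & J] wf (okb2 true true) e1 l1; first by solve_perm.
  rewrite bracket_loop //; congr (_ * _)%R.
  have wf2 : wfp p2 := wfp_joinl wf1 ok1.
  have {}ok1 : okb p2 cs [:: (o1, o2), (o2', o1') & J] := okl_join wf1 ok1.
  rewrite (@bracket_permJ _ _ _ _ _ _ [:: (o2', o1'), (o1, o2) & J]) //; last solve_perm.
  rewrite bracket_flip //; apply: bracket_permJ => //; last solve_perm.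
  by rewrite -(@okb_perm _ _ p2 cs cs [:: (o1, o2), (o2', o1') & J]) //; solve_perm.
have TF : br p cs ((J ++ smoothing true c) ++ smoothing false c') =
    br p2 cs [:: (o1, o2), (o1', o2') & J].
  have [|-> wf1 ok1] := bracket_slide_at a false true i2 o2' i1 i1'
    [:: (o1', i2'), (o1, o2) & J] wf (okb2 true false) e1 l1; first by solve_perm.
  have [|-> wf2 ok2] := bracket_slide_at a false false o2' o1' i2 i2'
    [:: (o1, o2) & J] wf1 ok1 E2 L2; first by solve_perm.
  rewrite bracket_flip //; apply: bracket_permJ => //; last solve_perm.
  by rewrite -(okb_perm _ (cs := cs) (J := [:: (o2', o1'), (o1, o2) & J])) //; solve_perm.
have FT : br p cs ((J ++ smoothing false c) ++ smoothing true c') =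
    br p2 cs [:: (o1, o2), (o1', o2') & J].
  have [|-> wf1 ok1] := bracket_slide_at a true false o2 i2' i1 i1'
    [:: (i2, o1), (o2', o1') & J] wf (okb2 false true) e1 l1; first by solve_perm.
  have [|-> wf2 ok2] := bracket_slide_at a false false o1 o2 i2 i2'
    [:: (o2', o1') & J] wf1 ok1 E2 L2; first by solve_perm.
  rewrite (@bracket_permJ _ _ _ _ _ _ [:: (o2', o1'), (o1, o2) & J]) //; last solve_perm.
  rewrite bracket_flip //; apply: bracket_permJ => //; last solve_perm.
  by rewrite -(okb_perm _ (cs := cs) (J := [:: (o1, o2), (o2', o1') & J])) //; solve_perm.
have FF : br p cs ((J ++ smoothing false c) ++ smoothing false c') =
    br p2 cs [:: (o1, o1'), (o2, o2') & J].
  have [|-> wf1 ok1] := bracket_slide_at a true true o2 o2' i1 i1'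
    [:: (i2, o1), (o1', i2') & J] wf (okb2 false false) e1 l1; first by solve_perm.
  have [|-> wf2 ok2] := bracket_slide_at a false false o1 o1' i2 i2'
    [:: (o2, o2') & J] wf1 ok1 E2 L2; first by solve_perm.
  by [].
(* The states [TT], [TF], [FT] leave the same arcs, with coefficients [delta a] and the two powers
   a^2, a^-2, whose sum is zero; only [FF] survives. *)
rewrite /= TT TF FT FF negbK /delta /weight.
by case: b {c c' ok okb2 TT TF FT FF}; rewrite /=; field.
Qed.

Lemma transp_id x y (s : seq E) : x \notin s -> y \notin s -> {in s, transp x y =1 id}.
Proof.
move=> xs ys z zs; rewrite /transp.
by case: eqP => [e|_]; [rewrite -e zs in xs | case: eqP => // e; rewrite -e zs in ys].
Qed.

Lemma map_crossing_id (f : E -> E) cs : {in cpts cs, f =1 id} -> map (map_crossing f) cs = cs.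
Proof.
elim: cs => //= -[b x0 x1 x2 x3] cs IH; rewrite cpts_cons /= => H; rewrite IH.
  by rewrite /map_crossing /= !H // !inE eqxx ?orbT.
by move=> z zs; apply: H; rewrite !inE zs !orbT.
Qed.

Lemma bracket_rename_at b p cs J0 i i' y J : wfp p -> okb p cs J0 ->
  opp p i = i' -> lbl p i = 1%g -> i \in cpts cs -> perm_eq J0 (orient b i' y :: J) ->
  [/\ br p cs J0 = br (pjoin p i i') (map (map_crossing (transp i y)) cs) J,
      wfp (pjoin p i i') & okb (pjoin p i i') (map (map_crossing (transp i y)) cs) J].
Proof.
move=> wf ok e l ics pe; pose r := rem i (cpts cs).
have pr : perm_eq (cpts cs) (i :: r) := perm_to_rem ics.
have pJ0 : perm_eq (pts J0 ++ cpts cs) [:: i, i', y & pts J ++ r].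
  have P1 := permP (perm_pts pe); have P2 := permP pr; apply/permP => P.
  rewrite count_cat P1 P2 pts_cons /orient; case: b {pe P1} => /=; rewrite count_cat; ring.
have okall : okl p [:: i, i', y & pts J ++ r] by rewrite -(perm_okl _ pJ0).
have wf' : wfp (pjoin p i i') := wfp_joinl wf okall.
have /andP[/= /and4P[i1 _ yJr _] _] := okall.
have iJr : i \notin pts J ++ r by move: i1; rewrite !inE !negb_or => /and3P[].
have idJr := transp_id iJr yJr.
have J_id : [seq (transp i y j.1, transp i y j.2) | j <- J] = J.
  rewrite -[RHS]map_id; apply/eq_in_map => -[u v] uvJ /=.
  have [uJ vJ] : u \in pts J /\ v \in pts J.
    by split; apply/flattenP; exists [:: u; v]; rewrite ?inE ?eqxx ?orbT //;
       apply/mapP; exists (u, v).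
  by rewrite !idJr // mem_cat ?uJ ?vJ.
split=> //.
  have -> : br p cs J0 = br p cs (orient b i' y :: J) by exact: bracket_permJ.
  have -> : br p cs (orient b i' y :: J) = br p cs ((i', y) :: J).
    by case: b {pe} => //; rewrite /= bracket_flip.
  rewrite (@bracket_rename _ a _ p cs i i' y) // ?J_id //.
  by apply: (okl_perm_catl (r := pts J ++ r) okall); solve_perm.
rewrite /okb cpts_map -(perm_okl _ (s := y :: pts J ++ r)); first exact: (okl_join wf okall).
have -> : y :: pts J ++ r = map (transp i y) (i :: pts J ++ r).
  by rewrite /= {1}/transp eqxx; congr (_ :: _); rewrite -[LHS]map_id; apply/eq_in_map => z /idJr.
have {2}-> : pts J = map (transp i y) (pts J).
  by rewrite -[LHS]map_id; apply/eq_in_map => z zJ; rewrite idJr // mem_cat zJ.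
rewrite -map_cat; apply: perm_map.
by rewrite -cat1s perm_catCA perm_cat2l /= perm_sym.
Qed.

Lemma transpL x y : transp x y x = y.
Proof. by rewrite /transp eqxx. Qed.

Lemma okl_transp p x y (s : seq E) : okl p (x :: y :: s) -> {in s, transp x y =1 id}.
Proof.
by case/andP=> /= /and3P[]; rewrite inE negb_or => /andP[_ xs] ys _ _; exact: transp_id.
Qed.

Lemma okb_swap p c c' cs J : okb p [:: c', c & cs] J = okb p [:: c, c' & cs] J.
Proof. by apply: okb_perm; solve_perm. Qed.

Lemma okb_rotate p c cs J : okb p (rotate c :: cs) J = okb p (c :: cs) J.
Proof. by apply: okb_perm; rewrite /rotate; solve_perm. Qed.

Lemma bracket_rotate_second p c c' cs J : wfp p -> okb p [:: c, c' & cs] J ->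
  br p [:: c, rotate c' & cs] J = br p [:: c, c' & cs] J.
Proof.
move=> wf ok; have ok' : okb p [:: c', c & cs] J by rewrite okb_swap.
have okr : okb p [:: rotate c', c & cs] J by rewrite okb_rotate.
by rewrite -(bracket_swap a wf okr) (bracket_rotate a wf ok') (bracket_swap a wf ok').
Qed.

(** A half turn exchanges smoothings and weights twice. In [bracket_R3] it brings a bigon into the
    position expected by [bracket_R2]. *)
Lemma bracket_half_turns p b b' x0 x1 x2 x3 y0 y1 y2 y3 cs J : wfp p ->
  okb p [:: Crossing b x0 x1 x2 x3, Crossing b' y0 y1 y2 y3 & cs] J ->
  br p [:: Crossing b x0 x1 x2 x3, Crossing b' y0 y1 y2 y3 & cs] J =
  br p [:: Crossing b x2 x3 x0 x1, Crossing b' y2 y3 y0 y1 & cs] J.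
Proof.
move=> wf ok.
have half bb u v w x : Crossing bb w x u v = rotate (rotate (Crossing bb u v w x)).
  by rewrite /rotate /= negbK.
rewrite (half b x0) (half b' y0).
set c := Crossing b x0 x1 x2 x3 in ok *; set c' := Crossing b' y0 y1 y2 y3 in ok *.
have ok1 : okb p [:: rotate c, c' & cs] J by rewrite okb_rotate.
have ok2 : okb p [:: rotate (rotate c), c' & cs] J by rewrite !okb_rotate.
have ok3 : okb p [:: rotate (rotate c), rotate c' & cs] J.
  by rewrite okb_swap okb_rotate okb_swap.
rewrite (bracket_rotate_second wf ok3) (bracket_rotate_second wf ok2).
by rewrite (bracket_rotate a wf ok1) (bracket_rotate a wf ok).
Qed.

End Reidemeister.

Arguments bracket : simpl never.

Section Reidemeister.

Context (G : groupType) (a : rat) (a0 : (a != 0)%R) (E : eqType).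
Implicit Types (p : pairing E G) (x y z : E) (J : seq (E * E)) (c : crossing E) (cs : seq (crossing E)).

Local Notation br := (bracket a).

Lemma okl_notin p x y (s r : seq E) z : okl p (x :: y :: s ++ r) -> z \in s ->
  (z != x) && (z != y).
Proof.
case/andP=> /= /and3P[]; rewrite !inE !mem_cat !negb_or => /and3P[_ xs _] /andP[ys _] _ _ zs.
by apply/andP; split; apply/eqP => e; rewrite -e zs in xs ys.
Qed.

(** Kauffman's trick: only [C2] is expanded, the crossing off the strand that is over, or under, at
    both other crossings. One smoothing leaves a bigon on either side of the move, removed by
    [bracket_R2]; the other leaves the same diagram. *)
Lemma bracket_R3 (q : pairing E G) b0 b2 (i0 j0 o0 p0 i1 j1 o1 p1 i2 j2 o2 p2 : E) cs J : wfp q ->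
  okb q [:: Crossing b0 i0 j0 o0 p0, Crossing (~~ b0) i1 j1 o1 p1,
            Crossing b2 i2 j2 o2 p2 & cs] J ->
  opp q i0 = j1 -> opp q i1 = j2 -> opp q i2 = j0 ->
  lbl q i0 = 1%g -> lbl q i1 = 1%g -> lbl q i2 = 1%g ->
  br q [:: Crossing b0 i0 j0 o0 p0, Crossing (~~ b0) i1 j1 o1 p1,
           Crossing b2 i2 j2 o2 p2 & cs] J =
  br q [:: Crossing b0 p1 o2 j1 i2, Crossing (~~ b0) p2 o0 j2 i0,
           Crossing b2 p0 o1 j0 i1 & cs] J.
Proof.
move=> wf ok e0 e1 e2 l0 l1 l2; have [qK qV] := wf.
set C0 := Crossing b0 i0 j0 o0 p0 in ok *.
set C1 := Crossing (~~ b0) i1 j1 o1 p1 in ok *.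
set C2 := Crossing b2 i2 j2 o2 p2 in ok *.
set D0 := Crossing b0 p1 o2 j1 i2; set D1 := Crossing (~~ b0) p2 o0 j2 i0.
set D2 := Crossing b2 p0 o1 j0 i1.
have okall : okl q ([:: i0; j0; o0; p0; i1; j1; o1; p1; i2; j2; o2; p2] ++ pts J ++ cpts cs).
  by rewrite -(perm_okl _ (s := pts J ++ cpts [:: C0, C1, C2 & cs])) //; solve_perm.
have okC : okb q [:: C2, C0, C1 & cs] J.
  by rewrite /okb (perm_okl _ (s' := pts J ++ cpts [:: C0, C1, C2 & cs])) //; solve_perm.
have okD : okb q [:: D2, D0, D1 & cs] J.
  rewrite /okb (perm_okl _ (s' := pts J ++ cpts [:: C0, C1, C2 & cs])) //.
  by rewrite /D0 /D1 /D2; solve_perm.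
have okD' : okb q [:: D0, D1, D2 & cs] J.
  rewrite /okb (perm_okl _ (s' := pts J ++ cpts [:: C0, C1, C2 & cs])) //.
  by rewrite /D0 /D1 /D2; solve_perm.
have f0 : opp q j1 = i0 by rewrite -e0 qK.
have f1 : opp q j2 = i1 by rewrite -e1 qK.
have f2 : opp q j0 = i2 by rewrite -e2 qK.
have m0 : lbl q j1 = 1%g by rewrite -e0 qV l0 invg1.
have m1 : lbl q j2 = 1%g by rewrite -e1 qV l1 invg1.
have m2 : lbl q j0 = 1%g by rewrite -e2 qV l2 invg1.
rewrite (bracket_front a (cs1 := [:: C0; C1]) (cs2 := cs) wf ok).
rewrite (bracket_front a (cs1 := [:: D0; D1]) (cs2 := cs) wf okD').
have step c c' c'' : br q [:: c, c' , c'' & cs] J =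
  (weight a (sgn c) * br q [:: c', c'' & cs] (J ++ smoothing true c) +
   weight a (~~ sgn c) * br q [:: c', c'' & cs] (J ++ smoothing false c))%R by [].
rewrite -[[:: C0; C1] ++ cs]/[:: C0, C1 & cs] -[[:: D0; D1] ++ cs]/[:: D0, D1 & cs] !step.
pose q1 := pjoin q j0 i2.
have neq x y s : perm_eq ([:: i0; j0; o0; p0; i1; j1; o1; p1; i2; j2; o2; p2] ++ pts J ++ cpts cs)
    (x :: y :: s) -> x != y.
  by move=> pe; apply: (@okl_neq _ _ q x y s); rewrite -(perm_okl _ pe).
have tr x y s : perm_eq ([:: i0; j0; o0; p0; i1; j1; o1; p1; i2; j2; o2; p2] ++ pts J ++ cpts cs)
    (x :: y :: s) -> {in s, transp x y =1 id}.
  by move=> pe; apply: (@okl_transp _ _ q x y s); rewrite -(perm_okl _ pe).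
have IL : {in [:: i0; o0; p0; i1; j1; o1; p1; j2; o2; p2], forall z,
    (opp q1 z = opp q z) * (lbl q1 z = lbl q z)}.
  have : okl q ([:: j0; i2] ++ [:: i0; o0; p0; i1; j1; o1; p1; j2; o2; p2] ++ pts J ++ cpts cs).
    by apply: (okl_perm_catl (r := [::]) okall); solve_perm.
  by move=> okj z /(okl_notin okj) /andP[]; exact: pjoin_inner.
have I0 z : z \in [:: i0; o0; p0; i1; j1; o1; p1; j2; o2; p2] -> opp q1 z = opp q z.
  by move=> /IL[].
have L0 z : z \in [:: i0; o0; p0; i1; j1; o1; p1; j2; o2; p2] -> lbl q1 z = lbl q z.
  by move=> /IL[].
have q1E : pjoin q i2 j0 = q1 by rewrite pjoin_sym.
have TC : br q [:: C0, C1 & cs] (J ++ smoothing true C2) =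
    br (pjoin (pjoin q1 i0 j1) j2 i1) cs [:: (o0, p1), (p0, o1), (o2, p2) & J].
  have [||] := @bracket_rename_at _ a _ true q [:: C0, C1 & cs] (J ++ smoothing true C2) j0 i2 j2
    ((o2, p2) :: J) wf (okb_smoothing true okC) f2 m2.
  - by rewrite cpts_cons !inE eqxx orbT.
  - by solve_perm.
  have T := tr j0 j2 ([:: i0; o0; p0; i1; j1; o1; p1; i2; o2; p2] ++ pts J ++ cpts cs).
  rewrite /= /map_crossing /= transpL !T ?inE ?eqxx ?orbT //; try solve_perm.
  rewrite map_crossing_id; last by move=> z zcs; apply: T; [solve_perm | rewrite !mem_cat zcs !orbT].
  rewrite -/q1 => -> wf1 ok1.
  by rewrite (bracket_R2 a0 wf1 ok1) // ?I0 ?L0 // !inE eqxx ?orbT.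
have TD : br q [:: D0, D1 & cs] (J ++ smoothing true D2) =
    br (pjoin (pjoin q1 j1 i0) i1 j2) cs [:: (p1, o0), (o2, p2), (p0, o1) & J].
  have [||] := @bracket_rename_at _ a _ true q [:: D0, D1 & cs] (J ++ smoothing true D2) i2 j0 i1
    ((p0, o1) :: J) wf (okb_smoothing true okD) e2 l2.
  - by rewrite cpts_cons !inE eqxx !orbT.
  - by rewrite /D2; solve_perm.
  have T := tr i2 i1 ([:: i0; o0; p0; j0; j1; o1; p1; j2; o2; p2] ++ pts J ++ cpts cs).
  rewrite /= /map_crossing /= transpL !T ?inE ?eqxx ?orbT //; try solve_perm.
  rewrite map_crossing_id; last by move=> z zcs; apply: T; [solve_perm | rewrite !mem_cat zcs !orbT].
  rewrite q1E => -> wf1 ok1.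
  rewrite bracket_half_turns // (bracket_R2 a0 wf1) // ?I0 ?L0 // ?inE ?eqxx ?orbT //.
  rewrite -(@okb_perm _ _ q1 [:: Crossing b0 p1 o2 j1 i1, Crossing (~~ b0) p2 o0 j2 i0 & cs]
              _ ((p0, o1) :: J)) //.
  by solve_perm.
have FC : br q [:: C0, C1 & cs] (J ++ smoothing false C2) =
    br (pjoin q1 i1 j2) [:: Crossing b0 i0 p2 o0 p0, Crossing (~~ b0) o2 j1 o1 p1 & cs] J.
  have [||] := @bracket_rename_at _ a _ false q [:: C0, C1 & cs] (J ++ smoothing false C2) j0 i2 p2
    ((j2, o2) :: J) wf (okb_smoothing false okC) f2 m2.
  - by rewrite cpts_cons !inE eqxx orbT.
  - by solve_perm.
  have T := tr j0 p2 ([:: i0; o0; p0; i1; j1; o1; p1; i2; o2; j2] ++ pts J ++ cpts cs).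
  rewrite /= /map_crossing /= transpL !T ?inE ?eqxx ?orbT //; try solve_perm.
  rewrite map_crossing_id; last by move=> z zcs; apply: T; [solve_perm | rewrite !mem_cat zcs !orbT].
  rewrite -/q1 => -> wf1 ok1.
  have [||||] := @bracket_rename_at _ a _ true q1 _ _ i1 j2 o2 J wf1 ok1.
  - by rewrite ?I0 ?L0 // !inE eqxx ?orbT.
  - by rewrite ?I0 ?L0 // !inE eqxx ?orbT.
  - by rewrite !cpts_cons !inE eqxx !orbT.
  - by solve_perm.
  have {}T := tr i1 o2 ([:: i0; o0; p0; j0; j1; o1; p1; i2; p2; j2] ++ pts J ++ cpts cs).
  rewrite /= /map_crossing /= transpL !T ?inE ?eqxx ?orbT //; try solve_perm.
  by rewrite map_crossing_id // => z zcs; apply: T; [solve_perm | rewrite !mem_cat zcs !orbT].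
have FD : br q [:: D0, D1 & cs] (J ++ smoothing false D2) =
    br (pjoin q1 i1 j2) [:: Crossing b0 p1 o2 j1 o1, Crossing (~~ b0) p2 o0 p0 i0 & cs] J /\
    okb (pjoin q1 i1 j2) [:: Crossing b0 p1 o2 j1 o1, Crossing (~~ b0) p2 o0 p0 i0 & cs] J /\
    wfp (pjoin q1 i1 j2).
  have [||] := @bracket_rename_at _ a _ false q [:: D0, D1 & cs] (J ++ smoothing false D2) i2 j0 o1
    ((i1, p0) :: J) wf (okb_smoothing false okD) e2 l2.
  - by rewrite cpts_cons !inE eqxx !orbT.
  - by rewrite /D2; solve_perm.
  have T := tr i2 o1 ([:: i0; o0; p0; j0; j1; i1; p1; j2; o2; p2] ++ pts J ++ cpts cs).
  rewrite /= /map_crossing /= transpL !T ?inE ?eqxx ?orbT //; try solve_perm.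
  rewrite map_crossing_id; last by move=> z zcs; apply: T; [solve_perm | rewrite !mem_cat zcs !orbT].
  rewrite q1E => -> wf1 ok1.
  have [||||] := @bracket_rename_at _ a _ true q1 _ _ j2 i1 p0 J wf1 ok1.
  - by rewrite ?I0 ?L0 // !inE eqxx ?orbT.
  - by rewrite ?I0 ?L0 // !inE eqxx ?orbT.
  - by rewrite !cpts_cons !inE eqxx !orbT.
  - by solve_perm.
  have {}T := tr j2 p0 ([:: i0; o0; i1; j0; j1; o1; p1; i2; p2; o2] ++ pts J ++ cpts cs).
  rewrite /= /map_crossing /= transpL !T ?inE ?eqxx ?orbT //; try solve_perm.
  rewrite map_crossing_id; last by move=> z zcs; apply: T; [solve_perm | rewrite !mem_cat zcs !orbT].
  by rewrite pjoin_sym.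
case: FD => FD [okF wfF].
pose A := Crossing b0 i0 p2 o0 p0; pose B := Crossing b0 p1 o2 j1 o1.
have okBA : okb (pjoin q1 i1 j2) [:: B, A & cs] J.
  by rewrite okb_swap -okb_rotate okb_swap.
have okAB : okb (pjoin q1 i1 j2) [:: A, B & cs] J by rewrite okb_swap.
(* The two sides now differ only by the order of the crossings and by quarter turns. *)
have FE : br (pjoin q1 i1 j2) [:: A, rotate B & cs] J = br (pjoin q1 i1 j2) [:: B, rotate A & cs] J.
  by rewrite !bracket_rotate_second // (bracket_swap a wfF okAB).
rewrite TC TD FC FD; congr (_ * _ + _ * _)%R; last exact: FE.
have okj : okl q ([:: j0; i2; i0; j1; j2; i1] ++ pts [:: (o0, p1); (o2, p2); (p0, o1)] ++ pts J ++ cpts cs).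
  by apply: (okl_perm_catl (r := [::]) okall); solve_perm.
have wf1 : wfp q1 := wfp_joinl wf okj.
have ok1 := okl_join wf okj.
have wf2 : wfp (pjoin q1 i0 j1) := wfp_joinl wf1 ok1.
have ok2 := okl_join wf1 ok1.
have wf3 : wfp (pjoin (pjoin q1 i0 j1) j2 i1) := wfp_joinl wf2 ok2.
have ok3 := okl_join wf2 ok2.
rewrite (pjoin_sym j1 i0 wf1) (pjoin_sym i1 j2 wf2) (bracket_flip _ _ p1 o0) //.
apply: bracket_permJ => //; last solve_perm.
by rewrite /okb; apply: (okl_perm_catl (r := [::]) ok3); solve_perm.
Qed.

End Reidemeister.

(** * Frames of a diagram *)

Section DiagramBasics.

Context (T : Type) (D : diagram T).

Local Notation ccw := (ccw D).
Local Notation mate := (mate D).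

Lemma ccwK d : ccw (ccw (ccw (ccw d))) = d. Proof. exact: (ccw4 D d). Qed.

Lemma ccw_inj : injective ccw.
Proof. by move=> d e h; rewrite -(ccwK d) h ccwK. Qed.

Lemma over_ccw2 d : is_over D (ccw (ccw d)) = is_over D d.
Proof. by rewrite !over_ccw negbK. Qed.

Lemma ccw_neq d : ccw d <> d.
Proof. by move=> e; apply: (@ccw2_neq _ D d); rewrite /= e. Qed.

Lemma ccw3_neq d : ccw (ccw (ccw d)) <> d.
Proof. by move=> e; apply: (@ccw_neq d); rewrite -{1}e ccwK. Qed.

Lemma mate_inj : injective mate. Proof. exact: inv_inj (mateK D). Qed.

Lemma face_mate d : face D (mate d) = ccw (ccw (ccw d)).
Proof. by rewrite /face mateK. Qed.

Lemma ccw_face d : ccw (face D d) = mate d.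
Proof. by rewrite /face /= ccwK. Qed.

Lemma face_inj : injective (face D).
Proof. by move=> d e; rewrite /face /= => /ccw_inj/ccw_inj/ccw_inj/mate_inj. Qed.

Definition crossing_at d : crossing T :=
  Crossing (is_over D d) d (ccw d) (ccw (ccw d)) (ccw (ccw (ccw d))).

Lemma crossing_at_ccw d : crossing_at (ccw d) = rotate (crossing_at d).
Proof. by rewrite /crossing_at /rotate /= over_ccw ccwK. Qed.

End DiagramBasics.

Section Frames.

Context (G : groupType) (T : eqType) (D : diagram T) (g : T -> G).

Local Notation ccw := (ccw D).
Local Notation mate := (mate D).

Definition side d : G := ((g d)^-1 * g (iter 3 ccw d))%g.

(* A frame is a flat connection: g d compares a trivialization over the region at the
   corner d with one at the crossing of d, so that side d is the transition across the
   edge of d, and the label of d in pairing_of is the transport along this edge. *)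
Definition frame : Prop := forall d, side (mate d) = (side d)^-1%g.

Definition pairing_of : pairing T G := Pairing mate (fun d => g d * (g (face D d))^-1)%g.

Lemma wfp_pairing_of : frame -> wfp pairing_of.
Proof.
move=> fr; split=> [|d] /=; first exact: mateK.
have := fr d; rewrite /side -[iter 3 ccw d]face_mate /face invgM invgK mateK.
move: (g d) (g (iter 3 ccw d)) (g (mate d)) (g (iter 3 ccw (mate d))) => A B C F e.
have -> : F = (C * (B^-1 * A))%g by rewrite -e mulgA mulgV mul1g.
by rewrite invgM invgK -!mulgA mulgV mulg1.
Qed.

Lemma frame_lbl :
  (forall d, lbl pairing_of (mate d) = (lbl pairing_of d)^-1)%g -> frame.
Proof.
move=> h d; have := h d; rewrite /side -[iter 3 ccw d]face_mate /= /face invgM invgK mateK.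
move: (g d) (g (iter 3 ccw d)) (g (mate d)) (g (iter 3 ccw (mate d))) => A B C F e.
have -> : F = (C * B^-1 * A)%g by rewrite e -mulgA mulVg mulg1.
by rewrite invgM invgK -!mulgA mulKg.
Qed.

End Frames.

Lemma bracket_perm_map (G : groupType) a (E S : eqType) (p : pairing E G) (F : S -> crossing E) s s' J :
  wfp p -> okb p (map F s) J -> perm_eq s s' ->
  bracket a p (map F s) J = bracket a p (map F s') J.
Proof.
move=> wf; elim: s s' J => [|x s IH] s' J ok e.
  by case: s' e => // y s' /perm_size.
have := perm_mem e x; rewrite mem_head => /esym/splitPr xs'.
case: xs' e => s1 s2 e.
have e' : perm_eq s (s1 ++ s2).
  by rewrite -(perm_cons x) (perm_trans e) // -cat1s perm_catCA.
have okx : okb p (map F s1 ++ F x :: map F s2) J.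
  rewrite /okb -(perm_okl _ (s := pts J ++ cpts (map F (x :: s)))) // perm_cat2l.
  rewrite -map_cons -map_cat /cpts -!map_comp.
  by apply: perm_flatten; exact: perm_map.
rewrite [in RHS]map_cat /= (bracket_front a wf okx) -map_cat.
rewrite /bracket -/(bracket _).
by congr (_ * _ + _ * _)%R; apply: IH => //; exact: okb_smoothing.
Qed.

(** * One dart for every crossing *)

Section Transversals.

Context (T : finType) (D : diagram T).

Local Notation ccw := (ccw D).

Definition quad d : seq T := [:: d; ccw d; ccw (ccw d); ccw (ccw (ccw d))].

(** Singles out one dart per crossing, the one at which [writhe] counts it. *)
Definition is_rep d := is_over D d && is_out D d.

Definition reps : seq T := [seq d <- enum T | is_rep d].

Definition transversal (s : seq T) : bool :=
  perm_eq (cpts (map (crossing_at D) s)) (enum T).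

Lemma quad_sym d e : (d \in quad e) = (e \in quad d).
Proof.
suff H x y : x \in quad y -> y \in quad x by apply/idP/idP; exact: H.
by rewrite !inE => /or4P[] /eqP ->; rewrite ?ccwK ?eqxx ?orbT.
Qed.

Lemma quad_trans d e x : d \in quad e -> e \in quad x -> d \in quad x.
Proof.
by rewrite !inE => /or4P[] /eqP -> /or4P[] /eqP ->; rewrite ?ccwK ?eqxx ?orbT.
Qed.

Lemma uniq_quad d : uniq (quad d).
Proof.
have n1 x : (x == ccw x) = false by apply/eqP => /esym; exact: ccw_neq.
have n2 x : (x == ccw (ccw x)) = false by apply/eqP => /esym; exact: ccw2_neq.
have n3 x : (x == ccw (ccw (ccw x))) = false by apply/eqP => /esym; exact: ccw3_neq.
by rewrite /= !inE !n1 !n2 n3.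
Qed.

Lemma rep_unique d e : is_rep d -> is_rep e -> d \in quad e -> d = e.
Proof.
rewrite /is_rep !inE => /andP[od ud] /andP[oe ue] /or4P[] /eqP // h; move: od ud;
  by rewrite h !(over_ccw, out_opposite) ?oe ?ue.
Qed.

Lemma rep_exists d : exists2 e, is_rep e & e \in quad d.
Proof.
have [od|od] := boolP (is_over D d); have [ud|ud] := boolP (is_out D d).
- by exists d; rewrite ?mem_head // /is_rep od.
- by exists (ccw (ccw d)); rewrite /is_rep ?over_ccw2 ?od ?out_opposite ?ud // !inE eqxx !orbT.
- case: (boolP (is_out D (ccw d))) => uc.
    by exists (ccw d); rewrite /is_rep ?over_ccw ?od // !inE eqxx !orbT.
  by exists (ccw (ccw (ccw d))); rewrite /is_rep ?over_ccw2 ?over_ccw ?od ?out_opposite ?uc // !inE eqxx !orbT.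
case: (boolP (is_out D (ccw d))) => uc.
  by exists (ccw d); rewrite /is_rep ?over_ccw ?od // !inE eqxx !orbT.
by exists (ccw (ccw (ccw d))); rewrite /is_rep ?over_ccw2 ?over_ccw ?od ?out_opposite ?uc // !inE eqxx !orbT.
Qed.

Lemma mem_quads s x :
  (x \in cpts (map (crossing_at D) s)) = has (fun d => x \in quad d) s.
Proof.
by elim: s => //= d s IH; rewrite cpts_cons !in_cons IH in_nil orbF /= -!orbA.
Qed.

Lemma uniq_quads s : uniq s -> all is_rep s -> uniq (cpts (map (crossing_at D) s)).
Proof.
elim: s => // d s IH; rewrite cons_uniq => /andP[ds us] /andP[rd rs].
rewrite map_cons cpts_cons -[X in uniq X]/(quad d ++ _) cat_uniq uniq_quad IH // andbT.
apply/hasPn => x; rewrite mem_quads => /hasP[e es xe]; apply: contra ds => xd.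
suff -> : d = e by [].
by apply: rep_unique => //; [exact: (allP rs) | apply: quad_trans xe; rewrite quad_sym].
Qed.

Lemma reps_transversal : transversal reps.
Proof.
apply: uniq_perm => [||x]; last 1 first.
- rewrite mem_enum inE mem_quads; apply/hasP.
  by have [e re ex] := rep_exists x; exists e; [rewrite mem_filter re mem_enum | rewrite quad_sym].
- apply: uniq_quads; first by rewrite filter_uniq ?enum_uniq.
  by apply/allP => d; rewrite mem_filter => /andP[].
exact: enum_uniq.
Qed.

Lemma okb_transversal (G : groupType) (g : T -> G) s :
  transversal s -> okb (pairing_of D g) (map (crossing_at D) s) [::].
Proof.
move=> ts; rewrite /okb (perm_okl _ ts) /okl enum_uniq.
by apply/allP => d _; apply/eqP => /=; exact: mate_neq.
Qed.

Lemma bracket_reps (G : groupType) a (p : pairing T G) (f : T -> T) s J :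
  wfp p -> (forall d, f d \in quad d) -> okb p (map (crossing_at D) s) J ->
  bracket a p (map (crossing_at D) (map f s)) J = bracket a p (map (crossing_at D) s) J.
Proof.
move=> wf fq; elim: s J => // d s IH J ok /=.
have rot cs : okb p (crossing_at D d :: cs) J ->
    bracket a p (crossing_at D (f d) :: cs) J = bracket a p (crossing_at D d :: cs) J.
  move=> okc; have := fq d; rewrite !inE => /or4P[] /eqP -> //; rewrite !crossing_at_ccw !bracket_rotate //;
    rewrite ?okb_rotate //.
have okf : okb p (crossing_at D d :: map (crossing_at D) (map f s)) J.
  suff e : perm_eq (cpts (map (crossing_at D) (map f s))) (cpts (map (crossing_at D) s)).
    by rewrite /okb -(perm_okl _ (s := pts J ++ cpts (map (crossing_at D) (d :: s)))) // perm_cat2l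
         /= !cpts_cons !perm_cons perm_sym.
  elim: (s) => //= x s' IHs; rewrite !cpts_cons.
  rewrite -[X in perm_eq X _]/(quad (f x) ++ _) -[X in perm_eq _ X]/(quad x ++ _).
  apply: perm_cat => //; have := fq x; rewrite !inE => /or4P[] /eqP ->; rewrite // /quad !ccwK; solve_perm.
rewrite rot // /bracket -/(bracket _).
by congr (_ * _ + _ * _)%R; apply: IH; exact: okb_smoothing.
Qed.

(** Changing the dart chosen at a crossing is a [rotate]; each move may therefore list the crossings
    from the darts that suit it. *)
Lemma bracket_transversal (G : groupType) a (g : T -> G) s : frame D g -> transversal s ->
  bracket a (pairing_of D g) (map (crossing_at D) s) [::] =
  bracket a (pairing_of D g) (map (crossing_at D) reps) [::].
Proof.
move=> fr ts; have wf := wfp_pairing_of fr.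
have /choice[r rP] : forall d, exists e, is_rep e && (e \in quad d).
  by move=> d; have [e re ed] := rep_exists d; exists e; rewrite re.
have rq d : r d \in quad d by case/andP: (rP d).
rewrite -(bracket_reps a wf rq) ?okb_transversal //; apply/esym.
apply: bracket_perm_map => //; first exact/okb_transversal/reps_transversal.
have memq x : has (fun d => x \in quad d) s by rewrite -mem_quads (perm_mem ts) mem_enum.
have uq : uniq (cpts (map (crossing_at D) s)) by rewrite (perm_uniq ts) enum_uniq.
apply: uniq_perm; first by rewrite filter_uniq ?enum_uniq.
  elim: (s) uq => // d s' IH; rewrite !map_cons cpts_cons -[X in uniq X]/(quad d ++ _) cat_uniq cons_uniq.
  move=> /and3P[_ /hasPn nd /IH us]; apply/andP; split; last exact: us.
  apply/mapP => -[e es e_d].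
  have := nd (r d); rewrite mem_quads => /(_ _)/negP; apply; last exact: rq.
  by apply/hasP; exists e => //; rewrite e_d.
move=> x; rewrite mem_filter mem_enum andbT; apply/idP/mapP => [rx|[d _ ->]]; last by case/andP: (rP d).
have /hasP[d ds xd] := memq x; exists d => //.
apply: rep_unique => //; first by case/andP: (rP d).
by apply: quad_trans xd _; rewrite quad_sym.
Qed.

End Transversals.

(** * Following strands through gluings *)

Section Exits.

Context (E : eqType) (G : groupType).
Implicit Types (p : pairing E G) (J : seq (E * E)).

(** Arcs and gluings alternate from [x] until an unglued end [y] is met. Being inductive, the
    relation excludes strands that run around a loop forever. *)
Inductive exits p J : E -> E -> Prop :=
| exit_now x y : opp p x = y -> y \notin pts J -> exits p J x y
| exit_step x u v y : opp p x = u -> (u, v) \in J \/ (v, u) \in J ->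
    exits p J v y -> exits p J x y.

Lemma mem_pts u v J : (u, v) \in J -> (u \in pts J) && (v \in pts J).
Proof.
by elim: J => // -[a b] J IH; rewrite in_cons pts_cons !in_cons => /orP[/eqP[-> ->]|/IH/andP[-> ->]];
  rewrite ?eqxx ?orbT.
Qed.

(** Induction step for gluing the pairs one by one: a path starting at the glued end [b] is
    continued from the arc arriving at [a], and conversely. An exit from a glued end also shows that
    [a] and [b] do not bound one arc. *)
Lemma exits_join p a b J x y : wfp p -> okl p (pts ((a, b) :: J)) ->
  exits p ((a, b) :: J) x y ->
  [/\ x != a -> x != b -> exits (pjoin p a b) J x y,
      x = b -> opp p b != a /\ forall z, opp p z = a -> z != b -> exits (pjoin p a b) J z y &
      x = a -> opp p a != b /\ forall z, opp p z = b -> z != a -> exits (pjoin p a b) J z y].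
Proof.
move=> [mK _]; rewrite pts_cons => /andP[/= /and3P[]]; rewrite inE negb_or.
move=> /andP[ab aJ] bJ _ /and3P[la lb _].
have K u v : opp p u = v -> u = opp p v by move=> <-; rewrite mK.
have oppN z : z != a -> z != b -> opp p z != a -> opp p z != b ->
    opp (pjoin p a b) z = opp p z.
  move=> /negPf za /negPf zb ha hb /=; rewrite za zb /=.
  by case: eqP => [e|_]; [rewrite e mK eqxx in ha | case: eqP => // e; rewrite e mK eqxx in hb].
have oppA z : opp p z = a -> z != b -> opp (pjoin p a b) z = opp p b.
  move=> za zb /=; rewrite (negPf zb) -(K _ _ za) eqxx orbF.
  by case: eqP => // e; move: la; rewrite /live -e za -e eqxx.
have oppB z : opp p z = b -> z != a -> opp (pjoin p a b) z = opp p a.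
  move=> zb za /=; rewrite (negPf za) /= -(K _ _ zb) eqxx.
  case: eqP => [e|_]; first by move: lb; rewrite /live -e zb -e eqxx.
  by case: eqP => // e; rewrite e mK in zb; rewrite zb eqxx in ab.
elim=> {x y} [x y xy | x u v y xu uv _ [IH0 IHb IHa]].
  rewrite pts_cons !in_cons !negb_or => /and3P[ya yb yJ]; split=> [xa xb | xb | xa].
  - by apply: exit_now => //; rewrite oppN ?xy.
  - subst x; rewrite xy; split=> // z za zb; apply: exit_now => //.
    by rewrite oppA.
  - subst x; rewrite xy; split=> // z zb za; apply: exit_now => //.
    by rewrite oppB.
have {}uv : [\/ u = a /\ v = b, u = b /\ v = a | [/\ u != a, u != b, v != a, v != b &
    (u, v) \in J \/ (v, u) \in J]].
  have memJ s t : (s, t) \in J -> [&& s != a, s != b, t != a & t != b].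
    move=> /mem_pts/andP[sJ tJ].
    by apply/and4P; split; apply/eqP => e; rewrite -e ?sJ ?tJ in aJ bJ.
  case: uv; rewrite in_cons => /orP[/eqP[-> ->]|h].
  - by constructor 1.
  - by constructor 3; case/and4P: (memJ _ _ h) => *; split=> //; left.
  - by constructor 2.
  - by constructor 3; case/and4P: (memJ _ _ h) => *; split=> //; right.
case: uv => [[ua vb] | [ub va] | [ua ub va vb uvJ]]; split=> [xa xb | xb | xa].
- by have [_ H] := IHb vb; apply: H; rewrite // -ua.
- by have [/eqP[]] := IHb vb; rewrite -xb -ua.
- by move: la; rewrite /live -[X in opp p X]xa xu ua eqxx.
- by have [_ H] := IHa va; apply: H; rewrite // -ub.
- by move: lb; rewrite /live -[X in opp p X]xb xu ub eqxx.
- by have [/eqP[]] := IHa va; rewrite -xa -ub.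
- by apply: (exit_step _ uvJ (IH0 va vb)); rewrite oppN ?xu.
- subst x; rewrite xu; split=> // z za zb; apply: (exit_step _ uvJ (IH0 va vb)).
  by rewrite oppA.
- subst x; rewrite xu; split=> // z zb za; apply: (exit_step _ uvJ (IH0 va vb)).
  by rewrite oppB.
Qed.

Lemma exits_nil p x y : exits p [::] x y -> opp p x = y.
Proof. by case=> // ? ? ? ? _ []. Qed.

End Exits.

(** Every gluing of [J] lies on a strand that exits, so none closes a loop and no factor [delta a]
    appears. The fused arcs are those of the smaller diagram, with the right labels by
    [join_potential]. *)
Lemma bracket_exits (G : groupType) a (E' E : eqType) (p' : pairing E' G) (p : pairing E G)
    (f : E' -> E) cs J (l r : E -> G) :
  injective f -> wfp p -> okb p (map (map_crossing f) cs) J ->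
  (forall x, f x \notin pts J) -> (forall x, live p (f x)) ->
  (forall x, exits p J (f x) (f (opp p' x))) ->
  (forall j, j \in J -> exists y, exits p J j.2 y) ->
  (forall j, j \in J -> r j.1 = l j.2 /\ r j.2 = l j.1) ->
  (forall z, live p z -> lbl p z = l z * (r (opp p z))^-1)%g ->
  (forall x, lbl p' x = l (f x) * (r (f (opp p' x)))^-1)%g ->
  bracket a p (map (map_crossing f) cs) J = bracket a p' cs [::].
Proof.
move=> inj; elim: J p => [|[u v] J IH] p wf ok fJ lf fe Je lrJ hl hl'.
  apply: (@bracket_map _ _ _ _ f p' p cs [::]) => // z; first exact: exits_nil.
  by rewrite hl // hl' (exits_nil (fe z)).
have okJ := okl_catl ok.
have ok2 : okl p [:: u; v] by apply: (@okl_catl _ _ _ [:: u; v] (pts J)).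
have neq x : (f x != u) && (f x != v).
  by have := fJ x; rewrite pts_cons !in_cons !negb_or => /and3P[-> ->].
have [w] := Je _ (mem_head _ _) => /= /(exits_join wf okJ)[_ /(_ erefl)[vu _] _].
rewrite bracket_join /loop.
have -> : (opp p u == v) = false.
  by apply/eqP => e; move: vu; rewrite -e; case: wf => -> _; rewrite eqxx.
rewrite mul1r; have /= [h1 h2] := lrJ _ (mem_head _ _).
have Juv j : j \in J -> (j.2 != u) && (j.2 != v).
  case: j => s t /mem_pts/andP[_ tJ] /=; case/andP: okJ => /= /and3P[].
  rewrite in_cons negb_or => /andP[_ uJ] vJ _ _.
  by apply/andP; split; apply/eqP => e; rewrite -e tJ in uJ vJ.
apply: IH.
- exact: wfp_joinl ok.
- exact: okl_join ok.
- by move=> x; have := fJ x; rewrite pts_cons !in_cons !negb_or => /and3P[].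
- move=> x; rewrite live_join ?lf ?neq //; first by case/andP: ok2 => _ /and3P[].
    by case/andP: ok2 => _ /and3P[].
  exact: okl_neq ok2.
- by move=> x; have /andP[xu xv] := neq x; have [H _ _] := exits_join wf okJ (fe x); exact: H.
- move=> j jJ; have [|y /(exits_join wf okJ)[H _ _]] := Je j; first by rewrite in_cons jJ orbT.
  by exists y; have /andP[ju jv] := Juv j jJ; exact: H.
- by move=> j jJ; apply: lrJ; rewrite in_cons jJ orbT.
- exact: join_potential.
- exact: hl'.
Qed.

(** * Deleting crossings *)

Section ExitsTheory.

Context (E : eqType) (G : groupType).
Implicit Types (p : pairing E G) (J : seq (E * E)).

Lemma exits_invariant (Y : Type) (iota : Y -> Y) p J (c : E -> Y) x y :
  involutive iota -> (forall z, live p z -> c (opp p z) = iota (c z)) ->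
  (forall j, j \in J -> c j.1 = iota (c j.2)) -> all (live p) (pts J) ->
  live p x -> exits p J x y -> c y = iota (c x).
Proof.
move=> iK hc hJ lJ lx h; elim: h lx => {x y} [x y <- _ lx | x u v y <- uv _ IH lx]; first exact: hc.
have [cuv lv] : c (opp p x) = iota (c v) /\ live p v.
  case: uv => uv; have /andP[uJ vJ] := mem_pts uv.
    by split; [exact: (hJ _ uv) | exact: (allP lJ)].
  by split; [rewrite (hJ _ uv) iK | exact: (allP lJ)].
by rewrite IH // -cuv hc.
Qed.

Definition pjoins p J := foldl (fun p j => pjoin p j.1 j.2) p J.

Lemma exits_pjoins p J x y : wfp p -> okl p (pts J) -> x \notin pts J ->
  exits p J x y -> opp (pjoins p J) x = y.
Proof.
elim: J p => [|[a b] J IH] p wf ok xJ h; first exact: exits_nil.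
move: xJ; rewrite pts_cons !in_cons !negb_or => /and3P[xa xb xJ].
have [H _ _] := exits_join wf ok h.
by apply: IH => //; [exact: wfp_joinl ok | exact: okl_join ok | exact: H].
Qed.

Lemma live_pjoins p J z : wfp p -> okl p (pts J) ->
  live (pjoins p J) z = live p z && (z \notin pts J).
Proof.
elim: J p => [|[a b] J IH] p wf ok; first by rewrite andbT.
rewrite [LHS]IH; [|exact: wfp_joinl ok|exact: okl_join ok].
have ok2 : okl p [:: a; b] by exact: (@okl_catl _ _ _ [:: a; b] (pts J) ok).
rewrite live_join //; first by rewrite pts_cons !in_cons !negb_or -!andbA.
- by case/andP: ok2 => _ /and3P[].
- by case/andP: ok2 => _ /and3P[].
exact: okl_neq ok2.
Qed.

(** The gluings are undone from the last to the first. As [opp p a] is not [b], the values at [a]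
    and [b] can be read off at the far ends of their arcs; around a closed loop there would be no
    such ends, and the exits rule this out. *)
Lemma extend_invariant (Y : Type) (iota : Y -> Y) p J (c0 : E -> Y) :
  involutive iota -> wfp p -> okl p (pts J) ->
  (forall j, j \in J -> exists y, exits p J j.2 y) ->
  (forall z, live (pjoins p J) z -> c0 (opp (pjoins p J) z) = iota (c0 z)) ->
  exists c : E -> Y, [/\ forall z, z \notin pts J -> c z = c0 z,
    forall z, live p z -> c (opp p z) = iota (c z) &
    forall j, j \in J -> c j.2 = iota (c j.1)].
Proof.
move=> iK; elim: J p => [|[a b] J IH] p wf ok Je hc; first by exists c0.
have wf1 := wfp_joinl wf ok; have ok1 := okl_join wf ok.
have ok2 : okl p [:: a; b] by exact: (@okl_catl _ _ _ [:: a; b] (pts J) ok).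
have [w] := Je _ (mem_head _ _) => /= /(exits_join wf ok)[_ /(_ erefl)[ba _] _].
have ab : a != b by exact: okl_neq ok2.
have /andP[/= /and3P[aJ bJ _] /and3P[la lb _]] := ok.
rewrite in_cons negb_or in aJ; case/andP: aJ => _ aJ.
have neqJ j : j \in J -> [/\ (j.1 == a) = false, (j.1 == b) = false, (j.2 == a) = false & (j.2 == b) = false].
  case: j => s t /mem_pts/andP[sJ tJ].
  by split; apply/eqP => /= e; rewrite -e ?sJ ?tJ in aJ bJ.
have Je1 j : j \in J -> exists y, exits (pjoin p a b) J j.2 y.
  move=> jJ; have [|y /(exits_join wf ok)[H _ _]] := Je j; first by rewrite in_cons jJ orbT.
  by exists y; have [_ _ ja jb] := neqJ j jJ; apply: H; rewrite ?ja ?jb.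
have [c [c_out c_opp c_J]] := IH _ wf1 ok1 Je1 hc.
have [mK _] := wf.
have ab' : opp p a != b by apply: contra ba => /eqP <-; rewrite mK.
have la' : (opp p a == a) = false by apply/negbTE.
have lb' : (opp p b == b) = false by apply/negbTE.
pose c1 z := if z == a then iota (c (opp p a)) else if z == b then iota (c (opp p b)) else c z.
exists c1; split.
- by move=> z; rewrite pts_cons !in_cons !negb_or /c1 => /and3P[/negPf-> /negPf-> /c_out].
- move=> z lz; rewrite /c1; case: (z =P a) => [->|/eqP za].
    by rewrite la' (negPf ab') iK.
  case: (z =P b) => [->|/eqP zb]; first by rewrite lb' (negPf ba) iK.
  case: eqP => [e|/eqP na]; first by rewrite -e mK.
  case: eqP => [e|/eqP nb]; first by rewrite -e mK.
  rewrite -c_opp /=; last first.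
    rewrite live_join // lz za zb //.
  rewrite (negPf za) (negPf zb) /=.
  by case: eqP => [e|_]; [rewrite e mK eqxx in na | case: eqP => // e; rewrite e mK eqxx in nb].
move=> j; rewrite in_cons => /orP[/eqP->|jJ] /=.
  rewrite /c1 eqxx (eq_sym b) (negPf ab) eqxx iK -c_opp /=.
    by rewrite (negPf ba) lb' /=; case: eqP => [->|_]; rewrite ?eqxx.
  by rewrite live_join // lb' (negPf ba) /live mK eq_sym lb'.
by have [h1 h2 h3 h4] := neqJ j jJ; rewrite /c1 h1 h2 h3 h4; exact: c_J.
Qed.

End ExitsTheory.

Definition signum (T : Type) (D : diagram T) (d : T) : int :=
  (if is_out D (ccw D d) then 1 else -1)%R.

Lemma writhe_reps (D : motif) : writhe D = (\sum_(d <- reps D) signum D d)%R.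
Proof. by rewrite /writhe /reps big_filter [RHS]big_enum_cond. Qed.

Lemma signum_quad (T : finType) (D : diagram T) d :
  (\sum_(x <- quad D d | is_rep D x) signum D x =
   if (is_out D d == is_out D (ccw D d)) == is_over D d then 1 else -1)%R.
Proof.
rewrite !big_cons big_nil /is_rep /signum !(over_ccw, out_opposite).
by case: (is_over D d) (is_out D d) (is_out D (ccw D d)) => [] [] [].
Qed.

Definition through (T : Type) (D : diagram T) (d : T) : T := mate D (ccw D (ccw D d)).

Record deletion (D D' : motif) (K : dart D -> Prop) (f : dart D' -> dart D) : Prop := Deletion {
  del_inj : injective f;
  del_im : forall d, (exists x, f x = d) <-> ~ K d;
  del_mor : forall x, [/\ f (ccw D' x) = ccw D (f x),
    is_over D (f x) = is_over D' x & is_out D (f x) = is_out D' x];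
  del_exit : forall d, exists k, ~ K (iter k (through D) d);
  del_mate : forall x, exists2 k, f (mate D' x) = iter k (through D) (mate D (f x)) &
    forall l, l < k -> K (iter l (through D) (mate D (f x))) }.

(* The deleted darts are those of the edges joining deleted crossings inside the
   move (inner) and the two ends of each deleted strand (the pairs of J). *)
Record strands (D : motif) (K : dart D -> Prop) (inner : seq (dart D))
    (J : seq (dart D * dart D)) : Prop := Strands {
  str_split : forall d, K d <-> (d \in inner ++ pts J);
  str_inner : forall d, d \in inner -> mate D d \in inner;
  str_uniq : uniq (inner ++ pts J);
  str_through : forall u v, (u, v) \in J \/ (v, u) \in J ->
    K (through D u) /\ through D (through D u) = mate D v }.

Section Deletion.

Context (G : groupType) (D D' : motif) (K : dart D -> Prop) (f : dart D' -> dart D).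
Context (inner : seq (dart D)) (J : seq (dart D * dart D)).
Context (del : deletion K f) (str : strands K inner J).

Local Notation through := (through D).

Let f_inj := del_inj del.
Let f_im := del_im del.
Let f_mor := del_mor del.
Let f_exit := del_exit del.
Let f_mate := del_mate del.
Let K_split := str_split str.
Let inner_mate := str_inner str.
Let uniqK := str_uniq str.
Let J_through := str_through str.

Lemma inner_ptsF d : d \in inner -> d \in pts J -> False.
Proof.
move=> di dJ; move: uniqK; rewrite cat_uniq => /and3P[_ /hasPn h _].
by have := h _ dJ; rewrite di.
Qed.

Lemma image_notin x : f x \notin inner ++ pts J.
Proof. by apply/negP => /K_split h; have /f_im := ex_intro (fun y => f y = f x) x erefl. Qed.

Lemma partner u : u \in pts J -> exists v, (u, v) \in J \/ (v, u) \in J.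
Proof.
elim: (J) => // -[a b] J' IH; rewrite pts_cons !in_cons => /or3P[/eqP->|/eqP->|/IH[v h]].
- by exists b; left; rewrite in_cons eqxx.
- by exists a; right; rewrite in_cons eqxx.
by exists v; rewrite !in_cons; case: h => ->; rewrite orbT; [left | right].
Qed.

(** A deleted strand takes exactly two steps of [through], one for each passage of a deleted
    crossing, so the induction advances by two. *)
Lemma first_exit (p : pairing (dart D) G) k x :
  (forall z, z \notin inner -> opp p z = mate D z) ->
  x \notin inner -> ~ K (iter k through (mate D x)) ->
  (forall l, l < k -> K (iter l through (mate D x))) ->
  exits p J x (iter k through (mate D x)).
Proof.
move=> hp; have [n] := ubnP k; elim: n k x => // n IH [|k] x kn xi nK lK.
  apply: exit_now; first exact: hp.
  by apply/negP => xJ; apply: nK; apply/K_split; rewrite mem_cat xJ orbT.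
have /K_split := lK 0 (ltn0Sn _); rewrite /= mem_cat => /orP[h|h].
  by case/negP: xi; rewrite -(mateK D x); exact: inner_mate.
have [v uv] := partner h; have [Kt tt] := J_through uv.
case: k kn nK lK => [|k] kn nK lK; first by case: nK.
apply: (exit_step (hp _ xi) uv).
have it l : iter l.+2 through (mate D x) = iter l through (mate D v).
  by rewrite !iterSr; congr (iter l _ _).
rewrite -[X in exits _ _ _ X]/(iter k.+2 through (mate D x)) it; apply: IH => //.
- by rewrite ltnS in kn; exact: ltn_trans kn.
- have vJ : v \in pts J by case: uv => /mem_pts/andP[].
  by apply/negP => vi; exact: inner_ptsF vi vJ.
- by rewrite -it.
by move=> l lk; rewrite -it; apply: lK; rewrite !ltnS.
Qed.

Lemma exits_image (p : pairing (dart D) G) x :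
  (forall z, z \notin inner -> opp p z = mate D z) ->
  exits p J (f x) (f (mate D' x)).
Proof.
move=> hp; have [k e lK] := f_mate x; rewrite e; apply: first_exit => //.
  by have := image_notin x; rewrite mem_cat negb_or => /andP[].
by rewrite -e; apply/f_im; exists (mate D' x).
Qed.

Lemma exits_partner (p : pairing (dart D) G) j :
  (forall z, z \notin inner -> opp p z = mate D z) ->
  j \in J -> exists y, exits p J j.2 y.
Proof.
move=> hp jJ; have ex : exists k, `[< ~ K (iter k through (mate D j.2)) >].
  by have [k h] := f_exit (mate D j.2); exists k; apply/asboolP.
exists (iter (ex_minn ex) through (mate D j.2)); case: ex_minnP => k /asboolP nK kmin.
apply: first_exit => //.
  have /andP[_ jJ'] : (j.1 \in pts J) && (j.2 \in pts J) by apply: mem_pts; case: (j) jJ.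
  by apply/negP => ji; exact: inner_ptsF ji jJ'.
move=> l lk; apply: contrapT => nKl.
by have := kmin l; rewrite leqNgt lk => /(_ _)/negP; apply => //; apply/asboolP.
Qed.

Lemma perm_darts : perm_eq (enum (dart D)) ((inner ++ pts J) ++ map f (enum (dart D'))).
Proof.
apply: uniq_perm => [||x]; first exact: enum_uniq.
  rewrite cat_uniq uniqK map_inj_uniq // enum_uniq andbT /=.
  by apply/hasPn => _ /mapP[y _ ->]; exact: image_notin.
rewrite mem_enum inE mem_cat; apply/esym.
case: (boolP (x \in inner ++ pts J)) => //= xK.
have /f_im[y <-] : ~ K x by move=> /K_split; rewrite (negPf xK).
by rewrite map_f // mem_enum.
Qed.

Lemma crossing_at_image x : crossing_at D (f x) = map_crossing f (crossing_at D' x).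
Proof.
have [h1 h2 _] := f_mor x; have [h3 _ _] := f_mor (ccw D' x).
have [h4 _ _] := f_mor (ccw D' (ccw D' x)).
by rewrite /crossing_at /map_crossing /= h4 h3 h1 h2.
Qed.

Lemma map_crossing_at s : map (crossing_at D) (map f s) =
  map (map_crossing f) (map (crossing_at D') s).
Proof. by rewrite -!map_comp; apply: eq_map => x /=; exact: crossing_at_image. Qed.

Lemma transversal_deletion s0 :
  perm_eq (cpts (map (crossing_at D) s0)) (inner ++ pts J) ->
  transversal D (s0 ++ map f (reps D')).
Proof.
move=> e; rewrite /transversal perm_sym (perm_trans perm_darts) // perm_sym.
rewrite map_cat cpts_cat map_crossing_at cpts_map; apply: perm_cat => //.
by apply: perm_map; exact: reps_transversal.
Qed.

Lemma writhe_deletion :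
  (writhe D = \sum_(d <- inner ++ pts J | is_rep D d) signum D d + writhe D')%R.
Proof.
rewrite !writhe_reps /reps big_filter (perm_big _ perm_darts) big_cat /=; congr (_ + _)%R.
rewrite big_map big_filter; apply: eq_big => x; rewrite /is_rep /signum.
  by case: (f_mor x) => _ -> ->.
by move=> _; case: (f_mor x) => <- _ _; case: (f_mor (ccw D' x)) => _ _ ->.
Qed.

(** Its labels are trivial because it only serves to follow the strands once the inner edges are
    removed. *)
Definition bypass : pairing (dart D) G :=
  Pairing (fun z => if z \in inner then z else mate D z) (fun=> 1%g).

Lemma wfp_bypass : wfp bypass.
Proof.
split=> z /=; last by rewrite invg1.
case: (boolP (z \in inner)) => [->//|zi]; rewrite ifN ?mateK //.
by apply: contra zi => /inner_mate; rewrite mateK.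
Qed.

Lemma live_bypass z : z \notin inner -> live bypass z.
Proof. by move=> zi; rewrite /live /= (negPf zi); apply/eqP; exact: mate_neq. Qed.

Lemma pts_notin_inner z : z \in pts J -> z \notin inner.
Proof. by move=> zJ; apply/negP => zi; exact: inner_ptsF zi zJ. Qed.

Lemma okl_bypass : okl bypass (pts J).
Proof.
apply/andP; split; first by move: uniqK; rewrite cat_uniq => /and3P[].
by apply/allP => z zJ; apply: live_bypass; exact: pts_notin_inner.
Qed.

Lemma bypassE z : z \notin inner -> opp bypass z = mate D z.
Proof. by move=> /negPf /= ->. Qed.

Lemma image_notin_pts x : f x \notin pts J.
Proof. by have := image_notin x; rewrite mem_cat negb_or => /andP[]. Qed.

Lemma image_notin_inner x : f x \notin inner.
Proof. by have := image_notin x; rewrite mem_cat negb_or => /andP[]. Qed.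

(** The transitions across the edges of [D'] are spread along the strands of [D] from which these
    come. Corner values realizing them are then chosen for each move separately. *)
Lemma extend_side (g' : dart D' -> G) : frame D' g' ->
  exists N : dart D -> G, [/\ forall x, N (f x) = side D' g' x,
    forall z, z \notin inner -> N (mate D z) = (N z)^-1%g &
    forall j, j \in J -> N j.2 = (N j.1)^-1%g].
Proof.
move=> fr.
pose c0 z := if [pick x | f x == z] is Some x then side D' g' x else 1%g.
have c0f x : c0 (f x) = side D' g' x.
  rewrite /c0; case: pickP => [y /eqP/f_inj -> //|/(_ x)]; by rewrite eqxx.
have ie j : j \in J -> exists y, exits bypass J j.2 y by exact/exits_partner/bypassE.
have invol : involutive (fun x : G => x^-1)%g by move=> x; rewrite invgK.
have hc z : live (pjoins bypass J) z -> c0 (opp (pjoins bypass J) z) = (c0 z)^-1%g.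
  rewrite live_pjoins ?okl_bypass //; last exact: wfp_bypass.
  case/andP=> lz zJ; have zi : z \notin inner.
    by apply/negP => zi; move: lz; rewrite /live /= zi eqxx.
  have /f_im[x <-] : ~ K z by move/K_split; rewrite mem_cat (negPf zJ) (negPf zi).
  rewrite (exits_pjoins wfp_bypass okl_bypass (image_notin_pts x) (exits_image x bypassE)).
  by rewrite !c0f fr.
have [N [N1 N2 N3]] := extend_invariant invol wfp_bypass okl_bypass ie hc.
exists N; split=> // [x|z zi].
  by rewrite N1 ?c0f // image_notin_pts.
by rewrite -N2 ?live_bypass // bypassE.
Qed.

(** The hypothesis on [J] matches the two sides of a deleted strand at its two ends, so the
    transition across the strand is constant along it. *)
Lemma frame_deletion (g : dart D -> G) : frame D g ->
  (forall j, j \in J -> g (iter 3 (ccw D) j.1) = g j.2 /\ g (iter 3 (ccw D) j.2) = g j.1) ->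
  frame D' (g \o f).
Proof.
move=> fr gJ x.
have sf y : side D' (g \o f) y = side D g (f y).
  rewrite /side /=; have [<- _ _] := f_mor y; have [<- _ _] := f_mor (ccw D' y).
  by have [<- _ _] := f_mor (ccw D' (ccw D' y)).
have invol : involutive (fun x : G => x^-1)%g by move=> y; rewrite invgK.
rewrite !sf; apply: (exits_invariant (c := side D g) invol) (exits_image x bypassE).
- by move=> z lz; rewrite bypassE ?fr //; apply/negP => zi; move: lz; rewrite /live /= zi eqxx.
- by move=> j /gJ[e1 e2]; rewrite /side e1 e2 invgM invgK.
- by case/andP: okl_bypass.
by apply: live_bypass; exact: image_notin_inner.
Qed.

Lemma bracket_deletion a (g : dart D -> G) (p : pairing (dart D) G) : frame D g ->
  wfp p -> okb p (map (crossing_at D) (map f (reps D'))) J ->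
  (forall z, z \in inner -> ~~ live p z) ->
  (forall z, z \notin inner -> opp p z = mate D z /\ lbl p z = lbl (pairing_of D g) z) ->
  (forall j, j \in J -> g (iter 3 (ccw D) j.1) = g j.2 /\ g (iter 3 (ccw D) j.2) = g j.1) ->
  bracket a p (map (crossing_at D) (map f (reps D'))) J =
  bracket a (pairing_of D' (g \o f)) (map (crossing_at D') (reps D')) [::].
Proof.
move=> fr wf; rewrite map_crossing_at => ok dead hp gJ.
have hp1 z : z \notin inner -> opp p z = mate D z by case/hp.
have lnot z : live p z -> z \notin inner by apply: contraL => /dead.
apply: (@bracket_exits _ _ _ _ _ _ f _ J g (fun z => g (iter 3 (ccw D) z))) => //.
- exact: image_notin_pts.
- move=> x; rewrite /live hp1 ?image_notin_inner //; apply/eqP; exact: mate_neq.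
- by move=> x; exact: exits_image.
- by move=> j; exact: exits_partner.
- by move=> z /lnot zi; have [-> ->] := hp _ zi.
move=> x /=; rewrite /face /=; have [<- _ _] := f_mor (mate D' x).
have [<- _ _] := f_mor (ccw D' (mate D' x)).
by have [<- _ _] := f_mor (ccw D' (ccw D' (mate D' x))).
Qed.

End Deletion.

(** * The Jones invariant of a framed motif *)

(** The exponent is + w: with the weights chosen here, a monogon of sign -1 multiplies the bracket
    by - a^3. *)
Definition jones (G : groupType) (a : rat) (D : motif) (g : dart D -> G) : rat :=
  ((- a ^+ 3) ^ writhe D * bracket a (pairing_of D g) (map (crossing_at D) (reps D)) [::])%R.

Lemma same_crossing_quad (T : finType) (D : diagram T) d e :
  same_crossing D d e <-> e \in quad D d.
Proof.
split=> [[k ->]|].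
  elim: k => [|k]; rewrite ?mem_head // !inE /= => /or4P[] /eqP ->; rewrite ?ccwK ?eqxx ?orbT //.
by rewrite !inE => /or4P[] /eqP ->; [exists 0 | exists 1 | exists 2 | exists 3].
Qed.

(** * The first move and frames *)

Section MoveR1.

Context (G : groupType) (D D' : motif) (d : dart D) (hd : face D d = d)
  (f : dart D' -> dart D) (del : deletion (same_crossing D d) f).

Let inner := [:: d; ccw D d].
Let J := [:: (ccw D (ccw D d), ccw D (ccw D (ccw D d)))].

Lemma R1_mate : mate D d = ccw D d.
Proof. by rewrite -{2}hd ccw_face. Qed.

Lemma R1_mate_ccw : mate D (ccw D d) = d.
Proof. by rewrite -R1_mate mateK. Qed.

Lemma R1_strands : strands (same_crossing D d) inner J.
Proof.
split=> [x|x||u v].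
- exact: same_crossing_quad.
- rewrite !inE => /orP[] /eqP ->; rewrite ?R1_mate_ccw ?R1_mate eqxx ?orbT //.
- exact: uniq_quad.
rewrite /through !inE => -[] /eqP[-> ->]; rewrite ?ccwK.
  by split; [exists 1; rewrite R1_mate | rewrite R1_mate].
by split; [exists 0; rewrite R1_mate_ccw | rewrite R1_mate_ccw].
Qed.

Lemma R1_pairs (g : dart D -> G) : frame D g ->
  forall j, j \in J -> g (iter 3 (ccw D) j.1) = g j.2 /\ g (iter 3 (ccw D) j.2) = g j.1.
Proof.
move=> fr j; rewrite inE => /eqP -> /=; rewrite !ccwK; split=> //.
have := fr d; rewrite /side R1_mate /= ccwK invgM invgK => e.
by apply: invg_inj; rewrite -[LHS](mulgK (g d)) e -mulgA mulgV mulg1.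
Qed.

Lemma jones_R1 (a : rat) (g : dart D -> G) : a != 0%R -> frame D g ->
  frame D' (g \o f) /\ jones a g = jones a (g \o f).
Proof.
move=> a0 fr; have wf := wfp_pairing_of fr.
split; first exact: (frame_deletion del R1_strands fr (R1_pairs fr)).
have ts : transversal D (d :: map f (reps D')).
  exact: (transversal_deletion del R1_strands (s0 := [:: d])).
have ok := okb_transversal g ts.
have e1 : opp (pairing_of D g) d = ccw D d by exact: R1_mate.
have l1 : lbl (pairing_of D g) d = 1%g by rewrite /= hd mulgV.
have ok2 : okl (pairing_of D g) [:: d, ccw D d & pts J ++ cpts (map (crossing_at D) (map f (reps D')))].
  exact: ok.
rewrite /jones -(bracket_transversal a fr ts) map_cons.
rewrite (bracket_R1 a0 wf ok e1 l1).
have wf1 := wfp_joinl wf ok2; have ok1 := okl_join wf ok2.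
have /andP[_ /and3P[ld lcd _]] := ok2; have d_neq := okl_neq ok2.
have out_inner z : z \notin inner -> opp (pjoin (pairing_of D g) d (ccw D d)) z = mate D z /\
    lbl (pjoin (pairing_of D g) d (ccw D d)) z = lbl (pairing_of D g) z.
  rewrite !inE negb_or => /andP[zd zcd].
  by have [-> ->] := pjoin_inner wf e1 zd zcd.
have dead z : z \in inner -> ~~ live (pjoin (pairing_of D g) d (ccw D d)) z.
  by rewrite live_join // !inE => /orP[] /eqP ->; rewrite eqxx ?andbF.
rewrite (bracket_deletion del R1_strands a fr wf1 ok1 dead out_inner (R1_pairs fr)).
rewrite (writhe_deletion del R1_strands) signum_quad -R1_mate out_mate mulrA.
congr (_ * _)%R.
have a3 : (- a ^+ 3 != 0)%R by rewrite oppr_eq0 expf_neq0.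
rewrite expfzDr //; case: (is_over D d); case: (is_out D d) => /=;
  rewrite ?exprN1 ?expr1z; field; exact: a0.
Qed.

Lemma frame_R1 (g' : dart D' -> G) : frame D' g' ->
  exists g : dart D -> G, frame D g /\ g \o f = g'.
Proof.
move=> fr; have [N [Nf Nm NJ]] := extend_side del R1_strands fr.
have /= NJ1 := NJ _ (mem_head _ _).
have uq := uniq_quad D d.
pose n := N (ccw D (ccw D d)).
(* The two corners of the region around the monogon get [n], the monogon and its opposite corner 1;
   then [n] is the transition across the strand, as [N] prescribes. *)
pose g x := if [pick y | f y == x] is Some y then g' y
  else if (x == ccw D d) || (x == ccw D (ccw D (ccw D d))) then n else 1%g.
have gf y : g (f y) = g' y.
  rewrite /g; case: pickP => [z /eqP/(del_inj del) -> //|/(_ y)]; by rewrite eqxx.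
have gK x : x \in quad D d ->
    g x = if (x == ccw D d) || (x == ccw D (ccw D (ccw D d))) then n else 1%g.
  move=> xq; rewrite /g; case: pickP => // y /eqP e.
  by case: (image_notin_inner del R1_strands y) (image_notin_pts del R1_strands y);
     have := image_notin del R1_strands y; rewrite e; have -> : x \in inner ++ pts J by [].
have g0 : g d = 1%g.
  rewrite gK ?mem_head //; move: uq; rewrite /= !inE !negb_or => /and4P[/and3P[/negPf-> _ /negPf->] _ _ _].
  by [].
have g1 : g (ccw D d) = n by rewrite gK ?eqxx // !inE eqxx orbT.
have g2 : g (ccw D (ccw D d)) = 1%g.
  rewrite gK ?inE ?eqxx ?orbT //; move: uq; rewrite /= !inE !negb_or => /and4P[_ /andP[h _] /negPf h' _].
  by rewrite h' orbF eq_sym (negPf h).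
have g3 : g (ccw D (ccw D (ccw D d))) = n by rewrite gK ?eqxx ?orbT // !inE eqxx !orbT.
have sN x : side D g x = if x == d then n else if x == ccw D d then n^-1%g else N x.
  rewrite /side /=.
  have [/same_crossing_quad xq|/(del_im del)[y <-]] := pselect (same_crossing D d x).
    move: xq; rewrite !inE => /or4P[] /eqP ->; rewrite ?ccwK ?g0 ?g1 ?g2 ?g3; move: uq; rewrite /= !inE !negb_or.
    - by rewrite eqxx invg1 mul1g.
    - by rewrite eq_sym => /and4P[/and3P[/negPf-> _ _] _ _ _]; rewrite eqxx mulg1.
    - rewrite ![_ == ccw D (ccw D d)]eq_sym => /and4P[/and3P[_ /negPf-> _] /andP[/negPf -> _] _ _].
      by rewrite invg1 mul1g.
    rewrite ![_ == ccw D (ccw D (ccw D d))]eq_sym => /and4P[/and3P[_ _ /negPf->] /andP[_ /negPf ->] _ _].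
    by rewrite mulg1 NJ1.
  have := image_notin_inner del R1_strands y; rewrite !inE negb_or => /andP[/negPf -> /negPf ->].
  rewrite Nf /side gf; have [<- _ _] := del_mor del y; have [<- _ _] := del_mor del (ccw D' y).
  by have [<- _ _] := del_mor del (ccw D' (ccw D' y)); rewrite gf.
exists g; split; last by apply/funext => y /=.
move=> x; rewrite !sN.
have d_neq : (ccw D d == d) = false by apply/eqP; exact: ccw_neq.
case: (x =P d) => [->|xd]; first by rewrite R1_mate d_neq eqxx.
case: (x =P ccw D d) => [->|xcd]; first by rewrite R1_mate_ccw eqxx invgK.
case: eqP => [e|_]; first by case: xcd; rewrite -R1_mate -e mateK.
case: eqP => [e|_]; first by case: xd; rewrite -R1_mate_ccw -e mateK.
by apply: Nm; rewrite !inE; apply/norP; split; apply/eqP.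
Qed.

End MoveR1.

Lemma bracket_gauge (G : groupType) a (E : eqType) (S : Type) (F : S -> crossing E)
    (u : E -> G) (p : pairing E G) s J :
  wfp p -> okb p (map F s) J -> (forall j, j \in J -> u j.1 = u j.2) ->
  (forall x b j, j \in smoothing b (F x) -> u j.1 = u j.2) ->
  bracket a (gauge u p) (map F s) J = bracket a p (map F s) J.
Proof.
move=> wf + + uF; elim: s J => [|x s IH] J ok uJ.
  by rewrite /bracket /= loop_count_gauge //; move: ok; rewrite /okb /= cats0.
rewrite map_cons in ok *.
rewrite /bracket -/(bracket _); congr (_ * _ + _ * _)%R; apply: IH; try exact: okb_smoothing;
  by move=> j; rewrite mem_cat => /orP[/uJ //|]; exact: uF.
Qed.

(** Left multiplication by [u] changes the trivializations at the crossings. Every gluing joins two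
    ends at one crossing, where [u] is constant. *)
Lemma jones_gauge (G : groupType) (D : motif) (u g : dart D -> G) :
  (forall z, u (ccw D z) = u z) -> frame D g ->
  frame D (fun z => u z * g z)%g /\
  forall a, jones a (fun z => u z * g z)%g = jones a g.
Proof.
move=> uc fr; have wf := wfp_pairing_of fr.
have uface z : u (face D z) = u (mate D z) by rewrite /face /= !uc.
have pE : pairing_of D (fun z => u z * g z)%g = gauge u (pairing_of D g).
  by apply: pairing_ext => z //=; rewrite invgM uface !mulgA.
split.
  apply: frame_lbl => z; rewrite pE /= !invgM !invgK mateK.
  have [_ /(_ z) /=] := wf; rewrite invgM invgK => ->; by rewrite !mulgA.
move=> a; rewrite /jones pE bracket_gauge //; first exact/okb_transversal/reps_transversal.
move=> x b j; rewrite /smoothing /crossing_at; case: b; rewrite !inE => /orP[] /eqP -> /=;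
  by rewrite !uc.
Qed.

(** * The second move and frames *)

Section MoveR2.

Context (G : groupType) (D D' : motif) (d d' : dart D) (hd1 : face D d = d') (hd : face D d' = d)
  (hcr : ~ same_crossing D d d') (hov : is_over D (mate D d) = is_over D d)
  (f : dart D' -> dart D)
  (del : deletion (fun e => same_crossing D d e \/ same_crossing D d' e) f).

Let inner := [:: d; ccw D d'; ccw D d; d'].
Let J := [:: (ccw D (ccw D d), ccw D (ccw D (ccw D d')));
             (ccw D (ccw D (ccw D d)), ccw D (ccw D d'))].

Lemma R2_mate : mate D d = ccw D d'. Proof. by rewrite -hd1 ccw_face. Qed.

Lemma R2_mate' : mate D d' = ccw D d. Proof. by rewrite -[in RHS]hd ccw_face. Qed.

Lemma R2_mate_ccw : mate D (ccw D d) = d'. Proof. by rewrite -R2_mate' mateK. Qed.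

Lemma R2_mate_ccw' : mate D (ccw D d') = d. Proof. by rewrite -R2_mate mateK. Qed.

Lemma R2_over : is_over D d' = ~~ is_over D d.
Proof. by rewrite -hov R2_mate over_ccw negbK. Qed.

Lemma R2_perm : perm_eq (inner ++ pts J) (quad D d ++ quad D d').
Proof. by rewrite /inner /J /quad; solve_perm. Qed.

Lemma R2_uniq : uniq (quad D d ++ quad D d').
Proof.
rewrite cat_uniq !uniq_quad andbT; apply/hasPn => x xd'; apply/negP => xd.
by apply: hcr; apply/same_crossing_quad; rewrite quad_sym (quad_trans _ xd') // quad_sym.
Qed.

Lemma R2_strands :
  strands (fun e => same_crossing D d e \/ same_crossing D d' e) inner J.
Proof.
split=> [x|x||u v].
- rewrite (perm_mem R2_perm) mem_cat; split.
    by case=> /same_crossing_quad ->; rewrite ?orbT.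
  by case/orP => /same_crossing_quad; [left | right].
- rewrite !inE => /or4P[] /eqP ->;
    by rewrite ?R2_mate_ccw ?R2_mate_ccw' ?R2_mate ?R2_mate' eqxx ?orbT.
- by rewrite (perm_uniq R2_perm) R2_uniq.
have K1 k : same_crossing D d (iter k (ccw D) d) \/ same_crossing D d' (iter k (ccw D) d).
  by left; exists k.
have K2 k : same_crossing D d (iter k (ccw D) d') \/ same_crossing D d' (iter k (ccw D) d').
  by right; exists k.
rewrite /through !inE => -[] /orP[] /eqP[-> ->]; rewrite ?ccwK;
  rewrite ?(R2_mate_ccw, R2_mate_ccw', R2_mate, R2_mate');
  split=> //; first [exact: (K2 0) | exact: (K2 1) | exact: (K1 0) | exact: (K1 1)].
Qed.

Section GoodFrame.

Context (g : dart D -> G) (fr : frame D g) (g_in : g d = g d')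
  (g_out : g (ccw D (ccw D d)) = g (ccw D (ccw D d'))).

Lemma R2_labels : g (ccw D d) = g (ccw D (ccw D (ccw D d'))) /\
  g (ccw D d') = g (ccw D (ccw D (ccw D d))).
Proof.
have [_ lV] := wfp_pairing_of fr.
have e1 : lbl (pairing_of D g) (ccw D d) = 1%g by rewrite -R2_mate' lV /= hd g_in mulgV invg1.
have e2 : lbl (pairing_of D g) (ccw D d') = 1%g by rewrite -R2_mate lV /= hd1 g_in mulgV invg1.
move: e1 e2; rewrite /= /face R2_mate_ccw R2_mate_ccw' /= => e1 e2.
have eq1 (x y : G) : (x * y^-1)%g = 1%g -> x = y.
  by move=> e; rewrite -[LHS](mulgVK y) e mul1g.
by split; apply: eq1.
Qed.

Lemma R2_pairs j : j \in J ->
  g (iter 3 (ccw D) j.1) = g j.2 /\ g (iter 3 (ccw D) j.2) = g j.1.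
Proof.
have [e1 e2] := R2_labels.
by rewrite !inE => /orP[] /eqP -> /=; rewrite !ccwK; split; rewrite ?e1 ?e2 ?g_out.
Qed.

Lemma jones_R2 (a : rat) : a != 0%R ->
  frame D' (g \o f) /\ jones a g = jones a (g \o f).
Proof.
move=> a0; have wf := wfp_pairing_of fr; have str := R2_strands.
split; first exact: (frame_deletion del str fr R2_pairs).
have ts : transversal D (d :: d' :: map f (reps D')).
  apply: (transversal_deletion del str (s0 := [:: d; d'])).
  by rewrite perm_sym; exact: R2_perm.
have ok := okb_transversal g ts.
have cE : crossing_at D d' = Crossing (~~ is_over D d) d' (ccw D d') (ccw D (ccw D d'))
    (ccw D (ccw D (ccw D d'))) by rewrite /crossing_at R2_over.
rewrite /jones -(bracket_transversal a fr ts) !map_cons cE.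
rewrite !map_cons cE in ok.
set p := pairing_of D g in wf ok *.
have e1 : opp p d = ccw D d' by exact: R2_mate.
have e2 : opp p (ccw D d) = d' by exact: R2_mate_ccw.
have l1 : lbl p d = 1%g by rewrite /= hd1 g_in mulgV.
have l2 : lbl p (ccw D d) = 1%g.
  have [_ lV] := wf; rewrite -(mateK D d) R2_mate in l1.
  by rewrite -R2_mate' lV /= hd g_in mulgV invg1.
rewrite (bracket_R2 a0 wf ok e1 l1 e2 l2).
have ok1 : okl p (inner ++ pts J ++ cpts (map (crossing_at D) (map f (reps D')))).
  by apply: (okl_perm_catl (r := [::]) ok); rewrite /inner /J; solve_perm.
have wf1 := wfp_joinl wf ok1; have ok2 := okl_join wf ok1.
have wf2 := wfp_joinl wf1 ok2; have ok3 := okl_join wf1 ok2.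
have uqi : uniq inner by have := str_uniq str; rewrite cat_uniq => /and3P[].
move: (uqi); rewrite /= !inE !negb_or -!andbA => /and5P[n1 n2 n3 n4 /and3P[n5 n6 _]].
have out1 z : z != d -> z != ccw D d' ->
    (opp (pjoin p d (ccw D d')) z = opp p z) * (lbl (pjoin p d (ccw D d')) z = lbl p z).
  by move=> *; exact: pjoin_inner.
have out_inner z : z \notin inner ->
    opp (pjoin (pjoin p d (ccw D d')) (ccw D d) d') z = mate D z /\
    lbl (pjoin (pjoin p d (ccw D d')) (ccw D d) d') z = lbl p z.
  rewrite !inE !negb_or => /and4P[zd zcd' zcd zd'].
  have [-> ->] : (opp (pjoin (pjoin p d (ccw D d')) (ccw D d) d') z = opp (pjoin p d (ccw D d')) z) *
     (lbl (pjoin (pjoin p d (ccw D d')) (ccw D d) d') z = lbl (pjoin p d (ccw D d')) z).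
    by apply: pjoin_inner => //; rewrite out1 // eq_sym.
  by rewrite !out1.
have live1 z : live (pjoin p d (ccw D d')) z = [&& live p z, z != d & z != ccw D d'].
  by have /andP[_ /and3P[? ? _]] := ok1; rewrite live_join.
have dead z : z \in inner -> ~~ live (pjoin (pjoin p d (ccw D d')) (ccw D d) d') z.
  have /andP[_ /and3P[? ? _]] := ok2; rewrite live_join // live1.
  by rewrite !inE => /or4P[] /eqP ->; rewrite eqxx ?andbF.
rewrite (bracket_deletion del str a fr wf2 ok3 dead out_inner R2_pairs).
congr (_ ^ _ * _)%R; rewrite (writhe_deletion del str) (perm_big _ R2_perm) big_cat /=.
rewrite !signum_quad R2_over -R2_mate -[ccw D d]R2_mate' !out_mate.
by case: (is_out D d) (is_out D d') (is_over D d) => [] [] [] /=; rewrite ?addrN ?addNr add0r.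
Qed.

End GoodFrame.

(** Two freedoms are used. Left multiplication at the crossing of [d'] makes the edges of the bigon
    trivial. Right multiplication over the region opposite to the bigon at [d'], which changes no
    label, matches it with the region opposite at [d], as the move merges these two; they have to be
    distinct for this. *)
Lemma good_frame (g : dart D -> G) : frame D g ->
  ~~ fconnect (face D) (ccw D (ccw D d')) (ccw D (ccw D d)) ->
  exists g2 : dart D -> G, [/\ frame D g2, g2 d = g2 d',
    g2 (ccw D (ccw D d)) = g2 (ccw D (ccw D d')) & forall a, jones a g2 = jones a g].
Proof.
move=> fr nlr.
pose u z : G := if z \in quad D d' then (g d * (g d')^-1)%g else 1%g.
have quc z : (ccw D z \in quad D d') = (z \in quad D d').
  by apply/idP/idP; apply: quad_trans; rewrite !inE ?ccwK eqxx ?orbT.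
have uc z : u (ccw D z) = u z by rewrite /u quc.
have [g1 [fr1 g1in J1]] : exists g1 : dart D -> G, [/\ frame D g1, g1 d = g1 d' &
    forall a, jones a g1 = jones a g].
  have [fr1 J1] := jones_gauge uc fr; exists (fun z => u z * g z)%g; split; [exact: fr1 | | exact: J1].
  have dq : (d \in quad D d') = false.
    by apply/negP; rewrite quad_sym => h; apply: hcr; apply/same_crossing_quad.
  by rewrite /u dq mem_head mul1g mulgVK.
pose k := ((g1 (ccw D (ccw D d')))^-1 * g1 (ccw D (ccw D d)))%g.
have fc y z : fconnect (face D) y (face D z) = fconnect (face D) y z.
  apply/esym; apply: same_fconnect1_r; exact: face_inj.
pose g2 z := (g1 z * (if fconnect (face D) (ccw D (ccw D d')) z then k else 1))%g.
have g2face z : (g2 z * (g2 (face D z))^-1 = g1 z * (g1 (face D z))^-1)%g.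
  rewrite /g2 fc invgM; case: ifP => _; last by rewrite mulg1 invg1 mul1g.
  by rewrite mulgA mulgK.
have pE : pairing_of D g2 = pairing_of D g1.
  by apply: pairing_ext => [z|z]; [|exact: g2face].
exists g2; split.
- by apply: frame_lbl => z; rewrite pE; have [_ ->] := wfp_pairing_of fr1.
- by rewrite /g2 g1in -(fc _ d) hd1.
- by rewrite /g2 connect0 (negPf nlr) mulg1 /k mulVKg.
by move=> a; rewrite -J1 /jones pE.
Qed.

Lemma frame_R2 (g' : dart D' -> G) : frame D' g' ->
  exists g : dart D -> G, [/\ frame D g, g d = g d',
    g (ccw D (ccw D d)) = g (ccw D (ccw D d')) & g \o f = g'].
Proof.
move=> fr; have str := R2_strands; have [N [Nf Nm NJ]] := extend_side del str fr.
have /= NJ1 := NJ _ (mem_head _ _).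
have NJ2 : N (ccw D (ccw D d')) = (N (ccw D (ccw D (ccw D d))))^-1%g.
  by apply: (NJ (_, _)); rewrite !inE eqxx orbT.
pose n1 := N (ccw D (ccw D d)); pose n2 := (N (ccw D (ccw D (ccw D d))))^-1%g.
(* The corners of the bigon and of the two merged regions get 1; those of the regions beside the
   bigon get [n1] and [n2], the values that realize [N] on the four outer darts. *)
pose L := quad D d ++ quad D d'.
pose g x : G := if [pick y | f y == x] is Some y then g' y
  else nth 1%g [:: 1%g; n1; 1%g; n2; 1%g; n2; 1%g; n1] (index x L).
have gf y : g (f y) = g' y.
  rewrite /g; case: pickP => [z /eqP/(del_inj del) -> //|/(_ y)]; by rewrite eqxx.
have gK i : i < 8 -> g (nth d L i) = nth 1%g [:: 1%g; n1; 1%g; n2; 1%g; n2; 1%g; n1] i.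
  move=> i8; rewrite /g; case: pickP => [y /eqP e|_]; last by rewrite index_uniq ?R2_uniq.
  by have := image_notin del str y; rewrite e (perm_mem R2_perm) mem_nth.
have g0 : g d = 1%g := gK 0 isT.
have g1 : g (ccw D d) = n1 := gK 1 isT.
have g2 : g (ccw D (ccw D d)) = 1%g := gK 2 isT.
have g3 : g (ccw D (ccw D (ccw D d))) = n2 := gK 3 isT.
have g4 : g d' = 1%g := gK 4 isT.
have g5 : g (ccw D d') = n2 := gK 5 isT.
have g6 : g (ccw D (ccw D d')) = 1%g := gK 6 isT.
have g7 : g (ccw D (ccw D (ccw D d'))) = n1 := gK 7 isT.
have sN x : x \notin inner -> side D g x = N x.
  move=> xi; have [/(str_split str)|/(del_im del)[y <-]] :=
    pselect (same_crossing D d x \/ same_crossing D d' x).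
    rewrite mem_cat (negPf xi) /= !inE => /or4P[] /eqP ->; rewrite /side /= !ccwK.
    - by rewrite g1 g2 invg1 mul1g.
    - by rewrite g6 g7 NJ1 mulg1.
    - by rewrite g2 g3 mulg1 invgK.
    by rewrite g5 g6 NJ2 invg1 mul1g.
  rewrite Nf /side gf /=; have [<- _ _] := del_mor del y; have [<- _ _] := del_mor del (ccw D' y).
  by have [<- _ _] := del_mor del (ccw D' (ccw D' y)); rewrite gf.
exists g; split; rewrite ?g0 ?g4 ?g2 ?g6 //; last by apply/funext => y /=.
move=> x; case: (boolP (x \in inner)) => [|xi].
  rewrite !inE => /or4P[] /eqP ->.
  - by rewrite R2_mate /side /= ccwK g0 g3 g4 g5 invg1 mul1g mulg1.
  - by rewrite R2_mate_ccw' /side /= ccwK g0 g3 g4 g5 invg1 mul1g mulg1 invgK.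
  - by rewrite R2_mate_ccw /side /= ccwK g0 g1 g4 g7 invg1 mul1g mulg1 invgK.
  by rewrite R2_mate' /side /= ccwK g0 g1 g4 g7 invg1 mul1g mulg1.
have mi : mate D x \notin inner.
  by apply: contra xi => /(str_inner str); rewrite mateK.
by rewrite !sN // Nm.
Qed.

End MoveR2.

(** * The third move in explicit darts *)

Record R3_data (T : finType) (D D' : diagram T) (a b c : T) (s : T -> T) : Prop := {
  R3_fa : face D a = b;  R3_fb : face D b = c;  R3_fc : face D c = a;
  R3_uniq : uniq (quad D a ++ quad D b ++ quad D c);
  R3_over : is_over D b = ~~ is_over D a;
  R3_sa : map s (quad D a) = [:: ccw D (ccw D (ccw D b)); ccw D (ccw D c); ccw D b; c];
  R3_sb : map s (quad D b) = [:: ccw D (ccw D (ccw D c)); ccw D (ccw D a); ccw D c; a];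
  R3_sc : map s (quad D c) = [:: ccw D (ccw D (ccw D a)); ccw D (ccw D b); ccw D a; b];
  R3_sid : forall x, x \notin quad D a ++ quad D b ++ quad D c -> s x = x;
  R3_ccw : ccw D' =1 ccw D;
  R3_mate : forall x, mate D' x = s (mate D (s x));
  R3_isover : is_over D' =1 is_over D;
  R3_isout : is_out D' =1 is_out D }.

Section R3Data.

Context (T : finType) (D D' : diagram T).

Lemma R3_exists : R3 D D' -> exists a b c s, R3_data D D' a b c s.
Proof.
move=> [a [s [[h3 hd ho] [si so sn] hD']]].
have hin k : k < 3 -> exists2 k', k' < 3 & iter k (face D) a = iter k' (face D) a \/
    iter k (face D) a = mate D (iter k' (face D) a) by move=> k3; exists k => //; left.
have hin' k : k < 3 -> exists2 k', k' < 3 & mate D (iter k (face D) a) = iter k' (face D) a \/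
    mate D (iter k (face D) a) = mate D (iter k' (face D) a) by move=> k3; exists k => //; right.
set b := face D a; set c := face D b.
have fc : face D c = a by [].
have ma : mate D a = ccw D b by rewrite ccw_face.
have mb : mate D b = ccw D c by rewrite ccw_face.
have mc : mate D c = ccw D a by rewrite -fc ccw_face.
have ma' : mate D (ccw D b) = a by rewrite -ma mateK.
have mb' : mate D (ccw D c) = b by rewrite -mb mateK.
have mc' : mate D (ccw D a) = c by rewrite -mc mateK.
have sa := si a (hin 0 isT); have sb := si b (hin 1 isT); have sc := si c (hin 2 isT).
have ta := si _ (hin' 0 isT); have tb := si _ (hin' 1 isT); have tc := si _ (hin' 2 isT).
rewrite /= -/b -/c ?ma ?mb ?mc ?ma' ?mb' ?mc' in sa sb sc ta tb tc.
have oin x : (exists2 k, k < 3 & x = iter k (face D) a \/ x = mate D (iter k (face D) a)) ->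
   exists2 k, k < 3 & ccw D (ccw D (ccw D (ccw D x))) = iter k (face D) a \/
     ccw D (ccw D (ccw D (ccw D x))) = mate D (iter k (face D) a) by rewrite ccwK.
have ua := so _ (oin _ (hin 0 isT)); have ub := so _ (oin _ (hin 1 isT)); have uc := so _ (oin _ (hin 2 isT)).
have va := so _ (oin _ (hin' 0 isT)); have vb := so _ (oin _ (hin' 1 isT)); have vc := so _ (oin _ (hin' 2 isT)).
rewrite /= -/b -/c ?ccwK ?ma ?mb ?mc ?ma' ?mb' ?mc' in ua ub uc va vb vc.
exists a, b, c, s; split=> //.
- have disj x y : ~ same_crossing D x y -> ~~ has (mem (quad D x)) (quad D y).
    move=> nxy; apply/hasPn => z zy; apply/negP => zx; apply: nxy; apply/same_crossing_quad.
    by rewrite quad_sym (quad_trans _ zy) // quad_sym.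
  rewrite !cat_uniq !uniq_quad has_cat negb_or !disj //.
  + exact: (hd 1 2).
  + exact: (hd 0 2).
  + exact: (hd 0 1).
- by rewrite -ho ma over_ccw negbK.
- by rewrite /= sa tc ua vc.
- by rewrite /= sb ta ub va.
- by rewrite /= sc tb uc vb.
- move=> x; rewrite !mem_cat !negb_or /= !andbT.
  move=> /and3P[/and4P[x1 x2 x3 x4] /and4P[x5 x6 x7 x8] /and4P[x9 x10 x11 x12]]; apply: sn.
    case=> -[|[|[|//]]] _ /= [] e; move: x1 x2 x3 x4 x5 x6 x7 x8 x9 x10 x11 x12;
      rewrite e -/b -/c ?ma ?mb ?mc ?eqxx //.
  have xE y z : ccw D (ccw D x) = y -> ccw D (ccw D y) = z -> x = z by move=> <- <-; rewrite ccwK.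
  case=> -[|[|[|//]]] _ /= [] /xE e; have {}e := e _ erefl; move: x1 x2 x3 x4 x5 x6 x7 x8 x9 x10 x11 x12;
      rewrite e -/b -/c ?ma ?mb ?mc ?eqxx //.
- by move=> x; have [] := hD' x.
- by move=> x; have [] := hD' x.
- by move=> x; have [] := hD' x.
- by move=> x; have [] := hD' x.
Qed.

End R3Data.

Section R3Theory.

Context (T : finType) (D D' : diagram T) (a b c : T) (s : T -> T).
Context (H : R3_data D D' a b c s).

Local Notation ccw := (ccw D).
Local Notation mate := (mate D).
Local Notation K := (quad D a ++ quad D b ++ quad D c).

Lemma R3_mates : [/\ mate a = ccw b, mate b = ccw c & mate c = ccw a].
Proof.
by split; [rewrite -(R3_fa H) | rewrite -(R3_fb H) | rewrite -[in RHS](R3_fc H)]; rewrite ccw_face.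
Qed.

Lemma R3_mates' : [/\ mate (ccw b) = a, mate (ccw c) = b & mate (ccw a) = c].
Proof. by have [<- <- <-] := R3_mates; rewrite !mateK. Qed.

Lemma R3_s : [/\ [/\ s a = ccw (ccw (ccw b)), s (ccw a) = ccw (ccw c),
                    s (ccw (ccw a)) = ccw b & s (ccw (ccw (ccw a))) = c],
                 [/\ s b = ccw (ccw (ccw c)), s (ccw b) = ccw (ccw a),
                    s (ccw (ccw b)) = ccw c & s (ccw (ccw (ccw b))) = a] &
                 [/\ s c = ccw (ccw (ccw a)), s (ccw c) = ccw (ccw b),
                    s (ccw (ccw c)) = ccw a & s (ccw (ccw (ccw c))) = b]].
Proof.
by have [? ? ? ?] := R3_sa H; have [? ? ? ?] := R3_sb H; have [? ? ? ?] := R3_sc H; split.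
Qed.

Lemma R3_quads (P : T -> Prop) :
  [/\ P a, P (ccw a), P (ccw (ccw a)) & P (ccw (ccw (ccw a)))] ->
  [/\ P b, P (ccw b), P (ccw (ccw b)) & P (ccw (ccw (ccw b)))] ->
  [/\ P c, P (ccw c), P (ccw (ccw c)) & P (ccw (ccw (ccw c)))] ->
  {in K, forall x, P x}.
Proof.
move=> [? ? ? ?] [? ? ? ?] [? ? ? ?] x; rewrite !mem_cat /quad !inE.
by move=> /or3P[] /or4P[] /eqP ->.
Qed.

Lemma R3_involutive : involutive s.
Proof.
have [[a0 a1 a2 a3] [b0 b1 b2 b3] [c0 c1 c2 c3]] := R3_s.
move=> x; have [xK|xK] := boolP (x \in K); last by rewrite !(R3_sid H).
move: x xK; apply: R3_quads; split;
  by rewrite ?(a0, a1, a2, a3, b0, b1, b2, b3, c0, c1, c2, c3) ?(a0, a1, a2, a3, b0, b1, b2, b3, c0, c1, c2, c3).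
Qed.

End R3Theory.

Section R3Sym.

Context (T : finType) (D D' : diagram T) (a b c : T) (s : T -> T).
Context (H : R3_data D D' a b c s).

(** The sides of the new triangle are the darts opposite to [a], [b], [c], and [s] is an involution;
    so the inverse of a third move is a third move. *)
Lemma R3_sym : R3_data D' D (ccw D (ccw D a)) (ccw D (ccw D b)) (ccw D (ccw D c)) s.
Proof.
have cE := R3_ccw H; have sK := R3_involutive H.
have [[a0 a1 a2 a3] [b0 b1 b2 b3] [c0 c1 c2 c3]] := R3_s H.
have [ma' mb' mc'] := R3_mates' H.
have permK : perm_eq (quad D' (ccw D (ccw D a)) ++ quad D' (ccw D (ccw D b)) ++ quad D' (ccw D (ccw D c)))
    (quad D a ++ quad D b ++ quad D c).
  have q x : perm_eq (quad D' (ccw D (ccw D x))) (quad D x).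
    by rewrite /quad !cE !ccwK; solve_perm.
  by apply: perm_cat => //; apply: perm_cat.
have uq : uniq (quad D' (ccw D (ccw D a)) ++ quad D' (ccw D (ccw D b)) ++ quad D' (ccw D (ccw D c))).
  by rewrite (perm_uniq permK) (R3_uniq H).
split=> //.
- by rewrite /face /= !cE (R3_mate H) a2 ma' a0 !ccwK.
- by rewrite /face /= !cE (R3_mate H) b2 mb' b0 !ccwK.
- by rewrite /face /= !cE (R3_mate H) c2 mc' c0 !ccwK.
- by rewrite !(R3_isover H) !over_ccw2 (R3_over H).
- by rewrite /= !cE !ccwK a0 a1 a2 a3.
- by rewrite /= !cE !ccwK b0 b1 b2 b3.
- by rewrite /= !cE !ccwK c0 c1 c2 c3.
- by move=> x; rewrite (perm_mem permK); exact: (R3_sid H).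
- by move=> x; rewrite (R3_mate H) !sK.
- by move=> x; rewrite (R3_isover H).
- by move=> x; rewrite (R3_isout H).
Qed.

End R3Sym.

Section R3Corner.

Context (Y : Type) (T : finType) (D D' : diagram T) (a b c : T) (s : T -> T).
Context (H : R3_data D D' a b c s).

Local Notation ccw := (ccw D).
Local Notation mate := (mate D).
Local Notation K := (quad D a ++ quad D b ++ quad D c).

Context (g : T -> Y) (t : Y) (gab : g a = g b) (gac : g a = g c).
Context (E1 : g (ccw b) = g (ccw (ccw (ccw a)))) (E2 : g (ccw c) = g (ccw (ccw (ccw b))))
  (E3 : g (ccw a) = g (ccw (ccw (ccw c)))).

(* The regions around the triangle keep their values; t is the value on the new triangle. *)
Definition R3_corner x : Y := if x \in K then
  nth t [:: g (ccw (ccw (ccw b))); g (ccw (ccw c)); t; g (ccw (ccw b));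
              g (ccw (ccw (ccw c))); g (ccw (ccw a)); t; g (ccw (ccw c));
              g (ccw (ccw (ccw a))); g (ccw (ccw b)); t; g (ccw (ccw a))] (index x K)
  else g x.

(** In [D'] the dart [z] takes the place of [s z] and sees the same two values. The exceptions are
    the darts on the sides of the new triangle, where neither diagram shows a change of value along
    the edge. Either way the label of [z] is that of [s z]. *)
Lemma R3_corner_face z :
  R3_corner z = R3_corner (face D' z) /\ g (s z) = g (face D (s z)) \/
  R3_corner z = g (s z) /\ R3_corner (face D' z) = g (face D (s z)).
Proof.
have gK i : i < 12 -> R3_corner (nth a K i) = nth t [:: g (ccw (ccw (ccw b))); g (ccw (ccw c)); t; g (ccw (ccw b));
              g (ccw (ccw (ccw c))); g (ccw (ccw a)); t; g (ccw (ccw c));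
              g (ccw (ccw (ccw a))); g (ccw (ccw b)); t; g (ccw (ccw a))] i.
  by move=> i12; rewrite /R3_corner mem_nth // index_uniq // (R3_uniq H).
have g0 : R3_corner a = _ := gK 0 isT.
have g1 : R3_corner (ccw a) = _ := gK 1 isT.
have g2 : R3_corner (ccw (ccw a)) = _ := gK 2 isT.
have g3 : R3_corner (ccw (ccw (ccw a))) = _ := gK 3 isT.
have g4 : R3_corner b = _ := gK 4 isT.
have g5 : R3_corner (ccw b) = _ := gK 5 isT.
have g6 : R3_corner (ccw (ccw b)) = _ := gK 6 isT.
have g7 : R3_corner (ccw (ccw (ccw b))) = _ := gK 7 isT.
have g8 : R3_corner c = _ := gK 8 isT.
have g9 : R3_corner (ccw c) = _ := gK 9 isT.
have g10 : R3_corner (ccw (ccw c)) = _ := gK 10 isT.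
have g11 : R3_corner (ccw (ccw (ccw c))) = _ := gK 11 isT.
rewrite /= in g0 g1 g2 g3 g4 g5 g6 g7 g8 g9 g10 g11.
have [ma mb mc] := R3_mates H; have [ma' mb' mc'] := R3_mates' H.
have [[a0 a1 a2 a3] [b0 b1 b2 b3] [c0 c1 c2 c3]] := R3_s H.
have cE := R3_ccw H; have sK := R3_involutive H.
pose Inn := [:: a; ccw a; b; ccw b; c; ccw c].
pose Out := [:: ccw (ccw a); ccw (ccw (ccw a)); ccw (ccw b); ccw (ccw (ccw b)); ccw (ccw c); ccw (ccw (ccw c))].
have case6 (P : T -> Prop) x0 x1 x2 x3 x4 x5 : P x0 -> P x1 -> P x2 -> P x3 -> P x4 -> P x5 ->
    {in [:: x0; x1; x2; x3; x4; x5], forall x, P x}.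
  by move=> ? ? ? ? ? ? x; rewrite !inE => /or4P[/eqP->|/eqP->|/eqP->|/or3P[]/eqP->].
have sOut x : x \in Out -> s x \in Inn.
  by move: x; apply: case6; rewrite ?a2 ?a3 ?b2 ?b3 ?c2 ?c3 !inE eqxx ?orbT.
have sInn x : x \in Inn -> s x \in Out.
  by move: x; apply: case6; rewrite ?a0 ?a1 ?b0 ?b1 ?c0 ?c1 !inE eqxx ?orbT.
have mInn x : x \in Inn -> mate x \in Inn.
  by move: x; apply: case6; rewrite ?ma ?mb ?mc ?ma' ?mb' ?mc' !inE eqxx ?orbT.
have permK : perm_eq K (Inn ++ Out) by rewrite /quad /Inn /Out; solve_perm.
have K_ccw x : (ccw x \in K) = (x \in K).
  have quc d : (ccw x \in quad D d) = (x \in quad D d).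
    by apply/idP/idP; apply: quad_trans; rewrite !inE ?ccwK eqxx ?orbT.
  by rewrite !mem_cat !quc.
have notK x : x \notin K -> R3_corner x = g x by rewrite /R3_corner => /negPf ->.
have HL x : x \notin Out -> R3_corner x = g (s x) /\
    R3_corner (ccw (ccw (ccw x))) = g (ccw (ccw (ccw (s x)))).
  move=> xO; have [xK|xK] := boolP (x \in K); last first.
    by rewrite !notK ?K_ccw // (R3_sid H).
  have : x \in Inn by move: xK; rewrite (perm_mem permK) mem_cat (negPf xO) orbF.
  move: x {xO xK}; apply: case6; rewrite ?a0 ?a1 ?b0 ?b1 ?c0 ?c1 ?ccwK;
    by rewrite ?g0 ?g1 ?g2 ?g3 ?g4 ?g5 ?g6 ?g7 ?g8 ?g9 ?g10 ?g11 ?E1 ?E2 ?E3.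
rewrite /face /= !cE (R3_mate H).
have [zO|zO] := boolP (z \in Out).
  left; move: z zO; apply: case6.
  - by rewrite a2 ma' a0 ccwK g2 g6 E1.
  - by rewrite a3 mc a1 !ccwK g3 g9 gac.
  - by rewrite b2 mb' b0 ccwK g6 g10 E2.
  - by rewrite b3 ma b1 !ccwK g7 g1 gab.
  - by rewrite c2 mc' c0 ccwK g10 g2 E3.
  by rewrite c3 mb c1 !ccwK g11 g5 -gab gac.
have [-> _] := HL z zO; right; split=> //.
have wO : s (mate (s z)) \notin Out.
  apply: contra zO => /sOut; rewrite sK => /mInn; rewrite mateK => /sInn; by rewrite sK.
by have [_ ->] := HL _ wO; rewrite sK.
Qed.

Lemma R3_corner_values :
  [/\ [/\ R3_corner a = g (ccw (ccw (ccw b))), R3_corner (ccw a) = g (ccw (ccw c)),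
          R3_corner (ccw (ccw a)) = t & R3_corner (ccw (ccw (ccw a))) = g (ccw (ccw b))],
      [/\ R3_corner b = g (ccw (ccw (ccw c))), R3_corner (ccw b) = g (ccw (ccw a)),
          R3_corner (ccw (ccw b)) = t & R3_corner (ccw (ccw (ccw b))) = g (ccw (ccw c))],
      [/\ R3_corner c = g (ccw (ccw (ccw a))), R3_corner (ccw c) = g (ccw (ccw b)),
          R3_corner (ccw (ccw c)) = t & R3_corner (ccw (ccw (ccw c))) = g (ccw (ccw a))] &
      forall x, x \notin K -> R3_corner x = g x].
Proof.
have gK i : i < 12 -> R3_corner (nth a K i) = nth t [:: g (ccw (ccw (ccw b))); g (ccw (ccw c)); t; g (ccw (ccw b));
              g (ccw (ccw (ccw c))); g (ccw (ccw a)); t; g (ccw (ccw c));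
              g (ccw (ccw (ccw a))); g (ccw (ccw b)); t; g (ccw (ccw a))] i.
  by move=> i12; rewrite /R3_corner mem_nth // index_uniq // (R3_uniq H).
have g0 : R3_corner a = _ := gK 0 isT.
have g1 : R3_corner (ccw a) = _ := gK 1 isT.
have g2 : R3_corner (ccw (ccw a)) = _ := gK 2 isT.
have g3 : R3_corner (ccw (ccw (ccw a))) = _ := gK 3 isT.
have g4 : R3_corner b = _ := gK 4 isT.
have g5 : R3_corner (ccw b) = _ := gK 5 isT.
have g6 : R3_corner (ccw (ccw b)) = _ := gK 6 isT.
have g7 : R3_corner (ccw (ccw (ccw b))) = _ := gK 7 isT.
have g8 : R3_corner c = _ := gK 8 isT.
have g9 : R3_corner (ccw c) = _ := gK 9 isT.
have g10 : R3_corner (ccw (ccw c)) = _ := gK 10 isT.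
have g11 : R3_corner (ccw (ccw (ccw c))) = _ := gK 11 isT.
by split=> // x; rewrite /R3_corner => /negPf ->.
Qed.

End R3Corner.

Section JonesR3.

Context (G : groupType) (T : finType) (D D' : diagram T) (a b c : T) (s : T -> T).
Context (H : R3_data D D' a b c s).

Local Notation ccw := (ccw D).
Local Notation mate := (mate D).
Local Notation K := (quad D a ++ quad D b ++ quad D c).

(** The trivializations at the crossings of [b] and [c] are adjusted to that at [a], which makes the
    sides of the triangle trivial. *)
Lemma R3_good_frame (g : T -> G) : frame D g ->
  exists g2 : T -> G, [/\ frame D g2, g2 a = g2 b, g2 a = g2 c &
    forall x, @jones G x (Motif D) g2 = @jones G x (Motif D) g].
Proof.
move=> fr; have := R3_uniq H; rewrite !cat_uniq has_cat negb_or.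
move=> /and3P[_ /andP[/hasPn ab /hasPn ac] /and3P[_ /hasPn bc _]].
pose u z : G := if z \in quad D b then (g a * (g b)^-1)%g
  else if z \in quad D c then (g a * (g c)^-1)%g else 1%g.
have quc d z : (ccw z \in quad D d) = (z \in quad D d).
  by apply/idP/idP; apply: quad_trans; rewrite !inE ?ccwK eqxx ?orbT.
have uc z : u (ccw z) = u z by rewrite /u !quc.
have [fr1 J1] := @jones_gauge G (Motif D) u g uc fr.
have qF x y z : (forall t, t \in quad D y -> t \notin quad D x) ->
    z \in quad D x -> (z \in quad D y) = false.
  by move=> h zx; apply/negP => /h; rewrite zx.
have ua : u a = 1%g by rewrite /u (qF a b a ab (mem_head _ _)) (qF a c a ac (mem_head _ _)).
have ub : u b = (g a * (g b)^-1)%g by rewrite /u mem_head.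
have cb t : t \in quad D b -> t \notin quad D c.
  by move=> tb; apply/negP => tc; have := bc _ tc; rewrite /= tb.
have ucc : u c = (g a * (g c)^-1)%g by rewrite /u (qF c b c cb (mem_head _ _)) mem_head.
exists (fun z => u z * g z)%g; split; [exact: fr1 | | | exact: J1].
  by rewrite ua ub mul1g mulgVK.
by rewrite ua ucc mul1g mulgVK.
Qed.

Context (g : T -> G) (fr : frame D g) (gab : g a = g b) (gac : g a = g c).

Lemma R3_corners : [/\ g (ccw b) = g (ccw (ccw (ccw a))),
  g (ccw c) = g (ccw (ccw (ccw b))) & g (ccw a) = g (ccw (ccw (ccw c)))].
Proof.
have [_ lV] := wfp_pairing_of fr.
have [ma mb mc] := R3_mates H.
have eq1 (x y : G) : (x * y^-1)%g = 1%g -> x = y.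
  by move=> e; rewrite -[LHS](mulgVK y) e mul1g.
have corner x y z : mate x = y -> face D x = z -> g x = g z -> g y = g (ccw (ccw (ccw x))).
  move=> xy fx gxz; apply: eq1.
  have := lV x; rewrite /= xy fx gxz mulgV invg1 => <-; congr (_ * (g _)^-1)%g.
  by rewrite -xy face_mate.
by split; [apply: corner ma (R3_fa H) gab | apply: corner mb (R3_fb H) _ | apply: corner mc (R3_fc H) _];
  rewrite -?gab ?gac.
Qed.

Definition R3_frame : T -> G := R3_corner D a b c g (g a).

Lemma R3_frame_lbl z : lbl (pairing_of D' R3_frame) z = lbl (pairing_of D g) (s z).
Proof.
have [E1 E2 E3] := R3_corners.
rewrite /= /R3_frame.
have [[-> ->]|[-> ->]] := R3_corner_face H (g a) gab gac E1 E2 E3 z => //.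
by rewrite !mulgV.
Qed.

Lemma R3_frameP : frame D' R3_frame.
Proof.
apply: frame_lbl => z; rewrite !R3_frame_lbl (R3_mate H) (R3_involutive H).
by have [_ ->] := wfp_pairing_of fr.
Qed.

Lemma R3_transversal : exists2 r : seq T, {in cpts (map (crossing_at D) r), forall x, x \notin K} &
  transversal D [:: a, b, c & r].
Proof.
pose r := [seq x <- reps D | x \notin K]; exists r.
  move=> x; rewrite mem_quads => /hasP[e]; rewrite mem_filter => /andP[eK _] xe.
  apply: contra eK; rewrite !mem_cat => /or3P[] xq; rewrite (quad_trans _ xq) ?orbT // quad_sym //.
apply: uniq_perm => [||x]; last 1 first.
- rewrite mem_quads mem_enum [RHS]inE; apply/hasP.
  have [xK|xK] := boolP (x \in K).
    by move: xK; rewrite !mem_cat => /or3P[] xq; [exists a => // | exists b => // | exists c => //]; rewrite !in_cons eqxx ?orbT.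
  have [e re ex] := rep_exists D x; exists e; last by rewrite quad_sym.
  rewrite !inE mem_filter mem_filter mem_enum re andbT; apply/orP; right; apply/orP; right; apply/orP; right.
  apply: contra xK; rewrite !mem_cat => /or3P[] eq; rewrite (quad_trans _ eq) ?orbT // quad_sym //.
- rewrite !map_cons !cpts_cons.
  have -> : [:: c0 (crossing_at D a), c1 (crossing_at D a), c2 (crossing_at D a), c3 (crossing_at D a),
     c0 (crossing_at D b), c1 (crossing_at D b), c2 (crossing_at D b), c3 (crossing_at D b),
     c0 (crossing_at D c), c1 (crossing_at D c), c2 (crossing_at D c), c3 (crossing_at D c)
     & cpts (map (crossing_at D) r)] = K ++ cpts (map (crossing_at D) r) by [].
  rewrite cat_uniq (R3_uniq H) uniq_quads ?andbT /=.
  + apply/hasPn => x; rewrite mem_quads => /hasP[e]; rewrite mem_filter => /andP[eK _] xe.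
    apply: contra eK => xK; move: (xK : x \in K).
    by rewrite !mem_cat => /or3P[] xq; rewrite (quad_trans _ xq) ?orbT // quad_sym.
  + by do 2!apply: filter_uniq; exact: enum_uniq.
  by apply/allP => e; rewrite !mem_filter => /andP[_ /andP[]].
exact: enum_uniq.
Qed.

Lemma jones_R3_good (x : rat) : x != 0%R ->
  @jones G x (Motif D) g = @jones G x (Motif D') R3_frame.
Proof.
move=> x0; have wf := wfp_pairing_of fr; have frp := R3_frameP.
have [r rK tr] := R3_transversal.
have crE y : crossing_at D' y = crossing_at D y.
  by rewrite /crossing_at !(R3_ccw H) (R3_isover H).
have tr' : transversal D' [:: a, b, c & r].
  by rewrite /transversal (eq_map crE).
have [[a0 a1 a2 a3] [b0 b1 b2 b3] [c0 c1 c2 c3]] := R3_s H.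
have [ma mb mc] := R3_mates H; have [ma' mb' mc'] := R3_mates' H.
rewrite /jones; congr (_ ^ _ * _)%R.
  rewrite !writhe_reps /reps !big_filter; apply: eq_big => y; rewrite /is_rep /signum.
    by rewrite /= (R3_isover H) (R3_isout H).
  by rewrite /= (R3_isout H) (R3_ccw H).
rewrite -(bracket_transversal x fr tr) -(bracket_transversal x frp tr') (eq_map crE).
(* Renaming the ends by [s] turns the arcs of [D'] into those of [D]; the move then only alters the
   three crossings, as in [bracket_R3]. *)
rewrite -(@bracket_map _ x _ _ s (pairing_of D' R3_frame) (pairing_of D g)).
- rewrite !map_cons (_ : map (map_crossing s) (map (crossing_at D) r) = map (crossing_at D) r).
    have ok := okb_transversal g tr; rewrite !map_cons in ok *.
    have lbl1 y z : face D y = z -> g y = g z -> lbl (pairing_of D g) y = 1%g.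
      by move=> /= -> ->; rewrite mulgV.
    rewrite /crossing_at (R3_over H) in ok *.
    rewrite (bracket_R3 x0 wf ok) //.
    + by rewrite /map_crossing /= a0 a1 a2 a3 b0 b1 b2 b3 c0 c1 c2 c3.
    + exact: lbl1 (R3_fa H) gab.
    + by apply: lbl1 (R3_fb H) _; rewrite -gab.
    by apply: lbl1 (R3_fc H) _; rewrite -gac.
  apply: map_crossing_id => y /rK yK; exact: (R3_sid H).
- exact: inv_inj (R3_involutive H).
- by move=> z /=; rewrite (R3_mate H) (R3_involutive H).
by move=> z; rewrite R3_frame_lbl.
Qed.

End JonesR3.

(** The holonomy group will consist of all bijections of the darts of the universal cover, which
    spares the construction of its deck transformations. *)
Record bijection (T : Type) := Bijection {
  bij_fun :> T -> T; bij_inv : T -> T;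
  bij_funK : cancel bij_fun bij_inv; bij_invK : cancel bij_inv bij_fun }.

Section Bijections.
Context (T : Type).

Lemma bijectionP (s t : bijection T) : s =1 t -> s = t.
Proof.
case: s t => [f f' fK f'K] [h h' hK h'K] /= /funext e; subst h.
have e : f' = h' by apply/funext => x; rewrite -{1}(h'K x) fK.
by subst h'; rewrite (Prop_irrelevance fK hK) (Prop_irrelevance f'K h'K).
Qed.

HB.instance Definition _ := gen_eqMixin (bijection T).
HB.instance Definition _ := gen_choiceMixin (bijection T).

Definition bij1 : bijection T := @Bijection T id id (frefl _) (frefl _).
Definition bijV (s : bijection T) : bijection T := Bijection (@bij_invK T s) (@bij_funK T s).
Definition bijM (s t : bijection T) : bijection T :=
  Bijection (can_comp (@bij_funK T s) (@bij_funK T t)) (can_comp (@bij_invK T t) (@bij_invK T s)).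

Lemma bijMA : associative bijM. Proof. by move=> s t u; exact: bijectionP. Qed.
Lemma bij1M : left_id bij1 bijM. Proof. by move=> s; exact: bijectionP. Qed.
Lemma bijM1 : right_id bij1 bijM. Proof. by move=> s; exact: bijectionP. Qed.
Lemma bijVM : left_inverse bij1 bijV bijM.
Proof. by move=> s; apply: bijectionP => x /=; exact: bij_funK. Qed.
Lemma bijMV : right_inverse bij1 bijV bijM.
Proof. by move=> s; apply: bijectionP => x /=; exact: bij_invK. Qed.

HB.instance Definition _ := isGroup.Build (bijection T) bijMA bij1M bijM1 bijVM bijMV.

Lemma iter_funK (s : bijection T) n : cancel (iter n s) (iter n (bij_inv s)).
Proof. by elim: n => // n IH x; rewrite iterSr iterS bij_funK. Qed.

Lemma iter_invK (s : bijection T) n : cancel (iter n (bij_inv s)) (iter n s).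
Proof. by elim: n => // n IH x; rewrite iterSr iterS bij_invK. Qed.

Definition bij_iter n (s : bijection T) : bijection T :=
  Bijection (iter_funK s n) (iter_invK s n).

End Bijections.

(** * Positive index of a quadratic function *)

Local Open Scope ring_scope.

Section LinearForm.
Context (vT : vectType rat) (phi : 'Hom(vT, rat^o)).
Lemma linear_formD u v : phi (u + v) = phi u + phi v :> rat. Proof. by rewrite linearD. Qed.
Lemma linear_formN v : phi (- v) = - phi v :> rat. Proof. by rewrite linearN. Qed.
Lemma linear_formZ c v : phi (c *: v) = c * phi v :> rat. Proof. by rewrite linearZ. Qed.
Lemma linear_form0 : phi 0 = 0 :> rat. Proof. by rewrite linear0. Qed.

Definition slide (e v : vT) : vT := v - (phi v : rat) *: e.

Lemma slide_is_linear e : linear (slide e).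
Proof.
move=> c u v; rewrite /slide linear_formD linear_formZ /= scalerBr scalerDl opprD addrACA; congr (_ + _).
by rewrite scalerA.
Qed.

HB.instance Definition _ e :=
  GRing.isLinear.Build rat vT vT _ (slide e) (slide_is_linear e).

End LinearForm.

Definition posdef (vT : vectType rat) (W : {vspace vT}) (Q : vT -> rat) : Prop :=
  forall v, v \in W -> v != 0 -> 0 < Q v.

(** Positive index at least [k], by a witness; this form involves no diagonalization. *)
Definition pos (vT : vectType rat) (V : {vspace vT}) (Q : vT -> rat) (k : nat) : Prop :=
  exists W, [/\ (W <= V)%VS, (k <= \dim W)%N & posdef W Q].

(** On a nonzero kernel vector of [h] in [W], [R] would be both positive and at most 0; so [h] is
    injective on [W]. *)
Lemma limg_pos (vT wT : vectType rat) (W : {vspace vT}) (V : {vspace wT}) Q R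
    (h : 'Hom(vT, wT)) : (h @: W <= V)%VS ->
  posdef W R -> (forall w, w \in W -> R w <= Q (h w)) ->
  (forall w, w \in W -> h w = 0 -> R w <= 0) ->
  pos V Q (\dim W).
Proof.
move=> hV pd le kill; exists (h @: W)%VS; split=> //.
  rewrite limg_dim_eq //; apply/eqP; rewrite -subv0; apply/subvP => w.
  rewrite memv_cap memv_ker memv0 => /andP[wW /eqP hw].
  by apply: contraT => /(pd w wW); rewrite ltNge kill.
move=> _ /memv_imgP[w wW ->] nz; apply: lt_le_trans (le w wW).
by apply: pd => //; apply: contra_neq nz => ->; rewrite linear0.
Qed.

Lemma pos_leq (vT : vectType rat) (V : {vspace vT}) Q k l : (k <= l)%N -> pos V Q l -> pos V Q k.
Proof. by move=> kl [W [WV lW pd]]; exists W; split=> //; apply: leq_trans lW. Qed.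

(** Witnesses are pushed forward by [rho] in one direction and by a linear section of it in the
    other. *)
Lemma pos_pull (vT wT : vectType rat) (V : {vspace vT}) (V' : {vspace wT}) (R : vT -> rat)
    (R' : wT -> rat) (rho : 'Hom(vT, wT)) k :
  (rho @: V = V')%VS -> (forall v, v \in V -> R v = R' (rho v)) -> R' 0 = 0 ->
  pos V R k <-> pos V' R' k.
Proof.
move=> rV RE R0; split=> -[W [WV kW pd]]; apply: (pos_leq kW).
  apply: (@limg_pos _ _ W V' R' R rho) => //.
  - by rewrite -rV limgS.
  - by move=> w wW; rewrite RE ?(subvP WV).
  by move=> w wW rw; rewrite RE ?(subvP WV) // rw R0.
pose h := (projv V \o (rho \o projv V)^-1)%VF.
have hK w : w \in W -> rho (h w) = w.
  move=> wW; have := @limg_lfunVK _ _ _ (rho \o projv V)%VF w.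
  by rewrite !comp_lfunE; apply; rewrite limg_comp limg_proj rV; exact: (subvP WV).
have hV w : h w \in V by rewrite /h comp_lfunE memv_proj.
apply: (@limg_pos _ _ W V R R' h) => //.
- by apply/subvP => _ /memv_imgP[w _ ->].
- by move=> w wW; rewrite RE // hK.
by move=> w wW hw; rewrite -(hK w wW) hw linear0 R0.
Qed.

Section PositiveIndex.

Context (vT : vectType rat).
Implicit Types (V W : {vspace vT}) (Q R : vT -> rat).

Lemma dim_lker_cap W (phi : 'Hom(vT, rat^o)) : (\dim W <= (\dim (W :&: lker phi)).+1)%N.
Proof.
rewrite -(limg_ker_dim phi W) -addn1 leq_add2l.
by apply: (leq_trans (dimvS (subvf _))); rewrite dimvf.
Qed.

Lemma pos_ker V Q (phi : 'Hom(vT, rat^o)) k : pos V Q k.+1 -> pos (V :&: lker phi) Q k.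
Proof.
move=> [W [WV kW pd]]; exists (W :&: lker phi)%VS; split; first exact: capvS.
  by rewrite -ltnS; apply: leq_trans kW (dim_lker_cap _ _).
by move=> v; rewrite memv_cap => /andP[vW _]; exact: pd.
Qed.

Lemma pos_ext V Q R k : (forall v, v \in V -> Q v = R v) -> pos V Q k -> pos V R k.
Proof.
move=> QR [W [WV kW pd]]; exists W; split=> // v vW nz.
by rewrite -QR ?(subvP WV) //; exact: pd.
Qed.

Section Line.

Context (V : {vspace vT}) (Q : vT -> rat) (e : vT) (phi : 'Hom(vT, rat^o)).
Hypotheses (eV : e \in V) (phie : phi e = 1) (Q0 : Q 0 = 0).

(** [e] spans a line of square +1, orthogonal to the kernel of [phi]. *)
Lemma pos_plus k : (forall v, v \in V -> Q v = Q (v - phi v *: e) + phi v ^+ 2) ->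
  pos V Q k.+1 <-> pos (V :&: lker phi) Q k.
Proof.
move=> hQ; split; first exact: pos_ker.
move=> [W [WV kW pd]]; have e0 : e != 0.
  by apply/eqP => e0; move: phie; rewrite e0 linear_form0 => /eqP; rewrite eq_sym oner_eq0.
have We : (W :&: <[e]> = 0)%VS.
  apply/eqP; rewrite -subv0; apply/subvP => v; rewrite memv_cap => /andP[vW /vlineP[c ve]].
  have := subvP WV v vW; rewrite memv_cap memv_ker ve linear_formZ phie mulr1 => /andP[_ /eqP ->].
  by rewrite scale0r mem0v.
exists (W + <[e]>)%VS; split.
- apply/subvP => v /memv_addP[w wW [_ /vlineP[c ->] ->]].
  by rewrite memvD ?memvZ //; have := subvP WV w wW; rewrite memv_cap => /andP[].
- by rewrite dimv_disjoint_sum // dim_vline e0 addn1 ltnS.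
move=> v /memv_addP[w wW [_ /vlineP[c ->] ->]] nz.
have /andP[wV] : (w \in V) && (w \in lker phi) by rewrite -memv_cap (subvP WV).
rewrite memv_ker => /eqP pw; have pc : phi (w + c *: e) = c.
  by rewrite linear_formD linear_formZ pw phie add0r mulr1.
rewrite hQ ?memvD ?memvZ // pc addrK.
have [w0|w0] := eqVneq w 0; last by apply: ltr_wpDr; rewrite ?sqr_ge0 ?pd.
rewrite w0 in nz *; rewrite Q0 add0r exprn_even_gt0 //=.
by apply: contra_neq nz => ->; rewrite scale0r addr0.
Qed.

(** Sliding a witness along [e] into the kernel of [phi] can only increase [Q]. *)
Lemma pos_minus k : (forall v, v \in V -> Q v = Q (v - phi v *: e) - phi v ^+ 2) ->
  pos V Q k <-> pos (V :&: lker phi) Q k.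
Proof.
move=> hQ; split=> -[W [WV kW pd]]; last first.
  by exists W; split=> //; apply: subv_trans WV (capvSl _ _).
apply: (pos_leq kW); apply: (@limg_pos _ _ W _ Q Q (linfun (slide phi e))) => //.
- apply/subvP => _ /memv_imgP[w wW ->]; rewrite lfunE /= memv_cap memv_ker /slide.
  by rewrite memvB ?memvZ ?(subvP WV _ wW) //= linear_formD linear_formN linear_formZ phie mulr1 subrr.
- by move=> w wW; rewrite lfunE /= hQ ?(subvP WV) // gerBl sqr_ge0.
move=> w wW; rewrite lfunE /= /slide => h; rewrite hQ ?(subvP WV) // h Q0 sub0r oppr_le0.
exact: sqr_ge0.
Qed.

End Line.

Section Hyperbolic.

Context (V : {vspace vT}) (Q R : vT -> rat) (z y : 'Hom(vT, rat^o)) (e g : vT).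
Context (beta : 'Hom(vT, rat^o)).
Hypotheses (eV : e \in V) (gV : g \in V) (ze : z e = 0) (ye : y e != 0) (zg : z g != 0).
Hypothesis QE : forall v, v \in V -> Q v = z v * y v + R v.
Hypothesis R_shift : forall v c, R (v + c *: e) = R v.
Hypothesis Q_shift : forall v c, Q (v + c *: g) = Q v + c * beta v + c ^+ 2 * Q g.
Hypothesis R0 : R 0 = 0.

(** [e] is isotropic and pairs nontrivially with [g]. They span a hyperbolic plane, which
    contributes one to the index; [R] is the form left on the kernel of [z] modulo [e]. *)
Lemma pos_hyperbolic k : pos V Q k.+1 <-> pos (V :&: lker z) R k.
Proof.
split=> [/(pos_ker z)|[W0 [WV kW pd]]].
  by apply: pos_ext => v; rewrite memv_cap memv_ker => /andP[vV /eqP zv]; rewrite QE // zv mul0r add0r.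
have Re c : R (c *: e) = 0 by rewrite -[c *: e]add0r R_shift.
have Qge c : Q (g + c *: e) = Q g + c * (z g * y e).
  rewrite !QE ?memvD ?memvZ // R_shift !linear_formD !linear_formZ ze; ring.
have be : beta e = z g * y e.
  have := Q_shift e 1; have := Qge 1; rewrite !scale1r [g + e]addrC => -> .
  rewrite [Q e]QE // ze mul0r add0r -[e in R e]scale1r Re; lra.
have be0 : beta e != 0 by rewrite be mulf_neq0.
pose phi : 'Hom(vT, rat^o) := (beta e)^-1 *: beta.
have phiE v : phi v = beta v / beta e by rewrite /phi scale_lfunE [LHS]mulrC.
(* A correction along [e], invisible to [R], that makes a vector orthogonal to [g] for the polar
   form [beta]. *)
pose th := linfun (slide phi e).
have W0P w : w \in W0 -> [/\ w \in V, z w = 0 & R w = Q (th w)].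
  move=> /(subvP WV); rewrite memv_cap memv_ker => /andP[wV /eqP zw]; split=> //.
  rewrite lfunE /= /slide QE ?memvB ?memvZ // linear_formD linear_formN linear_formZ zw ze mulr0 subr0 mul0r add0r.
  by rewrite -scaleNr R_shift.
have thP w : w \in W0 -> [/\ th w \in V, z (th w) = 0 & beta (th w) = 0].
  move=> /W0P[wV zw _]; rewrite lfunE /= /slide memvB ?memvZ // !linear_formD !linear_formN !linear_formZ zw ze phiE.
  by split=> //; [ring | field].
(* Solves [Q h = 1], since [Q (g + c *: e)] is [Q g + c * beta e]. *)
pose c0 := (1 - Q g) / beta e; pose h := g + c0 *: e.
have hV : h \in V by rewrite memvD ?memvZ.
have Qh w c : w \in W0 -> Q (th w + c *: h) = R w + c ^+ 2.
  move=> wW; have [wV zw Rw] := W0P w wW; have [tV zt bt] := thP w wW.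
  rewrite /h scalerDr scalerA addrCA addrC Q_shift linear_formD linear_formZ bt.
  rewrite [Q (th w + _)]QE ?memvD ?memvZ // linear_formD linear_formZ zt ze mulr0 addr0 mul0r add0r R_shift.
  rewrite Rw [Q (th w)]QE // zt mul0r add0r /c0; field.
  exact: be0.
have zh : z h != 0 by rewrite /h linear_formD linear_formZ ze mulr0 addr0.
have dis : (th @: W0 :&: <[h]> = 0)%VS.
  apply/eqP; rewrite -subv0; apply/subvP => v.
  rewrite memv_cap => /andP[/memv_imgP[w wW ->] /vlineP[c tc]].
  have [_ + _] := thP w wW; rewrite tc linear_formZ => /eqP; rewrite mulf_eq0 (negPf zh) orbF => /eqP ->.
  by rewrite scale0r mem0v.
exists (th @: W0 + <[h]>)%VS; split.
- apply/subvP => v /memv_addP[_ /memv_imgP[w wW ->] [_ /vlineP[c ->] ->]].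
  by rewrite memvD ?memvZ //; have [] := thP w wW.
- rewrite dimv_disjoint_sum // dim_vline.
  have -> : h != 0 by apply: contra_neq zh => ->; rewrite linear_form0.
  rewrite addn1 ltnS limg_dim_eq //; apply/eqP; rewrite -subv0; apply/subvP => w.
  rewrite memv_cap memv_ker memv0 => /andP[wW /eqP tw]; apply: contraT => nz.
  move: tw; rewrite lfunE /= /slide => /eqP; rewrite subr_eq0 => /eqP we.
  by have := pd w wW nz; rewrite we Re ltxx.
move=> v /memv_addP[_ /memv_imgP[w wW ->] [_ /vlineP[c ->] ->]]; rewrite Qh //.
have [-> nz|w0 _] := eqVneq w 0; last by apply: ltr_wpDr; rewrite ?sqr_ge0 ?pd.
rewrite R0 add0r exprn_even_gt0 //=.
by apply: contra_neq nz => ->; rewrite linear0 scale0r addr0.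
Qed.

End Hyperbolic.

End PositiveIndex.

(** * Face functions *)

Notation fspace T := {ffun T -> rat^o}.

Section Pull.
Context (S T : finType) (h : S -> T).

Definition pull_fun (v : fspace T) : fspace S := [ffun x => v (h x)].

Lemma pull_is_linear : linear pull_fun.
Proof. by move=> c u v; apply/ffunP => x; rewrite !ffunE. Qed.

HB.instance Definition _ :=
  GRing.isLinear.Build rat (fspace T) (fspace S) _ pull_fun pull_is_linear.

Definition pull : 'Hom(fspace T, fspace S) := linfun pull_fun.

Lemma pullE v x : pull v x = v (h x).
Proof. by rewrite lfunE /= ffunE. Qed.

End Pull.

Section Evaluation.
Context (T : finType) (x : T).

Definition ev_fun (v : fspace T) : rat^o := v x.

Lemma ev_is_linear : linear ev_fun.
Proof. by move=> c u v; rewrite /ev_fun !ffunE. Qed.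

HB.instance Definition _ := GRing.isLinear.Build rat (fspace T) rat^o _ ev_fun ev_is_linear.

Definition ev : 'Hom(fspace T, rat^o) := linfun ev_fun.

Lemma evE v : ev v = v x.
Proof. by rewrite lfunE. Qed.

End Evaluation.

Section Invariants.
Context (T : finType) (h : T -> T).

Definition fixfun : {vspace fspace T} := lker (pull h - \1)%VF.

Lemma mem_fixfun (v : fspace T) : reflect (forall x, v (h x) = v x) (v \in fixfun).
Proof.
rewrite memv_ker add_lfunE opp_lfunE id_lfunE subr_eq0; apply: (iffP eqP) => [e x|e].
  by rewrite -[in RHS]e pullE.
by apply/ffunP => x; rewrite pullE e.
Qed.

Lemma fixfun_connect (v : fspace T) x y : v \in fixfun -> fconnect h x y -> v x = v y.
Proof.
move=> /mem_fixfun vh /iter_findex <-; elim: (findex _ _ _) => //= n ->; by rewrite vh.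
Qed.

Lemma dim_fixfun : injective h -> \dim fixfun = fcard h T.
Proof.
move=> hI; pose S : finType := {x : T | froots h x}.
have rP x : froots h (froot h x) by apply: roots_root; exact: fconnect_sym.
pose r x : S := Sub (froot h x) (rP x).
have kerr : lker (pull r) = 0%VS.
  apply/eqP; rewrite -subv0; apply/subvP => v; rewrite memv_ker memv0 => /eqP e.
  apply/eqP/ffunP => -[x xr]; rewrite ffunE.
  have -> : exist _ x xr = r x :> S by apply: val_inj; rewrite /=; apply/esym/eqP.
  by rewrite -[v (r x)](pullE r) e ffunE.
have -> : fixfun = (pull r @: fullv)%VS.
  apply: subv_anti; apply/andP; split; apply/subvP => v.
    move=> vf; apply/memv_imgP; exists [ffun s : S => v (val s)]; first exact: memvf.
    apply/ffunP => x; rewrite pullE ffunE /=; apply: fixfun_connect => //; exact: connect_root.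
  move=> /memv_imgP[u _ ->]; apply/mem_fixfun => x; rewrite !pullE; congr (u _).
  apply: val_inj => /=; symmetry; apply/eqP.
  rewrite root_connect; [exact: fconnect1 | exact: fconnect_sym].
rewrite limg_dim_eq ?kerr ?capv0 // dimvf.
have -> : dim (fspace S) = #|S| by rewrite /dim /= ?muln1.
by rewrite card_sig; apply: eq_card => x; rewrite !inE andbT.
Qed.

End Invariants.

(** Functions of the regions, kept as [face]-invariant functions of the darts so that a move acts by
    restriction to the surviving darts. *)
Definition faces (D : motif) : {vspace fspace (dart D)} := fixfun (face D).

Lemma facesP (D : motif) (v : fspace (dart D)) :
  reflect (forall x, v (face D x) = v x) (v \in faces D).
Proof. exact: mem_fixfun. Qed.

Lemma dim_faces (D : motif) : \dim (faces D) = fcard (face D) (dart D).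
Proof. by apply: dim_fixfun; exact: face_inj. Qed.

Lemma fcard_order_const (T : finType) (h : T -> T) n : injective h ->
  (forall x, order h x = n) -> (fcard h T * n = #|T|)%N.
Proof.
move=> hI on; apply: fcard_order_set => //; apply/subsetP => x _; by rewrite inE on.
Qed.

Lemma order_ccw (T : finType) (D : diagram T) x : order (ccw D) x = 4.
Proof.
apply: (@order_cycle _ (ccw D) (quad D x)); rewrite ?mem_head ?uniq_quad //.
by rewrite /= !eqxx ccwK eqxx.
Qed.

Lemma order_mate (T : finType) (D : diagram T) x : order (mate D) x = 2.
Proof.
apply: (@order_cycle _ (mate D) [:: x; mate D x]); rewrite ?mem_head //=.
  by rewrite mateK !eqxx.
by rewrite inE andbT eq_sym; apply/eqP; exact: mate_neq.
Qed.

(** With V crossings there are 2V edges and 4V darts, so F + 2g = V + 2, here multiplied by 4. *)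
Lemma euler (g : nat) (D : motif) : on_surface g D ->
  (4 * \dim (faces D) + 8 * g = #|dart D| + 8)%N.
Proof.
case=> _ _ e; rewrite dim_faces.
have := fcard_order_const (@ccw_inj _ D) (order_ccw D).
have := fcard_order_const (@mate_inj _ D) (order_mate D).
move: e; rewrite -![fcard _ (dart D)]/(fcard _ _). lia.
Qed.

Section DeletionFaces.

Context (D D' : motif) (K : dart D -> Prop) (f : dart D' -> dart D).
Context (inner : seq (dart D)) (J : seq (dart D * dart D)).
Context (del : deletion K f) (str : strands K inner J).

Lemma card_deletion : #|dart D| = (size (inner ++ pts J) + #|dart D'|)%N.
Proof. by rewrite cardE (perm_size (perm_darts del str)) (size_cat (inner ++ pts J)) size_map -cardE. Qed.

Context (v : fspace (dart D)) (vD : v \in faces D).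
Hypothesis vJ : forall j, j \in J ->
  v (iter 3 (ccw D) j.1) = v j.2 /\ v (iter 3 (ccw D) j.2) = v j.1.

Let vF x : v (face D x) = v x.
Proof. exact: (elimT (facesP v) vD). Qed.

Let c z := (v z, v (iter 3 (ccw D) z)).
Let iota (q : rat * rat) := (q.2, q.1).

Let p : pairing (dart D) (bijection unit) := @bypass (bijection unit) D inner.

Lemma faces_exits x y : x \notin inner -> exits p J x y ->
  v y = v (iter 3 (ccw D) x) /\ v (iter 3 (ccw D) y) = v x.
Proof.
move=> xi ex; have iK : involutive iota by case.
suff e : c y = iota (c x) by split; [exact: (congr1 fst e) | exact: (congr1 snd e)].
apply: (exits_invariant iK) ex.
- move=> z lz; have zi : z \notin inner by apply/negP => zi; move: lz; rewrite /live /= zi eqxx.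
  rewrite /c /iota (bypassE _ zi) /=; congr pair.
    by rewrite -[ccw D _]face_mate vF.
  exact: vF.
- by move=> j /vJ[e1 e2]; rewrite /c /iota e1 e2.
- by case/andP: (okl_bypass (bijection unit) str).
apply: live_bypass. exact: xi.
Qed.

Lemma pull_faces : pull f v \in faces D'.
Proof.
apply/facesP => x; rewrite !pullE /face /=.
have [-> _ _] := del_mor del (ccw D' (ccw D' (mate D' x))).
have [-> _ _] := del_mor del (ccw D' (mate D' x)); have [-> _ _] := del_mor del (mate D' x).
have xi := image_notin_inner del str (mate D' x).
have := exits_image del str (mate D' x) (@bypassE (bijection unit) D inner).
by rewrite mateK => /(faces_exits xi)[->].
Qed.

Lemma exits_survive x y : x \notin inner -> exits p J x y -> exists z, f z = y.
Proof.
move=> xi ex; apply/(del_im del) => /(str_split str); rewrite mem_cat.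
elim: ex xi => {x y} [x y e yJ xi|x u w y e uw _ IH xi].
  rewrite (negPf yJ) orbF -e bypassE // => /(str_inner str); rewrite mateK.
  exact/negP.
apply: IH; apply: (pts_notin_inner str).
by case: uw => /mem_pts/andP[].
Qed.

(** Every deleted strand exits to a surviving dart that borders the same two regions, so zero values
    there propagate back. *)
Lemma faces_vanish : pull f v = 0 -> forall u, u \in pts J -> v u = 0.
Proof.
move=> v0; have vf x : v (f x) = 0 by rewrite -(pullE f) v0 ffunE.
have J0 j : j \in J -> v j.1 = 0 /\ v j.2 = 0.
  move=> jJ; have [y ex] := exits_partner del str (@bypassE (bijection unit) D inner) jJ.
  have ji : j.2 \notin inner.
    apply/negP => ji; apply: (inner_ptsF str ji).
    by have /andP[] : (j.1 \in pts J) && (j.2 \in pts J) by apply: mem_pts; case: (j) jJ.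
  have [x xy] := exits_survive ji ex; have [e1 e2] := faces_exits ji ex.
  have [_ e3] := vJ jJ; rewrite -e3 -e1 -e2 -xy /=.
  have [<- _ _] := del_mor del x; have [<- _ _] := del_mor del (ccw D' x).
  by have [<- _ _] := del_mor del (ccw D' (ccw D' x)); rewrite !vf.
elim: (J) J0 => // -[a b] J' IH J0 u; rewrite pts_cons !in_cons => /or3P[/eqP->|/eqP->|].
- by have [] := J0 _ (mem_head _ _).
- by have [] := J0 _ (mem_head _ _).
by apply: IH => j jJ; apply: J0; rewrite in_cons jJ orbT.
Qed.

End DeletionFaces.

(** * The quadratic form of a motif *)

Section FunctionSpace.
Context (T : finType) (u v : fspace T) (c : rat) (x : T).
Lemma fspace0 : (0 : fspace T) x = 0 :> rat. Proof. by rewrite ffunE. Qed.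
Lemma fspaceD : (u + v) x = (u x : rat) + v x :> rat. Proof. by rewrite ffunE. Qed.
Lemma fspaceN : (- u) x = - (u x : rat) :> rat. Proof. by rewrite ffunE. Qed.
Lemma fspaceZ : (c *: u) x = c * u x :> rat. Proof. by rewrite ffunE. Qed.
End FunctionSpace.

Section Form.

Context (T : finType) (D : diagram T).

(** The squared jump between two opposite regions minus that between the other two: both Goeritz
    forms of a checkerboard colouring at once, with opposite signs and without choosing a
    colouring. *)
Definition local_form (d : T) (v : fspace T) : rat :=
  ((v d : rat) - v (ccw D (ccw D d))) ^+ 2
  - ((v (ccw D d) : rat) - v (ccw D (ccw D (ccw D d)))) ^+ 2.

Lemma local_form_ccw d v : local_form (ccw D d) v = - local_form d v.
Proof. rewrite /local_form ccwK; ring. Qed.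

Definition form (v : fspace T) : rat := \sum_(d <- reps D) local_form d v.

Lemma form_quad d v :
  \sum_(x <- quad D d | is_rep D x) local_form x v = (-1) ^+ (~~ is_over D d) * local_form d v.
Proof.
rewrite !big_cons big_nil /is_rep !(over_ccw, out_opposite) !local_form_ccw !opprK.
by case: (is_over D d) (is_out D d) (is_out D (ccw D d)) => [] [] [] /=;
  rewrite ?(mul1r, mulN1r, addr0).
Qed.

Lemma form0 : form 0 = 0.
Proof. by apply: big1_seq => d _; rewrite /local_form !fspace0. Qed.

Definition polar (g : fspace T) : 'Hom(fspace T, rat^o) :=
  \sum_(d <- reps D)
    (2 * ((g d : rat) - g (ccw D (ccw D d))) *: (ev d - ev (ccw D (ccw D d)))
    - 2 * ((g (ccw D d) : rat) - g (ccw D (ccw D (ccw D d)))) *: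
        (ev (ccw D d) - ev (ccw D (ccw D (ccw D d))))).

Lemma form_polar v c g : form (v + c *: g) = form v + c * polar g v + c ^+ 2 * form g.
Proof.
rewrite /form /polar sum_lfunE /= !mulr_sumr -!big_split; apply: eq_bigr => d _ /=.
rewrite add_lfunE opp_lfunE !scale_lfunE !add_lfunE !opp_lfunE !evE.
rewrite /local_form !(fspaceD, fspaceZ).
set a := v d; set b := v _; set p := v _; set q := v _.
set a' := g d; set b' := g _; set p' := g _; set q' := g _.
rewrite -![_ *: _]/(_ * _).
ring.
Qed.

End Form.

(* The largest such n is a signature with the Gordon-Litherland correction. *)
Definition form_index (D : motif) (n : int) : Prop :=
  exists2 k : nat, pos (faces D) (form D) k &
    (n <= k%:Z + k%:Z - (\dim (faces D))%:Z + writhe D)%R.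

Section DeletionForm.

Context (D D' : motif) (K : dart D -> Prop) (f : dart D' -> dart D).
Context (inner : seq (dart D)) (J : seq (dart D * dart D)).
Context (del : deletion K f) (str : strands K inner J).

Lemma form_deletion v :
  form D v = \sum_(d <- inner ++ pts J | is_rep D d) local_form D d v + form D' (pull f v).
Proof.
rewrite /form /reps big_filter (perm_big _ (perm_darts del str)) big_cat /=; congr (_ + _)%R.
rewrite big_map big_filter; apply: eq_big => x; rewrite /is_rep.
  by case: (del_mor del x) => _ -> ->.
move=> _; rewrite /local_form !pullE.
have [-> _ _] := del_mor del (ccw D' (ccw D' x)).
by have [-> _ _] := del_mor del (ccw D' x); have [-> _ _] := del_mor del x.
Qed.

End DeletionForm.

Definition indic (T : finType) (s : seq T) : fspace T := [ffun x => (x \in s)%:R].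

Lemma indicE (T : finType) (s : seq T) x : indic s x = (x \in s)%:R :> rat.
Proof. by rewrite ffunE. Qed.

Lemma fsubE (T : finType) (x y : T) (v : fspace T) : (ev x - ev y)%VF v = (v x : rat) - v y :> rat.
Proof. by rewrite add_lfunE opp_lfunE !evE. Qed.

Lemma mem_capker (vT wT : vectType rat) (V : {vspace vT}) (h : 'Hom(vT, wT)) v :
  (v \in V :&: lker h)%VS = (v \in V) && (h v == 0).
Proof. by rewrite memv_cap memv_ker. Qed.

(** * The quadratic form under the moves *)

Section FormR1.

Context (g : nat) (D D' : motif) (sD : on_surface g D) (sD' : on_surface g D').
Context (d : dart D) (hd : face D d = d) (f : dart D' -> dart D)
  (del : deletion (same_crossing D d) f).

Let str := R1_strands hd.
Let e : fspace (dart D) := indic [:: d].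

Let md := R1_mate hd.

Lemma R1_faces v : v \in faces D -> [/\ (v (ccw D (ccw D (ccw D d))) : rat) = v (ccw D d) &
  forall j, j \in [:: (ccw D (ccw D d), ccw D (ccw D (ccw D d)))] ->
   v (iter 3 (ccw D) j.1) = v j.2 /\ v (iter 3 (ccw D) j.2) = v j.1].
Proof.
move=> /facesP vF; have e1 : v (ccw D (ccw D (ccw D d))) = v (ccw D d).
  by rewrite -(vF (ccw D d)) /face (R1_mate_ccw hd).
by split=> // j; rewrite inE => /eqP -> /=; rewrite !ccwK e1.
Qed.

Lemma R1_indic_face : e \in faces D.
Proof.
apply/facesP => x; rewrite /e !ffunE !inE; congr ((nat_of_bool _)%:R).
apply/eqP/eqP => [h|->]; last exact: hd.
by apply: (@face_inj _ D); rewrite h hd.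
Qed.

Lemma R1_pull_indic : pull f e = 0.
Proof.
apply/ffunP => x; rewrite pullE /e !ffunE inE.
have /negPf -> // : f x != d.
apply/eqP => h; have := image_notin del str x; rewrite h inE eqxx; done.
Qed.

(** A function vanishing on the surviving darts can be nonzero only on the monogon, which gives the
    kernel. Surjectivity is a dimension count, by Euler's formula for both diagrams. *)
Lemma R1_pull_faces : (pull f @: faces D = faces D')%VS /\ \dim (faces D) = (\dim (faces D')).+1.
Proof.
have sub : (pull f @: faces D <= faces D')%VS.
  apply/subvP => _ /memv_imgP[v vD ->]; have [_ vJ] := R1_faces vD.
  exact: (pull_faces del str vD vJ).
have ker : (faces D :&: lker (pull f) = <[e]>)%VS.
  apply: subv_anti; apply/andP; split; apply/subvP => v.
    rewrite mem_capker => /andP[vD /eqP v0]; have [v31 vJ] := R1_faces vD.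
    have van := faces_vanish del str vD vJ v0.
    apply/vlineP; exists (v d); apply/ffunP => x; rewrite /e !ffunE inE.
    case: eqP => [->|xd]; first by rewrite [RHS]mulr1.
    rewrite [RHS]mulr0.
    have [/same_crossing_quad|/(del_im del)[y <-]] := pselect (same_crossing D d x).
      rewrite !inE (introF eqP xd) /= => /or3P[] /eqP ->.
      - by rewrite -v31; apply: van; rewrite !inE eqxx orbT.
      - by apply: van; rewrite !inE eqxx.
      by apply: van; rewrite !inE eqxx orbT.
    by rewrite -(pullE f) v0 ffunE.
  move=> /vlineP[c ->]; rewrite memvZ // mem_capker R1_indic_face R1_pull_indic eqxx.
  by [].
have e0 : e != 0.
  apply/eqP => /ffunP/(_ d); rewrite /e !ffunE inE eqxx; exact/eqP/oner_neq0.
have dims := limg_ker_dim (pull f) (faces D); rewrite ker dim_vline e0 in dims.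
have := euler sD; have := euler sD'; have := card_deletion del str => /= c E' E.
have F : \dim (faces D) = (\dim (faces D')).+1 by lia.
split=> //; apply/eqP; rewrite eqEdim sub -ltnS -F -dims. exact: leqnn.
Qed.

(** A monogon adds the square of [phi] with a sign. Index, dimension and writhe grow by 1, 1, -1 if
    the sign is plus, and by 0, 1, 1 if it is minus; both leave 2 k - dim + w unchanged. *)
Lemma form_index_R1 n : form_index D n <-> form_index D' n.
Proof.
have [onto dimF] := R1_pull_faces.
have uq := uniq_quad D d; move: (uq); rewrite /= !inE !negb_or => /and4P[/and3P[n1 n2 n3] _ _ _].
pose phi := (ev d - ev (ccw D (ccw D d)))%VF.
have phiE v : phi v = (v d : rat) - v (ccw D (ccw D d)) by exact: fsubE.
have phie : phi e = 1.
  by rewrite phiE /e !indicE !inE eqxx eq_sym (negPf n2) subr0.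
have fE v : v \in faces D -> form D v = (-1) ^+ (~~ is_over D d) * phi v ^+ 2 + form D' (pull f v).
  move=> vD; have [v31 _] := R1_faces vD.
  rewrite (form_deletion del str) (form_quad D d); congr (_ * _ + _).
  by rewrite /local_form v31 phiE subrr expr0n subr0.
have pulls v : pull f (v - (phi v : rat) *: e) = pull f v.
  by rewrite linearB linearZ /= R1_pull_indic scaler0 subr0.
have slideV v : v \in faces D -> v - (phi v : rat) *: e \in faces D.
  by move=> vD; rewrite memvB ?memvZ ?R1_indic_face.
have phis v : phi (v - (phi v : rat) *: e) = 0 by rewrite linear_formD linear_formN linear_formZ phie mulr1 subrr.
have ontok : (pull f @: (faces D :&: lker phi) = faces D')%VS.
  apply: subv_anti; rewrite -onto limgS ?capvSl //=.
  apply/subvP => _ /memv_imgP[v vD ->]; rewrite -pulls memv_img // mem_capker slideV //=.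
  by rewrite phis.
have iff_ker k : pos (faces D :&: lker phi) (form D) k <-> pos (faces D') (form D') k.
  apply: (pos_pull _ ontok); last exact: form0.
  move=> v; rewrite mem_capker => /andP[vD /eqP pv].
  by rewrite fE // pv expr0n mulr0 add0r.
have wr := writhe_deletion del str.
rewrite (signum_quad D d) -[ccw D d]md out_mate in wr.
rewrite /form_index dimF wr; case: (boolP (is_over D d)) => od; rewrite od in fE wr *.
  have st k : pos (faces D) (form D) k.+1 <-> pos (faces D') (form D') k.
    rewrite -iff_ker; apply: (pos_plus R1_indic_face phie (form0 D)) => v vD.
    by rewrite !fE ?slideV // pulls phis; ring.
  have -> : (is_out D d == ~~ is_out D d) == true = false by case: (is_out D d).
  split=> -[k].
    case: k => [_ h|k /st pk h]; last by exists k => //; lia.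
    exists 0; first by exists 0%VS; split; rewrite ?sub0v // => v; rewrite memv0 => ->.
    lia.
  by move=> /st pk h; exists k.+1 => //; lia.
have st k : pos (faces D) (form D) k <-> pos (faces D') (form D') k.
  rewrite -iff_ker; apply: (pos_minus R1_indic_face phie (form0 D)) => v vD.
  by rewrite !fE ?slideV // pulls phis; ring.
have -> : (is_out D d == ~~ is_out D d) == false by case: (is_out D d).
by split=> -[k /st pk h]; exists k => //; lia.
Qed.

End FormR1.

Section FormR2.

Context (g : nat) (D D' : motif) (sD : on_surface g D) (sD' : on_surface g D').
Context (d d' : dart D) (hd1 : face D d = d') (hd : face D d' = d)
  (hcr : ~ same_crossing D d d') (hov : is_over D (mate D d) = is_over D d)
  (f : dart D' -> dart D)
  (del : deletion (fun e => same_crossing D d e \/ same_crossing D d' e) f).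

Let str := R2_strands hd1 hd hcr.
Let e : fspace (dart D) := indic [:: d; d'].
Let z0 : 'Hom(fspace (dart D), rat^o) := (ev (ccw D (ccw D d')) - ev (ccw D (ccw D d)))%VF.

Lemma R2_faces v : v \in faces D ->
  [/\ (v d' : rat) = v d, (v (ccw D (ccw D (ccw D d))) : rat) = v (ccw D d'),
      (v (ccw D (ccw D (ccw D d'))) : rat) = v (ccw D d) &
  v (ccw D (ccw D d')) = v (ccw D (ccw D d)) ->
  forall j, j \in [:: (ccw D (ccw D d), ccw D (ccw D (ccw D d')));
                      (ccw D (ccw D (ccw D d)), ccw D (ccw D d'))] ->
   v (iter 3 (ccw D) j.1) = v j.2 /\ v (iter 3 (ccw D) j.2) = v j.1].
Proof.
move=> /facesP vF; have e1 : v (ccw D (ccw D (ccw D d))) = v (ccw D d').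
  by rewrite -(vF (ccw D d')) /face (R2_mate_ccw' hd1).
have e2 : v (ccw D (ccw D (ccw D d'))) = v (ccw D d).
  by rewrite -(vF (ccw D d)) /face (R2_mate_ccw hd).
split=> //; first by rewrite -hd1 vF.
by move=> e3 j; rewrite !inE => /orP[] /eqP -> /=; rewrite !ccwK ?e1 ?e2 ?e3.
Qed.

Lemma R2_indic_face : e \in faces D.
Proof.
apply/facesP => x; rewrite /e !ffunE !inE; congr ((nat_of_bool _)%:R).
apply/orP/orP => -[/eqP h|/eqP h].
- by right; apply/eqP/(@face_inj _ D); rewrite h hd.
- by left; apply/eqP/(@face_inj _ D); rewrite h hd1.
- by right; apply/eqP; rewrite h hd1.
by left; apply/eqP; rewrite h hd.
Qed.

Let notin_indic (i : nat) : (i < 8)%N -> i \notin [:: 0; 4]%N ->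
  (nth d (quad D d ++ quad D d') i \in [:: d; d']) = false.
Proof.
move=> i8 i04; have uq := R2_uniq hcr.
rewrite !inE -[X in (_ == X) || _]/(nth d (quad D d ++ quad D d') 0).
rewrite -[X in _ || (_ == X)]/(nth d (quad D d ++ quad D d') 4) !nth_uniq //.
by move: i04; rewrite !inE => /negPf.
Qed.

Lemma R2_pull_indic : pull f e = 0.
Proof.
apply/ffunP => x; rewrite pullE /e !ffunE.
have /negPf -> // : f x \notin [:: d; d'].
apply: contra (image_notin del str x); rewrite !inE => /orP[] ->; rewrite ?orbT //.
Qed.

Lemma R2_e : [/\ e d = 1, e d' = 1, e (ccw D (ccw D d)) = 0 & e (ccw D (ccw D d')) = 0].
Proof.
rewrite /e !ffunE (notin_indic (i := 2)) // (notin_indic (i := 6)) //.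
by rewrite !inE !eqxx orbT.
Qed.

(** [z0] compares the two regions that the move merges. By Euler's formula [D'] has two regions
    less: one is the bigon, and the other can only be lost by merging distinct regions, so [z0] does
    not vanish. *)
Lemma R2_pull_faces : [/\ (pull f @: (faces D :&: lker z0) = faces D')%VS,
  \dim (faces D) = (\dim (faces D')).+2 &
  exists2 h, h \in faces D & z0 h != 0].
Proof.
have sub : (pull f @: (faces D :&: lker z0) <= faces D')%VS.
  apply/subvP => _ /memv_imgP[v + ->]; rewrite mem_capker fsubE subr_eq0 => /andP[vD /eqP vz].
  have [_ _ _ /(_ vz) vJ] := R2_faces vD.
  exact: (pull_faces del str vD vJ).
have [ed ed' e2 e2'] := R2_e.
have ker : ((faces D :&: lker z0) :&: lker (pull f) = <[e]>)%VS.
  apply: subv_anti; apply/andP; split; apply/subvP => v.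
    rewrite mem_capker => /andP[+ /eqP v0]; rewrite mem_capker fsubE subr_eq0 => /andP[vD /eqP vz].
    have [vd v3 v3' /(_ vz) vJ] := R2_faces vD.
    have van := faces_vanish del str vD vJ v0.
    apply/vlineP; exists (v d); apply/ffunP => x; rewrite /e !ffunE.
    case: (boolP (x \in [:: d; d'])) => [|xd].
      by rewrite !inE => /orP[] /eqP ->; rewrite ?vd [RHS]mulr1.
    rewrite [RHS]mulr0.
    have [xK|/(del_im del)[y <-]] :=
        pselect (same_crossing D d x \/ same_crossing D d' x).
      have : x \in quad D d ++ quad D d'.
        by rewrite mem_cat; case: xK => /same_crossing_quad ->; rewrite ?orbT.
      rewrite mem_cat => /orP[]; rewrite !inE => /or4P[] /eqP xE.
      - by move: xd; rewrite xE !inE eqxx.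
      - by rewrite xE -v3'; apply: van; rewrite !inE eqxx ?orbT.
      - by rewrite xE; apply: van; rewrite !inE eqxx ?orbT.
      - by rewrite xE; apply: van; rewrite !inE eqxx ?orbT.
      - by move: xd; rewrite xE !inE eqxx orbT.
      - by rewrite xE -v3; apply: van; rewrite !inE eqxx ?orbT.
      - by rewrite xE; apply: van; rewrite !inE eqxx ?orbT.
      by rewrite xE; apply: van; rewrite !inE eqxx ?orbT.
    by rewrite -(pullE f) v0 ffunE.
  move=> /vlineP[c ->]; rewrite memvZ // mem_capker mem_capker R2_indic_face R2_pull_indic eqxx.
  by rewrite fsubE e2 e2' subrr eqxx.
have e0 : e != 0.
  by apply/eqP => e0; move: ed; rewrite e0 ffunE => /eqP; rewrite eq_sym (negPf (oner_neq0 _)).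
have dims := limg_ker_dim (pull f) (faces D :&: lker z0); rewrite ker dim_vline e0 in dims.
have := euler sD; have := euler sD'; have := card_deletion del str => /= c E' E.
have F : \dim (faces D) = (\dim (faces D')).+2 by lia.
have dk := dim_lker_cap (faces D) z0.
have ds := dimvS sub; have dc := dimvS (capvSl (faces D) (lker z0)).
have s1 : (\dim (faces D :&: lker z0) <= (\dim (faces D')).+1)%N by rewrite -dims add1n ltnS.
split=> //.
  apply/eqP; rewrite eqEdim sub -ltnS -ltnS -F; apply: leq_trans dk _.
  by rewrite ltnS -dims add1n.
have : ~~ (faces D <= lker z0)%VS.
  apply/negP => /capv_idPl cE; move: s1; rewrite cE F; lia.
by move=> /subvPn[h hF hz]; exists h => //; move: hz; rewrite memv_ker.
Qed.

Lemma R2_opposite_faces : ~~ fconnect (face D) (ccw D (ccw D d')) (ccw D (ccw D d)).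
Proof.
have [_ _ [h hF hz]] := R2_pull_faces; apply: contra hz => /(fixfun_connect hF) hE.
by rewrite fsubE hE subrr.
Qed.

(** The two crossings have opposite signs, so the squares of the jump between the regions beside the
    bigon cancel. The difference of the other squares factors as a product [z v * y v], a hyperbolic
    plane: index and dimension drop by 1 and 2, and the writhe is kept. *)
Lemma form_index_R2 n : form_index D n <-> form_index D' n.
Proof.
have [onto dimF [h hF hz]] := R2_pull_faces; have [ed ed' e2 e2'] := R2_e.
pose z := ((-1) ^+ (~~ is_over D d) *: z0)%VF.
pose y := (ev d + ev d - ev (ccw D (ccw D d)) - ev (ccw D (ccw D d')))%VF.
have z0E v : z0 v = (v (ccw D (ccw D d')) : rat) - v (ccw D (ccw D d)) by exact: fsubE.
have zE v : z v = (-1) ^+ (~~ is_over D d) * z0 v :> rat by rewrite /z scale_lfunE.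
have yE v : y v = (v d : rat) + v d - v (ccw D (ccw D d)) - v (ccw D (ccw D d')).
  by rewrite /y !add_lfunE !opp_lfunE !evE.
have kz : lker z = lker z0.
  by apply/vspaceP => v; rewrite !memv_ker zE mulf_eq0 signr_eq0.
have z0e : z0 e = 0 by rewrite z0E e2 e2' subrr.
have ye : y e != 0 by rewrite yE ed e2 e2' !subr0.
have QE v : v \in faces D -> form D v = z v * y v + form D' (pull f v).
  move=> vD; have [vd v3 v3' _] := R2_faces vD.
  rewrite (form_deletion del str) (perm_big _ (R2_perm _ _)) big_cat /= !form_quad.
  rewrite (R2_over hd1 hov) negbK zE z0E yE /local_form vd v3 v3'.
  by case: (is_over D d); rewrite /=; ring.
have Rs v c : form D' (pull f (v + c *: e)) = form D' (pull f v).
  by rewrite linearD linearZ /= R2_pull_indic scaler0 addr0.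
have st k : pos (faces D) (form D) k.+1 <-> pos (faces D') (form D') k.
  rewrite (@pos_hyperbolic _ (faces D) (form D) (fun v => form D' (pull f v)) z y e h (polar D h)) //.
  - rewrite kz; apply: (pos_pull _ onto) => //; exact: form0.
  - exact: R2_indic_face.
  - by rewrite zE z0e mulr0.
  - by rewrite zE mulf_neq0 // signr_eq0.
  - by move=> v c; rewrite form_polar.
  by rewrite linear0 form0.
have wr := writhe_deletion del str.
rewrite (perm_big _ (R2_perm _ _)) big_cat /= !signum_quad (R2_over hd1 hov) in wr.
rewrite -(R2_mate hd1) -[ccw D d](R2_mate' hd) !out_mate in wr.
have {}wr : writhe D = writhe D'.
  rewrite wr; case: (is_out D d) (is_out D d') (is_over D d) => [] [] [] /=; lia.
rewrite /form_index dimF wr; split=> -[k].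
  case: k => [_ nk|k /st pk nk]; last by exists k => //; lia.
  exists 0; first by exists 0%VS; split; rewrite ?sub0v // => v; rewrite memv0 => ->.
  lia.
by move=> /st pk nk; exists k.+1 => //; lia.
Qed.

End FormR2.

(** The sign makes the term independent of the dart chosen at the crossing, so the form can be
    computed from any transversal. *)
Definition crossing_form (T : finType) (D : diagram T) (v : fspace T) (x : T) : rat :=
  (-1) ^+ (~~ is_over D x) * local_form D x v.

Lemma sum_transversal (T : finType) (D : diagram T) (F : T -> rat) s :
  (forall x, F (ccw D x) = F x) -> transversal D s ->
  \sum_(x <- s) F x *+ 4 = \sum_x F x.
Proof.
move=> Fc ts; rewrite -[RHS]big_enum /= -(perm_big _ ts).
elim: s {ts} => [|x s IH]; first by rewrite !big_nil.
by rewrite map_cons cpts_cons !big_cons {}IH /= !Fc /=; ring.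
Qed.

Lemma form_transversal (T : finType) (D : diagram T) (v : fspace T) s :
  transversal D s -> form D v = \sum_(x <- s) crossing_form D v x.
Proof.
move=> ts; have Fc x : crossing_form D v (ccw D x) = crossing_form D v x.
  by rewrite /crossing_form over_ccw negbK local_form_ccw; case: (is_over D x); rewrite /=; ring.
have := sum_transversal Fc ts; rewrite -(sum_transversal Fc (reps_transversal D)).
rewrite !sumrMnl => /eqP; rewrite eqr_pMn2r // => /eqP ->; apply: eq_big_seq => x.
by rewrite mem_filter /crossing_form => /andP[/andP[-> _] _]; rewrite mul1r.
Qed.

Section FormR3.

Context (T : finType) (D D' : diagram T) (a b c : T) (s : T -> T).
Context (H : R3_data D D' a b c s).

Local Notation ccw := (ccw D).
Local Notation K := (quad D a ++ quad D b ++ quad D c).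

(* Completing the square in the value v a on the triangle, on both sides of the move,
   shows by how much this value must change. *)
Definition R3_shift : 'Hom(fspace T, rat^o) :=
  (ev (ccw (ccw (ccw a))) - ev (ccw (ccw c)) +
   (-1) ^+ (is_over D a (+) is_over D c) *:
     (ev (ccw (ccw (ccw b))) - ev (ccw (ccw a)) - ev (ccw (ccw (ccw c))) + ev (ccw (ccw b))))%VF.

(** With the identity as corner function, [R3_corner] tells from which dart each value is copied;
    the new triangle copies [v a] and adds the shift. *)
Definition R3_fun (v : fspace T) : fspace T :=
  [ffun x => (v (R3_corner D a b c id a x) : rat)
     + (x \in [:: ccw (ccw a); ccw (ccw b); ccw (ccw c)])%:R * R3_shift v].

Lemma R3_fun_is_linear : linear R3_fun.
Proof.
move=> k u v; apply/ffunP => x; rewrite !ffunE linear_formD linear_formZ.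
by rewrite -![_ *: _]/(_ * _); ring.
Qed.

HB.instance Definition _ :=
  GRing.isLinear.Build rat (fspace T) (fspace T) _ R3_fun R3_fun_is_linear.

Definition R3_hom : 'Hom(fspace T, fspace T) := linfun R3_fun.

Lemma R3_homE (v : fspace T) x :
  R3_hom v x = R3_corner D a b c v ((v a : rat) + R3_shift v) x.
Proof.
have uq := R3_uniq H.
have [[a0 a1 a2 a3] [b0 b1 b2 b3] [c0 c1 c2 c3] h] := R3_corner_values H (id : T -> T) a.
have [[a0' a1' a2' a3'] [b0' b1' b2' b3'] [c0' c1' c2' c3'] h'] :=
  R3_corner_values H v ((v a : rat) + R3_shift v).
rewrite lfunE /= ffunE.
have nC i : (i < 12)%N -> (nth a K i \in [:: ccw (ccw a); ccw (ccw b); ccw (ccw c)]) = (i \in [:: 2; 6; 10]%N).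
  move=> i12; rewrite !inE -[X in (_ == X) || _]/(nth a K 2).
  by rewrite -[X in _ || ((_ == X) || _)]/(nth a K 6) -[X in _ || (_ || (_ == X))]/(nth a K 10) !nth_uniq.
case: (boolP (x \in K)) => xK; last first.
  rewrite h // h' //; suff -> : (x \in [:: ccw (ccw a); ccw (ccw b); ccw (ccw c)]) = false.
    by rewrite mul0r addr0.
  apply: contraNF xK; rewrite !inE => /or3P[] /eqP ->; by rewrite eqxx ?orbT.
have [i i12 ->] : exists2 i, (i < 12)%N & x = nth a K i.
  by exists (index x K); rewrite ?nth_index // -[12%N]/(size K) index_mem.
rewrite nC //.
case: i i12 => [|[|[|[|[|[|[|[|[|[|[|[|//]]]]]]]]]]]] _ /=;
  rewrite ?(a0, a1, a2, a3, b0, b1, b2, b3, c0, c1, c2, c3)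
    ?(a0', a1', a2', a3', b0', b1', b2', b3', c0', c1', c2', c3') ?mul1r ?mul0r ?addr0 //.
Qed.

Lemma R3_face_corners v : v \in faces (Motif D) ->
  [/\ v b = v a, v c = v a, v (ccw b) = v (ccw (ccw (ccw a))),
      v (ccw c) = v (ccw (ccw (ccw b))) & v (ccw a) = v (ccw (ccw (ccw c)))].
Proof.
move=> /facesP /= vF; have [ma mb mc] := R3_mates H.
have e x : v (ccw (ccw (ccw x))) = v (mate D x) by rewrite -face_mate vF.
by split; rewrite ?e ?ma ?mb ?mc // -?(R3_fc H) -?(R3_fb H) -?(R3_fa H) ?vF.
Qed.

Lemma R3_hom_faces v : v \in faces (Motif D) -> R3_hom v \in faces (Motif D').
Proof.
move=> vD; have [vb vc E1 E2 E3] := R3_face_corners vD.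
apply/facesP => x; rewrite !R3_homE.
have := @R3_corner_face _ _ _ _ _ _ _ _ H v ((v a : rat) + R3_shift v) (esym vb) (esym vc) E1 E2 E3 x.
case=> [[-> _] //|[-> ->]].
by move/facesP: vD => /= ->.
Qed.

Lemma R3_hom_form v : v \in faces (Motif D) -> form D v = form D' (R3_hom v).
Proof.
move=> vD; have [vb vc E1 E2 E3] := R3_face_corners vD.
have [r rK tr] := R3_transversal H.
have tr' : transversal D' [:: a, b, c & r].
  rewrite /transversal (@eq_map _ _ _ (crossing_at D)) // => y.
  by rewrite /crossing_at !(R3_ccw H) (R3_isover H).
rewrite (form_transversal v tr) (form_transversal _ tr') !big_cons.
have -> : \sum_(j <- r) crossing_form D v j = \sum_(j <- r) crossing_form D' (R3_hom v) j.
  apply: eq_big_seq => x xr; rewrite /crossing_form /local_form !(R3_ccw H) (R3_isover H) !R3_homE.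
  have [_ _ _ h] := R3_corner_values H v ((v a : rat) + R3_shift v).
  have xK y : y \in quad D x -> y \notin K.
    move=> yx; apply: rK; rewrite mem_quads; by apply/hasP; exists x.
  by rewrite !h ?xK // !inE eqxx ?orbT.
rewrite !addrA; congr (_ + _).
rewrite /crossing_form /local_form !(R3_ccw H) !(R3_isover H) !R3_homE.
have [[a0 a1 a2 a3] [b0 b1 b2 b3] [c0 c1 c2 c3] _] :=
  R3_corner_values H v ((v a : rat) + R3_shift v).
rewrite a0 a1 a2 a3 b0 b1 b2 b3 c0 c1 c2 c3 vb vc E1 E2 E3.
have -> : R3_shift v = (v (ccw (ccw (ccw a))) : rat) - v (ccw (ccw c)) +
   (-1) ^+ (is_over D a (+) is_over D c) *
     ((v (ccw (ccw (ccw b))) : rat) - v (ccw (ccw a)) - v (ccw (ccw (ccw c))) + v (ccw (ccw b))).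
  rewrite /R3_shift !(add_lfunE, opp_lfunE, scale_lfunE) !evE.
  by rewrite -![_ *: _]/(_ * _).
rewrite (R3_over H); case: (is_over D a) (is_over D c) => [] [] /=; ring.
Qed.

End FormR3.

(** A map preserving the form is injective on positive definite subspaces, so no inverse is asked
    for; the dimensions agree by Euler's formula. *)
Lemma form_index_hom g (D D' : motif) (h : 'Hom(fspace (dart D), fspace (dart D'))) n :
  on_surface g D -> on_surface g D' -> #|dart D| = #|dart D'| -> writhe D = writhe D' ->
  (forall v, v \in faces D -> h v \in faces D' /\ form D v = form D' (h v)) ->
  form_index D n -> form_index D' n.
Proof.
move=> sD sD' cD wD hV [k [W [WV kW pd]] nk]; exists k.
  apply: (pos_leq kW); apply: (@limg_pos _ _ W _ _ (form D) h) => //.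
  - by apply/subvP => _ /memv_imgP[w /(subvP WV) /hV[? _] ->].
  - by move=> w /(subvP WV) /hV[_ ->].
  by move=> w /(subvP WV) /hV[_ ->] ->; rewrite form0.
have := euler sD; have := euler sD'; rewrite -wD -cD; lia.
Qed.

Lemma form_index_R3 g (T : finType) (D D' : diagram T) n :
  on_surface g (Motif D) -> on_surface g (Motif D') -> R3 D D' ->
  form_index (Motif D) n <-> form_index (Motif D') n.
Proof.
move=> sD sD' /R3_exists[a [b [c [s H]]]].
have wr : writhe (Motif D) = writhe (Motif D').
  apply: eq_big => x; first by rewrite /= (R3_isover H) (R3_isout H).
  by rewrite /= (R3_isout H) (R3_ccw H).
have H' := R3_sym H; split.
  apply: (@form_index_hom g (Motif D) (Motif D') (R3_hom D a b c) n sD sD' erefl wr) => v vD.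
  by split; [exact: (R3_hom_faces H vD) | exact: (R3_hom_form H vD)].
apply: (@form_index_hom g (Motif D') (Motif D) (R3_hom D' (ccw D (ccw D a)) (ccw D (ccw D b))
  (ccw D (ccw D c))) n sD' sD erefl (esym wr)) => v vD.
by split; [exact: (R3_hom_faces H' vD) | exact: (R3_hom_form H' vD)].
Qed.

(** * Homeomorphisms and equivalent motifs *)

Section Homeo.

Context (D D' : motif) (f : dart D -> dart D').
Context (fbij : bijective f) (fm : diagram_morphism D D' f).

Lemma iso_face x : f (face D x) = face D' (f x).
Proof.
rewrite /face /=; have [-> _ _ _] := fm (ccw D (ccw D (mate D x))).
by have [-> _ _ _] := fm (ccw D (mate D x)); have [-> _ _ _] := fm (mate D x); have [_ -> _ _] := fm x.
Qed.

Lemma iso_writhe : writhe D = writhe D'.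
Proof.
rewrite [RHS]/writhe (reindex f) /=; last exact: onW_bij.
apply: eq_big => x; first by have [_ _ -> ->] := fm x.
by have [<- _ _ _] := fm x; have [_ _ _ ->] := fm (ccw D x).
Qed.

Lemma iso_form v : form D' v = form D (pull f v).
Proof.
have fc (E : motif) (u : fspace (dart E)) x : crossing_form E u (ccw E x) = crossing_form E u x.
  by rewrite /crossing_form over_ccw negbK local_form_ccw; case: (is_over E x); rewrite /=; ring.
have e4 (E : motif) (u : fspace (dart E)) : form E u *+ 4 = \sum_x crossing_form E u x.
  rewrite (form_transversal u (reps_transversal E)) -(sum_transversal (fc E u) (reps_transversal E)).
  by rewrite sumrMnl.
apply/eqP; rewrite -(eqr_pMn2r (n := 4)) // !e4 (reindex f) /=; last exact: onW_bij.
apply/eqP/eq_bigr => x _; rewrite /crossing_form /local_form !pullE.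
have [-> _ _ _] := fm (ccw D (ccw D x)); have [-> _ _ _] := fm (ccw D x).
by have [-> _ -> _] := fm x.
Qed.

End Homeo.

Lemma isomorphism_inv T T' (D : diagram T) (D' : diagram T') f : isomorphism D D' f ->
  exists2 f', isomorphism D' D f' & cancel f f'.
Proof.
move=> [[f' fK f'K] fm]; exists f' => //; split; first by exists f.
move=> y; have [h1 h2 h3 h4] := fm (f' y); split.
- by apply: (can_inj fK); rewrite f'K h1 f'K.
- by apply: (can_inj fK); rewrite f'K h2 f'K.
- by rewrite -h3 f'K.
by rewrite -h4 f'K.
Qed.

Lemma form_index_iso g (D D' : motif) (f : dart D -> dart D') n :
  on_surface g D -> on_surface g D' -> isomorphism D D' f -> form_index D' n -> form_index D n.
Proof.
move=> sD sD' [fb fm]; apply: (@form_index_hom g _ _ (pull f)) => //.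
- exact/esym/(bij_eq_card fb).
- exact/esym/(iso_writhe fb fm).
move=> v /facesP vF; split; last exact: (iso_form fb fm).
by apply/facesP => x; rewrite !pullE (iso_face fm).
Qed.

Lemma form_index_equiv g (D D' : motif) n : motif_equiv g D D' ->
  form_index D n <-> form_index D' n.
Proof.
elim=> {D D'} [D D' [sD sD' mv]|D|D D' _ IH|D D' D'' _ IH _ IH'] //; last 2 first.
- exact: iff_sym IH.
- exact: iff_trans IH IH'.
case: mv sD sD' => {D D'} [D D' f iso|D D' [d hd [f [fI fim fm fex fma]]]|D D' [d [hd ncr ho [f [fI fim fm fex fma]]]]|T D D' r3] sD sD'.
- have [f' iso' _] := isomorphism_inv iso.
  by split; [exact: (form_index_iso sD' sD iso') | exact: (form_index_iso sD sD' iso)].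
- by apply: (form_index_R1 sD sD' hd (f := f)).
- exact: (form_index_R2 sD sD' erefl hd ncr ho (f := f)).
exact: form_index_R3 sD sD' r3.
Qed.

(** Frames are matched, not mapped: a move first changes trivializations, and its inverse chooses
    values at the new corners. *)
Definition transports (G : groupType) (D D' : motif) : Prop :=
  forall g : dart D -> G, frame D g -> exists2 g' : dart D' -> G, frame D' g' &
    forall a : rat, a != 0 -> jones a g = jones a g'.

Section Transport.

Context (G : groupType).

Lemma transports_iso (D D' : motif) (f : dart D -> dart D') :
  isomorphism D D' f -> transports G D' D.
Proof.
move=> [fb fm] g fr; have fI := bij_inj fb.
have cm x : ccw D' (f x) = f (ccw D x) by have [-> _ _ _] := fm x.
have fr' : frame D (g \o f).
  move=> x; rewrite /side /=; have := fr (f x); rewrite /side /= !cm.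
  by have [_ <- _ _] := fm x; rewrite !cm.
exists (g \o f) => // a a0; rewrite /jones (iso_writhe fb fm); congr (_ * _).
have crE s : map (crossing_at D') (map f s) = map (map_crossing f) (map (crossing_at D) s).
  rewrite -!map_comp; apply: eq_map => x /=; rewrite /crossing_at /map_crossing /= !cm.
  by have [_ _ -> _] := fm x.
have ts : transversal D' (map f (reps D)).
  rewrite /transversal crE cpts_map; apply: (perm_trans (perm_map f (reps_transversal D))).
  apply: uniq_perm => [||x]; [by rewrite (map_inj_uniq fI) enum_uniq | exact: enum_uniq |].
  rewrite mem_enum inE; have [f' fK f'K] := fb.
  by apply/mapP; exists (f' x); rewrite ?f'K ?mem_enum.
rewrite -(bracket_transversal a fr ts) crE.
apply: (@bracket_map _ a _ _ f (pairing_of D (g \o f)) (pairing_of D' g) _ [::]) => // x.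
  by have [_ -> _ _] := fm x.
by rewrite /= (iso_face fm).
Qed.

Lemma transports_R3 (T : finType) (D D' : diagram T) (a b c : T) s :
  R3_data D D' a b c s -> transports G (Motif D) (Motif D').
Proof.
move=> H g fr; have [g2 [fr2 ab ac J2]] := R3_good_frame H fr.
exists (R3_frame D a b c g2); first exact: (R3_frameP H fr2 ab ac).
by move=> x x0; rewrite -J2; exact: (jones_R3_good H fr2 ab ac x0).
Qed.

Lemma transports_equiv k (D D' : motif) : motif_equiv k D D' ->
  transports G D D' /\ transports G D' D.
Proof.
elim=> {D D'} [D D' [sD sD' mv]|D|D D' _ [IH1 IH2]|D D' D'' _ [IH1 IH2] _ [IH3 IH4]] //; last 2 first.
- by split=> g fr; exists g.
- split=> g fr.
    have [g1 fr1 e1] := IH1 g fr; have [g2 fr2 e2] := IH3 g1 fr1.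
    by exists g2 => // a a0; rewrite e1 ?e2.
  have [g1 fr1 e1] := IH4 g fr; have [g2 fr2 e2] := IH2 g1 fr1.
  by exists g2 => // a a0; rewrite e1 ?e2.
case: mv sD sD' => {D D'} [D D' f iso|D D' [d hd [f [fI fim fm fex fma]]]|D D' [d [hd ncr ho [f [fI fim fm fex fma]]]]|T D D' /R3_exists[a [b [c [s H]]]]] sD sD'.
- have [f' iso' _] := isomorphism_inv iso.
  by split; [exact: (transports_iso iso') | exact: (transports_iso iso)].
- have del : deletion (same_crossing D d) f by [].
  split=> g fr.
    have [fr' _] := jones_R1 hd del (oner_neq0 _) fr.
    by exists (g \o f) => // a a0; have [] := jones_R1 hd del a0 fr.
  have [g1 [fr1 e1]] := frame_R1 hd del fr; exists g1 => // a a0.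
  by have [_ ->] := jones_R1 hd del a0 fr1; rewrite e1.
- set d' := face D d in hd ncr fim fex fma.
  have del : deletion (fun e => same_crossing D d e \/ same_crossing D d' e) f by [].
  split=> g fr.
    (* The distinctness required by [good_frame] comes from the dimension count made for the
       quadratic form. *)
    have opp := R2_opposite_faces sD sD' erefl hd ncr ho del.
    have [g2 [fr2 gi go J2]] := good_frame erefl ncr fr opp.
    have [fr' _] := jones_R2 erefl hd ncr ho del fr2 gi go (oner_neq0 _).
    exists (g2 \o f) => // a a0; rewrite -J2.
    by have [] := jones_R2 erefl hd ncr ho del fr2 gi go a0.
  have [g1 [fr1 gi go e1]] := frame_R2 erefl hd ncr del fr; exists g1 => // a a0.
  by have [_ ->] := jones_R2 erefl hd ncr ho del fr1 gi go a0; rewrite e1.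
by split; [exact: (transports_R3 H) | exact: (transports_R3 (R3_sym H))].
Qed.

End Transport.

(** * Growth of the bracket *)

Section States.

Context (E : eqType) (G : groupType).
Implicit Types (p : pairing E G) (J K : seq (E * E)) (c : crossing E) (cs : seq (crossing E)).

Lemma loop_count_cat p J K :
  loop_count p (J ++ K) = (loop_count p J + loop_count (pjoins p J) K)%N.
Proof. by elim: J p => //= j J IH p; rewrite IH addnA. Qed.

Lemma wfp_pjoins p J s : wfp p -> okl p (pts J ++ s) -> wfp (pjoins p J).
Proof. by elim: J p => //= -[x y] J IH p wf ok; apply: IH; [exact: wfp_joinl ok | exact: okl_join]. Qed.

Lemma okl_pjoins p J s : wfp p -> okl p (pts J ++ s) -> okl (pjoins p J) s.
Proof. by elim: J p => //= -[x y] J IH p wf ok; apply: IH; [exact: wfp_joinl ok | exact: okl_join]. Qed.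

(** Only the case of two counted loops on the left matters. Both arcs are then trivial, and the
    other smoothing fuses them into one trivial loop. *)
Lemma loop_count_four p x y z t : wfp p -> okl p [:: x; y; z; t] ->
  (loop_count p [:: (x, y); (z, t)] <= (loop_count p [:: (y, z); (t, x)]).+1)%N.
Proof.
move=> [pK lV] /andP[]; rewrite /= !inE !negb_or -!andbA.
move=> /and5P[xy xz xt yz /and3P[yt zt _]] _.
case: (boolP (loop p x y)) => [/andP[/eqP pxy /eqP lx]|_]; last first.
  by rewrite add0n addn0; apply: leq_trans (leq_b1 _) _.
case: (boolP (loop (pjoin p x y) z t)) => // /andP[].
have pyx : opp p y = x by rewrite -pxy pK.
have ly : lbl p y = 1%g by rewrite -pxy lV lx invg1.
rewrite /= pxy pyx ![z == _]eq_sym (negPf xz) (negPf yz) /= => /eqP pzt /eqP lz.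
suff -> : loop (pjoin p y z) t x by case: (loop p y z).
rewrite /loop /= ![t == _]eq_sym (negPf yt) (negPf zt) /= pyx (negPf xt) pzt eqxx eqxx /=.
by rewrite -pzt lV lz invg1 ly mulg1 eqxx.
Qed.

Lemma perm_smoothing b c : perm_eq (pts (smoothing b c)) [:: c0 c; c1 c; c2 c; c3 c].
Proof. by case: b => //=; rewrite (perm_catCA [:: c1 c; c2 c; c3 c] [:: c0 c] [::]). Qed.

Lemma loop_count_switch p b c J K : wfp p -> okl p (pts (J ++ smoothing b c ++ K)) ->
  (loop_count p (J ++ smoothing b c ++ K) <= (loop_count p (J ++ smoothing (~~ b) c ++ K)).+1)%N.
Proof.
move=> wf ok.
have e b' : perm_eq (pts (J ++ smoothing b' c ++ K)) (pts (J ++ K) ++ [:: c0 c; c1 c; c2 c; c3 c]).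
  rewrite !pts_cat -!catA perm_cat2l perm_catC perm_cat2l; exact: perm_smoothing.
have ok2 : okl p (pts (J ++ K) ++ [:: c0 c; c1 c; c2 c; c3 c]) by rewrite -(perm_okl _ (e b)).
have m b' : loop_count p (J ++ smoothing b' c ++ K) =
    (loop_count p (J ++ K) + loop_count (pjoins p (J ++ K)) (smoothing b' c))%N.
  rewrite -loop_count_cat; apply: perm_loop_count => //; first by rewrite (perm_okl _ (e b')).
  by rewrite -catA perm_cat2l perm_catC.
rewrite !m -addnS leq_add2l.
have wfq := wfp_pjoins wf ok2; have okq := okl_pjoins wf ok2.
case: b {ok e m} => /=; first exact: loop_count_four.
set q := pjoins p (J ++ K) in wfq okq *.
have ok3 : okl q [:: c1 c; c2 c; c3 c; c0 c].
  by rewrite -(perm_okl _ (s := [:: c0 c; c1 c; c2 c; c3 c])) // (perm_catC [:: c0 c]).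
apply: leq_trans (loop_count_four wfq ok3) _.
by rewrite ltnS leq_eqVlt; apply/orP; left; apply/eqP/loop_count_swap => //;
  rewrite -(perm_okl _ (s := [:: c0 c; c1 c; c2 c; c3 c])) // (perm_catC [:: c0 c; c1 c] [:: c2 c; c3 c]).
Qed.

Definition state_A cs : seq (E * E) := flatten [seq smoothing (sgn c) c | c <- cs].

Lemma state_A_cons c cs : state_A (c :: cs) = smoothing (sgn c) c ++ state_A cs.
Proof. by []. Qed.

Lemma perm_state_A cs : perm_eq (pts (state_A cs)) (cpts cs).
Proof.
elim: cs => // c cs IH; rewrite state_A_cons pts_cat cpts_cons.
by rewrite -[[:: c0 c, c1 c, c2 c, c3 c & cpts cs]]/([:: c0 c; c1 c; c2 c; c3 c] ++ cpts cs);
  apply: perm_cat; first exact: perm_smoothing.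
Qed.

Lemma okl_state p cs J : okb p cs J -> okl p (pts (J ++ state_A cs)).
Proof.
by rewrite /okb; rewrite -(perm_okl _ (s := pts (J ++ state_A cs))) // pts_cat perm_cat2l perm_state_A.
Qed.

Lemma bracket_cons a p c cs J : bracket a p (c :: cs) J =
  weight a (sgn c) * bracket a p cs (J ++ smoothing true c) +
  weight a (~~ sgn c) * bracket a p cs (J ++ smoothing false c).
Proof. by []. Qed.

Lemma bracket_cons_A a p c cs J : bracket a p (c :: cs) J =
  a * bracket a p cs (J ++ smoothing (sgn c) c) +
  a^-1 * bracket a p cs (J ++ smoothing (~~ sgn c) c).
Proof. by rewrite bracket_cons; case: (sgn c) => //=; rewrite addrC. Qed.

(** Leaving the state A at a crossing divides the weight by a^2 and gains at most one loop, worth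
    a^2 up to a constant; no state exceeds the order of the state A. *)
Lemma bracket_upper p cs J : wfp p -> okb p cs J ->
  exists2 C : rat, 0 <= C & forall a : rat, 1 <= a ->
    `|bracket a p cs J| <= C * a ^+ (size cs + (loop_count p (J ++ state_A cs)).*2).
Proof.
move=> wf; elim: cs J => [|c cs IH] J ok.
  rewrite cats0; exists (2 ^+ loop_count p J) => [|a a1]; first exact: exprn_ge0.
  have a0 : 0 < a by lra.
  rewrite /bracket normrX -mul2n exprM -exprMn lerXn2r ?nnegrE ?normr_ge0 //.
    by rewrite mulr_ge0 // exprn_ge0 // ltW.
  rewrite /delta normrN ger0_norm; last by rewrite addr_ge0 ?exprn_ge0 ?invr_ge0 ?exprn_ge0 ?ltW.
  have : a ^- 2 <= a ^+ 2.
    apply: (@le_trans _ _ 1); last exact: exprn_ege1.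
    by rewrite invf_le1 ?exprn_gt0 // exprn_ege1.
  lra.
have [C1 C10 B1] := IH _ (okb_smoothing (sgn c) ok).
have [C2 C20 B2] := IH _ (okb_smoothing (~~ sgn c) ok).
exists (C1 + C2) => [|a a1]; first exact: addr_ge0.
have a0 : 0 < a by lra.
rewrite bracket_cons_A (le_trans (ler_normD _ _)) // mulrDl !normrM normfV (gtr0_norm a0).
rewrite state_A_cons /= addSn exprS; apply: lerD.
  rewrite mulrCA ler_pM2l //; move: (B1 a a1); by rewrite -catA.
rewrite ler_pdivrMl //; apply: le_trans (B2 a a1) _.
rewrite !mulrA ![_ * C2]mulrC -!mulrA ler_wpM2l // -!exprS ler_weXn2l //.
rewrite -!addnS leq_add2l -!doubleS leq_double.
have := loop_count_switch (b := ~~ sgn c) (J := J) (K := state_A cs) wf.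
rewrite negbK -catA; apply.
by rewrite catA; apply: okl_state; exact: okb_smoothing.
Qed.

Definition adequate p cs J : Prop := forall cs1 c cs2, cs = cs1 ++ c :: cs2 ->
  (loop_count p (J ++ state_A cs1 ++ smoothing (~~ sgn c) c ++ state_A cs2)
   < loop_count p (J ++ state_A cs))%N.

(** By adequacy, the first crossing that leaves the state A costs a^2 in weight and a^2 for a lost
    loop. The remaining crossings win nothing back, by [bracket_upper]; hence the factor a^4. *)
Lemma bracket_dominant p cs J : wfp p -> okb p cs J -> adequate p cs J ->
  exists2 C : rat, 0 <= C & forall a : rat, 1 <= a ->
    `|bracket a p cs J - a ^+ size cs * delta a ^+ loop_count p (J ++ state_A cs)| * a ^+ 4
    <= C * a ^+ (size cs + (loop_count p (J ++ state_A cs)).*2).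
Proof.
move=> wf; elim: cs J => [|c cs IH] J ok ad.
  by exists 0 => // a a1; rewrite cats0 /bracket mul1r subrr normr0 !mul0r.
have adr : adequate p cs (J ++ smoothing (sgn c) c).
  by move=> cs1 c' cs2 e; have := ad (c :: cs1) c' cs2; rewrite e /= !state_A_cons -!catA; apply.
have [C1 C10 B1] := IH _ (okb_smoothing (sgn c) ok) adr.
have [C2 C20 B2] := bracket_upper wf (okb_smoothing (~~ sgn c) ok).
have := ad [::] c cs erefl; rewrite cat0s; set N := loop_count p (J ++ state_A (c :: cs)) => adc.
exists (C1 + C2) => [|a a1]; first exact: addr_ge0.
have a0 : 0 < a by lra.
rewrite bracket_cons_A -catA in B1 *.
have -> : a * bracket a p cs (J ++ smoothing (sgn c) c) + a^-1 * bracket a p cs (J ++ smoothing (~~ sgn c) c)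
    - a ^+ size (c :: cs) * delta a ^+ N =
  a * (bracket a p cs (J ++ smoothing (sgn c) c) - a ^+ size cs * delta a ^+ N)
  + a^-1 * bracket a p cs (J ++ smoothing (~~ sgn c) c) by rewrite /= exprS; ring.
have h : `|a * (bracket a p cs (J ++ smoothing (sgn c) c) - a ^+ size cs * delta a ^+ N)
  + a^-1 * bracket a p cs (J ++ smoothing (~~ sgn c) c)| <=
  a * `|bracket a p cs (J ++ smoothing (sgn c) c) - a ^+ size cs * delta a ^+ N|
  + a^-1 * `|bracket a p cs (J ++ smoothing (~~ sgn c) c)|.
  by rewrite (le_trans (ler_normD _ _)) // !normrM normfV (gtr0_norm a0).
apply: (le_trans (ler_wpM2r (exprn_ge0 4 (ltW a0)) h)).
rewrite mulrDl mulrDl /= addSn [a ^+ (_ + N.*2).+1]exprS; apply: lerD.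
  by rewrite -mulrA [C1 * _]mulrCA ler_pM2l //; exact: B1.
have {}B2 := B2 a a1; rewrite -catA in B2.
rewrite -mulrA mulrCA.
have -> : a^-1 * a ^+ 4 = a ^+ 3 by rewrite (exprS a 3) mulKf // gt_eqF.
apply: (le_trans (ler_wpM2r (exprn_ge0 3 (ltW a0)) B2)).
rewrite -mulrA ler_wpM2l // -exprD -exprS ler_weXn2l //.
by move: adc; rewrite -(leq_double) doubleS; lia.
Qed.

Definition flip c : crossing E := Crossing (~~ sgn c) (c0 c) (c1 c) (c2 c) (c3 c).

Lemma bracket_flip_sign a p cs J : bracket a p (map flip cs) J = bracket a^-1 p cs J.
Proof.
elim: cs J => [|c cs IH] J; first by rewrite /bracket /delta exprVn invrK addrC.
rewrite map_cons !bracket_cons !IH /= negbK.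
by case: (sgn c); rewrite /= invrK.
Qed.

End States.

(** * States of an alternating motif *)

Section LoopFunctions.

Context (E : finType) (G : groupType).
Implicit Types (p : pairing E G) (J : seq (E * E)) (v u : fspace E).

Definition loop_function p J v : Prop :=
  [/\ forall z, v (opp p z) = v z, forall j, j \in J -> v j.1 = v j.2 &
      forall z, ~~ live p z -> v z = 0].

Lemma join_loop_function p a b J v : wfp p -> okl p (pts ((a, b) :: J)) ->
  loop_function p ((a, b) :: J) v -> loop_function (pjoin p a b) J (v - (v a : rat) *: indic [:: a; b]).
Proof.
move=> wf ok [vo vJ vd]; have [pK _] := wf.
have /andP[/= /andP[]] := ok; rewrite inE negb_or => /andP[ab aJ] /andP[bJ _] /and3P[la lb _].
have uE z : (v - (v a : rat) *: indic [:: a; b]) z =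
    (if (z == a) || (z == b) then 0 else v z) :> rat.
  rewrite fspaceD fspaceN fspaceZ indicE !inE.
  have vab : v a = v b := vJ _ (mem_head _ _).
  case: ifP => [/orP[] /eqP ->|_]; rewrite ?mulr1 ?mulr0 ?subr0 ?vab ?subrr //.
have uE' z : (v - (v a : rat) *: indic [:: a; b]) z =
    (if (z == a) || (z == b) then 0 else v z) by exact: uE.
have vab : v a = v b := vJ _ (mem_head _ _).
split=> [z|j jJ|z].
- case: (boolP ((z == a) || (z == b))) => [h|zn]; first by rewrite /= h.
  rewrite !uE' /= (negPf zn); move: zn; rewrite negb_or => /andP[za zb].
  case: (z =P opp p a) => [zpa|zpa].
    rewrite zpa (vo a) (vo b) vab; case: ifP => // /orP[] /eqP e.
      by move: lb; case/negP; move: zb; rewrite zpa -e pK e eqxx.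
    by move: lb; rewrite /live e eqxx.
  case: (z =P opp p b) => [zpb|zpb].
    rewrite zpb (vo a) (vo b) vab; case: ifP => // /orP[] /eqP e.
      by move: la; rewrite /live e eqxx.
    by move: za; rewrite zpb -e pK eqxx.
  case: ifP => // /orP[] /eqP e; first by case: zpa; rewrite -e pK.
  by case: zpb; rewrite -e pK.
- have jK : j \in (a, b) :: J by rewrite in_cons jJ orbT.
  have /andP[j1 j2] : (j.1 \in pts J) && (j.2 \in pts J) by apply: mem_pts; case: (j) jJ.
  have nin y : y \in pts J -> (y == a) || (y == b) = false.
    by move=> yJ; apply/negP => /orP[] /eqP e; [move: aJ | move: bJ]; rewrite -e yJ.
  by rewrite !uE' !nin // vJ.
rewrite uE' live_join //; case: ifP => // /negbT; rewrite negb_or => /andP[-> ->].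
by rewrite !andbT; exact: vd.
Qed.

Lemma loop_function_join p a b J u : wfp p -> okl p (pts ((a, b) :: J)) ->
  loop_function (pjoin p a b) J u -> forall c : rat, (opp p a != b -> u (opp p a) = c) ->
  loop_function p ((a, b) :: J) (u + c *: indic [:: a; b]).
Proof.
move=> wf ok [uo uJ ud] c uc; have [pK _] := wf.
have /andP[/= /andP[]] := ok; rewrite inE negb_or => /andP[ab aJ] /andP[bJ _] /and3P[la lb _].
have u0 z : (z == a) || (z == b) -> u z = 0.
  by move=> h; apply: ud; rewrite live_join // -negb_or h andbF.
have uE z : (u + c *: indic [:: a; b]) z = (if (z == a) || (z == b) then c else u z).
  have: (u + c *: indic [:: a; b]) z = (if (z == a) || (z == b) then c else u z) :> rat.
    rewrite fspaceD fspaceZ indicE !inE; case: ifP => [/u0 ->|_]; rewrite ?mulr1 ?mulr0 ?addr0 ?add0r //.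
  by [].
have ub : opp p a != b -> u (opp p b) = c.
  move=> n; rewrite -(uc n); have := uo (opp p a); rewrite /= (negPf n) (negPf la) eqxx /= => <-.
  by [].
split=> [z|j|z].
- rewrite !uE; case: ifP => [h|/negbT].
    case: (ifP ((z == a) || (z == b))) => // hz.
    move: h => /orP[] /eqP e.
      have zE : z = opp p a by rewrite -e pK.
      rewrite zE uc //; apply: contraFneq hz => <-; by rewrite zE eqxx orbT.
    have zE : z = opp p b by rewrite -e pK.
    rewrite zE ub //; apply: contraFneq hz => h; by rewrite zE -h pK eqxx.
  rewrite negb_or => /andP[pa pb].
  case: ifP => [/orP[] /eqP zE|/negbT].
  - by rewrite zE uc // -zE.
  - by rewrite zE ub //; apply: contraNneq pa => e; rewrite zE -e pK eqxx.
  rewrite negb_or => /andP[za zb]; rewrite -[RHS]uo /= (negPf za) (negPf zb) /=.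
  case: (z =P opp p a) => [e|_]; first by move: pa; rewrite e pK eqxx.
  by case: (z =P opp p b) => [e|//]; move: pb; rewrite e pK eqxx.
- rewrite in_cons => /orP[/eqP -> /=|jJ]; first by rewrite !uE !eqxx orbT.
  have /andP[j1 j2] : (j.1 \in pts J) && (j.2 \in pts J) by apply: mem_pts; case: (j) jJ.
  have nin y : y \in pts J -> (y == a) || (y == b) = false.
    by move=> yJ; apply/negP => /orP[] /eqP e; [move: aJ | move: bJ]; rewrite -e yJ.
  by rewrite !uE !nin // uJ.
move=> dz; rewrite uE; case: ifP => [/orP[] /eqP e|_]; try by move: dz; rewrite e ?la ?lb.
by apply: ud; rewrite live_join // (negPf dz).
Qed.

(** Loops are counted by the functions constant along them, to be compared with functions of
    regions. A gluing that closes a loop adds the indicator of its two ends; any other one only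
    extends the functions to these ends. *)
Lemma loop_count_dim p J : wfp p -> okl p (pts J) -> (forall z, lbl p z = 1%g) ->
  (forall z, live p z -> z \in pts J) ->
  exists2 W : {vspace fspace E}, forall v, v \in W <-> loop_function p J v & \dim W = loop_count p J.
Proof.
elim: J p => [|[a b] J IH] p wf ok l1 cov.
  exists 0%VS; last by rewrite dimv0.
  move=> v; rewrite memv0; split=> [/eqP ->|[_ _ v0]].
    by split=> *; rewrite !ffunE.
  by apply/eqP/ffunP => z; rewrite ffunE v0 //; apply/negP => /cov.
have wf' := wfp_joinl wf ok.
have [pK _] := wf.
have /andP[/= /andP[]] := ok; rewrite inE negb_or => /andP[ab aJ] /andP[bJ _] /and3P[la lb _].
have l1' z : lbl (pjoin p a b) z = 1%g by rewrite /= !l1 mulg1; do !case: ifP.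
have cov' z : live (pjoin p a b) z -> z \in pts J.
  by rewrite live_join // => /and3P[/cov + za zb]; rewrite pts_cons !in_cons (negPf za) (negPf zb).
have [W WP dW] := IH _ wf' (okl_join wf ok) l1' cov'.
have dead u z : u \in W -> (z == a) || (z == b) -> u z = 0.
  by move=> /WP[_ _ ud] h; apply: ud; rewrite live_join // -negb_or h andbF.
have ea : indic [:: a; b] a = 1 by rewrite ffunE inE eqxx.
have ea1 : indic [:: a; b] a = 1 :> rat by [].
rewrite /= /loop l1 eqxx andbT; case: (boolP (opp p a == b)) => [/eqP pab|pab].
  exists (W + <[indic [:: a; b]]>)%VS.
    move=> v; split=> [/memv_addP[u uW [_ /vlineP[c ->] ->]]|hv].
      by apply: loop_function_join => //; [exact/WP | rewrite pab eqxx].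
    apply/memv_addP; exists (v - (v a : rat) *: indic [:: a; b]).
      exact/WP/join_loop_function.
    by exists ((v a : rat) *: indic [:: a; b]); rewrite ?memvZ ?memv_line ?subrK.
  rewrite dimv_disjoint_sum; last first.
    apply/eqP; rewrite -subv0; apply/subvP => u; rewrite memv_cap => /andP[uW /vlineP[c uc]].
    have : u a = 0 by apply: dead => //; rewrite eqxx.
    have -> : u a = c :> rat by rewrite uc fspaceZ ea1 mulr1.
    by move=> c0; rewrite uc c0 scale0r mem0v.
  have -> : \dim <[indic [:: a; b] : fspace E]> = 1%N.
    rewrite dim_vline; case: eqP => // /ffunP/(_ a); rewrite ea ffunE => /eqP.
    by rewrite (negPf (oner_neq0 _)).
  by rewrite dW addnC.
have hE u : linfun (slide (- ev (opp p a)) (indic [:: a; b])) u =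
    u + (u (opp p a) : rat) *: indic [:: a; b].
  by rewrite lfunE /= /slide opp_lfunE evE scaleNr opprK.
exists (linfun (slide (- ev (opp p a)) (indic [:: a; b])) @: W)%VS.
  move=> v; split=> [/memv_imgP[u uW ->]|hv].
    by rewrite hE; apply: loop_function_join => //; exact/WP.
  apply/memv_imgP; exists (v - (v a : rat) *: indic [:: a; b]); first exact/WP/join_loop_function.
  have [vo _ _] := hv.
  rewrite hE.
  have -> : (v - (v a : rat) *: indic [:: a; b]) (opp p a) = v a :> rat.
    rewrite fspaceD fspaceN fspaceZ indicE vo !inE (negPf la) (negPf pab) mulr0 subr0.
    by [].
  by rewrite subrK.
rewrite limg_dim_eq // ; apply/eqP; rewrite -subv0; apply/subvP => u.
rewrite memv_cap memv_ker memv0 => /andP[uW]; rewrite hE => /eqP h.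
apply/eqP/ffunP => z; rewrite [RHS]ffunE.
case: (boolP ((z == a) || (z == b))) => [/(dead _ _ uW) //|zn].
have := congr1 (fun w : fspace E => (w z : rat)) h.
by rewrite /= fspaceD fspaceZ indicE !inE (negPf zn) mulr0 addr0 fspace0.
Qed.

End LoopFunctions.

Local Close Scope ring_scope.

Section Mask.
Context (T : finType) (P : pred T).

Definition mask_fun (v : fspace T) : fspace T := [ffun x => if P x then v x else 0%R].

Lemma mask_is_linear : linear mask_fun.
Proof.
move=> c u v; apply/ffunP => x; rewrite !ffunE; case: ifP => // _.
by rewrite GRing.scaler0 GRing.addr0.
Qed.

HB.instance Definition _ :=
  GRing.isLinear.Build rat (fspace T) (fspace T) _ mask_fun mask_is_linear.

Definition restrict_to : 'Hom(fspace T, fspace T) := linfun mask_fun.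

Lemma restrict_toE v x : restrict_to v x = if P x then v x else 0%R.
Proof. by rewrite lfunE /= ffunE. Qed.
End Mask.

Section Alternating.

Context (G : groupType) (D : motif) (alt : alternating D) (o : bool).

Local Notation ccw := (ccw D).
Local Notation mate := (mate D).

(** For [o = false] this is the mirror image, so that the behaviour near 0 also becomes growth for
    large [a]. *)
Definition crossings : seq (crossing (dart D)) :=
  [seq Crossing o d (ccw d) (ccw (ccw d)) (ccw (ccw (ccw d))) | d <- reps D].

(** In an alternating diagram an edge borders one region of each kind; this is the corner of the one
    of kind [o], at the crossing of [z]. *)
Definition corner z := if is_over D z == o then z else ccw (ccw (ccw z)).

(* Functions of the regions whose corners are at over-darts (o = true) or under-darts;
   in an alternating diagram every region is of one of these kinds. *)
Definition faces_of : {vspace fspace (dart D)} :=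
  (faces D :&: lker (restrict_to (fun x => is_over D x != o)))%VS.

Lemma over_mate d : is_over D (mate d) = ~~ is_over D d.
Proof. by have := alt d; rewrite /straight over_ccw2. Qed.

Lemma over_face d : is_over D (face D d) = is_over D d.
Proof. by rewrite /face /= !over_ccw over_mate !negbK. Qed.

Lemma mem_faces_of v : v \in faces_of <-> v \in faces D /\ forall x, is_over D x != o -> v x = 0%R.
Proof.
rewrite mem_capker; split=> [/andP[vD /eqP h]|[-> h]].
  split=> // x xo; have := restrict_toE (fun x => is_over D x != o) v x; rewrite h ffunE xo.
  by [].
apply/eqP/ffunP => x; rewrite restrict_toE ffunE; case: ifP => //; exact: h.
Qed.

Lemma perm_state : perm_eq (pts (state_A crossings)) (enum (dart D)).
Proof.
apply: (perm_trans (perm_state_A _)); apply: perm_trans (reps_transversal D).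
by rewrite /crossings /cpts -!map_comp; apply: perm_refl.
Qed.

Lemma state_corner j : j \in state_A crossings -> j.2 = ccw j.1 /\ is_over D j.1 = o.
Proof.
rewrite /state_A /crossings -map_comp => /flattenP[s /mapP[d]].
rewrite mem_filter /is_rep => /andP[/andP[od _] _] -> /=.
by rewrite /smoothing; case: (o); rewrite !inE => /orP[] /eqP -> /=; rewrite ?ccwK ?(over_ccw, od).
Qed.

Lemma corner_state x : is_over D x = o -> (x, ccw x) \in state_A crossings.
Proof.
move=> xo; have : x \in pts (state_A crossings) by rewrite (perm_mem perm_state) mem_enum.
rewrite /pts => /flattenP[s /mapP[j jJ ->]]; have [e jo] := state_corner jJ.
rewrite !inE => /orP[] /eqP xE; first by rewrite xE -e; case: (j) jJ.
by move: xo; rewrite xE e over_ccw jo; case: (o).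
Qed.

Lemma corner_mate z : corner (mate z) = if is_over D z == o then face D z else mate z.
Proof. by rewrite /corner over_mate; case: (is_over D z) (o) => [] []. Qed.

Lemma corner_ccw x : is_over D x = o -> corner x = x /\ corner (ccw x) = x.
Proof. by move=> xo; rewrite /corner over_ccw xo eqxx ccwK; case: (o). Qed.

(** Transport along an edge can be read on either side of it. On the side of kind [o] it is the
    coboundary of a function of the corners. *)
Lemma corner_potential (g : dart D -> G) z : frame D g ->
  lbl (pairing_of D g) z = (g (corner z) * (g (corner (mate z)))^-1)%g.
Proof.
move=> fr; rewrite corner_mate /corner; case: ifP => // _.
have [_ lV] := wfp_pairing_of fr; rewrite -[z in LHS](mateK D) [LHS]lV /= face_mate.
by rewrite invgM invgK.
Qed.

Lemma okl_crossings (g : dart D -> G) : frame D g -> okl (pairing_of D g) (pts (state_A crossings)).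
Proof.
move=> fr; rewrite (perm_okl _ perm_state) /okl enum_uniq /=.
by apply/allP => z _; apply/eqP; exact: mate_neq.
Qed.

(** The loops of this state bound the regions of kind [o], over which the connection is trivialized:
    all of them are counted, whatever the frame. *)
Lemma dim_faces_of (g : dart D -> G) : frame D g ->
  \dim faces_of = loop_count (pairing_of D g) (state_A crossings).
Proof.
move=> fr; have wf := wfp_pairing_of fr; have ok := okl_crossings fr.
pose al z := (g (corner z))^-1%g.
have uJ j : j \in state_A crossings -> al j.1 = al j.2.
  rewrite /al; by move=> /state_corner[-> jo]; have [-> ->] := corner_ccw jo.
have <- : loop_count (gauge al (pairing_of D g)) (state_A crossings) = _ := loop_count_gauge wf uJ ok.
set p := gauge _ _.
have pm z : opp p z = mate z by [].
have pl z : lbl p z = 1%g.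
  rewrite -[LHS]/(al z * lbl (pairing_of D g) z * (al (mate z))^-1)%g corner_potential // /al invgK.
  by rewrite mulKg mulVg.
have pwf : wfp p by split=> z; rewrite ?pm ?mateK // !pl invg1.
have pok : okl p (pts (state_A crossings)) by exact: ok.
have cov z : live p z -> z \in pts (state_A crossings).
  by rewrite (perm_mem perm_state) mem_enum.
have [W WP <-] := loop_count_dim pwf pok pl cov.
pose h := restrict_to (fun x => is_over D x == o).
have -> : faces_of = (h @: W)%VS.
  apply: subv_anti; apply/andP; split; apply/subvP => v.
    move=> /mem_faces_of[/facesP vF v0]; apply/memv_imgP.
    exists [ffun x => v (corner x)]; last first.
      apply/ffunP => x; rewrite restrict_toE ffunE; case: ifP => [xo|/negbT/v0 //].
      by rewrite /corner xo.
    apply/WP; split=> [z|j jJ|z].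
    - rewrite pm !ffunE corner_mate /corner; case: ifP => _; first exact: vF.
      by rewrite -face_mate vF.
    - by rewrite !ffunE; have [-> jo] := state_corner jJ; have [-> ->] := corner_ccw jo.
    by case/negP; apply/eqP; exact: mate_neq.
  move=> /memv_imgP[u /WP[um uJ' _] ->]; apply/mem_faces_of; split=> [|x xo]; last first.
    by rewrite restrict_toE (negPf xo).
  apply/facesP => x; rewrite !restrict_toE over_face; case: ifP => // /eqP xo.
  rewrite -[u x]um pm -ccw_face.
  have := uJ' _ (@corner_state (face D x) _); rewrite /= over_face; exact.
rewrite limg_dim_eq //; apply/eqP; rewrite -subv0; apply/subvP => u.
rewrite memv_cap memv_ker memv0 => /andP[/WP[um _ _] /eqP hu].
have u0 x : is_over D x == o -> u x = 0%R.
  by move=> xo; have := restrict_toE (fun x => is_over D x == o) u x; rewrite -/h hu ffunE xo.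
apply/eqP/ffunP => x; rewrite ffunE; case: (boolP (is_over D x == o)) => [/u0 //|xo].
by rewrite -um pm u0 // over_mate; move: xo; case: (is_over D x) (o) => [] [].
Qed.

End Alternating.

Section Potentials.

Context (E : eqType) (G : groupType).
Implicit Types (p : pairing E G) (J : seq (E * E)).

Lemma pjoins_potential p J s (al : E -> G) : wfp p -> okl p (pts J ++ s) ->
  (forall j, j \in J -> al j.1 = al j.2) ->
  (forall z, live p z -> lbl p z = al z * (al (opp p z))^-1)%g ->
  forall z, live (pjoins p J) z ->
  lbl (pjoins p J) z = (al z * (al (opp (pjoins p J) z))^-1)%g.
Proof.
elim: J p => //= -[x y] J IH p wf ok alJ hl.
have ok2 : okl p [:: x; y] by exact: (@okl_catl _ _ _ [:: x; y] (pts J ++ s)).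
have alxy : al x = al y := alJ _ (mem_head _ _).
apply: IH; first exact: wfp_joinl ok; first exact: okl_join.
  by move=> j jJ; apply: alJ; rewrite in_cons jJ orbT.
by apply: join_potential.
Qed.

Lemma pjoins_invariant (Y : Type) (iota : Y -> Y) p J s (c : E -> Y) :
  involutive iota -> wfp p -> okl p (pts J ++ s) ->
  (forall j, j \in J -> c j.1 = iota (c j.2)) ->
  (forall z, live p z -> c (opp p z) = iota (c z)) ->
  forall z, live (pjoins p J) z -> c (opp (pjoins p J) z) = iota (c z).
Proof.
move=> iK; elim: J p => //= -[x y] J IH p wf ok cJ hc.
have ok2 : okl p [:: x; y] by exact: (@okl_catl _ _ _ [:: x; y] (pts J ++ s)).
have cxy : c x = iota (c y) := cJ _ (mem_head _ _).
apply: IH; first exact: wfp_joinl ok; first exact: okl_join.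
  by move=> j jJ; apply: cJ; rewrite in_cons jJ orbT.
by apply: join_invariant => //; rewrite cxy ?iK.
Qed.

End Potentials.

Section Adequacy.

Context (G : groupType) (D : motif) (alt : alternating D) (o : bool).
Context (g : dart D -> G) (fr : frame D g).
Hypothesis g_opposite : forall d, fconnect (face D) d (ccw D (ccw D d)) -> g d <> g (ccw D (ccw D d)).

Local Notation ccw := (ccw D).
Local Notation mate := (mate D).
Local Notation p := (pairing_of D g).

(* The arcs left at the crossing join y either to ccw y, and then switching merges two
   loops, or to the fourth dart, and then it cuts a loop into two loops of nontrivial label. *)
Lemma switch_decreases (q : pairing (dart D) G) y : wfp q -> is_over D y = o ->
  okl q [:: y; ccw y; ccw (ccw y); ccw (ccw (ccw y))] ->
  (forall z, live q z -> z \in [:: y; ccw y; ccw (ccw y); ccw (ccw (ccw y))]) ->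
  (forall z, live q z -> lbl q z = g (corner o z) * (g (corner o (opp q z)))^-1)%g ->
  (forall z, live q z -> is_over D (opp q z) = ~~ is_over D z) ->
  (forall z, live q z -> fconnect (face D) (corner o z) (corner o (opp q z))) ->
  loop_count q [:: (ccw y, ccw (ccw y)); (ccw (ccw (ccw y)), y)] <
  loop_count q [:: (y, ccw y); (ccw (ccw y), ccw (ccw (ccw y)))].
Proof.
move=> wf yo ok cov lab ov fc; have [qK lV] := wf.
have /andP[uq /and5P[l0 l1 l2 l3 _]] := ok.
have [c0 c1] := corner_ccw yo.
have yo2 : is_over D (ccw (ccw y)) = o by rewrite over_ccw2.
have [c2 c3] := corner_ccw yo2.
have nK i j : (i < 4)%N -> (j < 4)%N ->
   (nth y [:: y; ccw y; ccw (ccw y); ccw (ccw (ccw y))] i ==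
    nth y [:: y; ccw y; ccw (ccw y); ccw (ccw (ccw y))] j) = (i == j).
  by move=> i4 j4; apply: nth_uniq.
have n01 : (y == ccw y) = false := nK 0 1 isT isT.
have n02 : (y == ccw (ccw y)) = false := nK 0 2 isT isT.
have n03 : (y == ccw (ccw (ccw y))) = false := nK 0 3 isT isT.
have n12 : (ccw y == ccw (ccw y)) = false := nK 1 2 isT isT.
have n13 : (ccw y == ccw (ccw (ccw y))) = false := nK 1 3 isT isT.
have n23 : (ccw (ccw y) == ccw (ccw (ccw y))) = false := nK 2 3 isT isT.
have n10 := nK 1 0 isT isT; have n20 := nK 2 0 isT isT; have n30 := nK 3 0 isT isT.
have n21 := nK 2 1 isT isT; have n31 := nK 3 1 isT isT; have n32 := nK 3 2 isT isT.
rewrite /= in n10 n20 n30 n21 n31 n32.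
have lq z : live q z -> live q (opp q z) by rewrite /live qK eq_sym.
have ovr z : live q z -> is_over D z = o -> opp q z \in [:: ccw y; ccw (ccw (ccw y))].
  move=> lz zo; have := cov _ (lq _ lz); have := ov _ lz; rewrite zo !inE.
  move=> h /or4P[] /eqP e; rewrite e ?eqxx ?orbT //; move: h; rewrite e ?yo2 ?yo; by case: (o).
have := ovr _ l0 yo; rewrite !inE => /orP[] /eqP e0.
  have e1 : opp q (ccw y) = y by rewrite -e0 qK.
  have e2 : opp q (ccw (ccw y)) = ccw (ccw (ccw y)).
    have := ovr _ l2 yo2; rewrite !inE => /orP[] /eqP e //.
    by move/eqP: n20; case; rewrite -[LHS]qK e e1.
  have lb0 : lbl q y = 1%g by rewrite lab // e0 c0 c1 mulgV.
  have lb2 : lbl q (ccw (ccw y)) = 1%g by rewrite lab // e2 c2 c3 mulgV.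
  rewrite /= /loop /= e0 e1 e2 n02 ?(n01, n02, n03, n12, n13, n23, n10, n20, n30, n21, n31, n32) /=.
  rewrite !eqxx lb0 lb2 eqxx /= addn0.
  exact: leq_b1.
have e3 : opp q (ccw (ccw (ccw y))) = y by rewrite -e0 qK.
have e2 : opp q (ccw (ccw y)) = ccw y.
  have := ovr _ l2 yo2; rewrite !inE => /orP[] /eqP e //.
  by move/eqP: n20; case; rewrite -[LHS]qK e e3.
have e1 : opp q (ccw y) = ccw (ccw y) by rewrite -{1}e2 qK.
have ne : g y <> g (ccw (ccw y)).
  by apply: g_opposite; have := fc _ l0; rewrite e0 c0 c3.
have ne' (s t : G) : s <> t -> (s * t^-1)%g == 1%g = false.
  by move=> st; apply/eqP => h; apply: st; rewrite -[s](mulgVK t) h mul1g.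
have lb0 : lbl q y = (g y * (g (ccw (ccw y)))^-1)%g by rewrite lab // e0 c0 c3.
have lb1 : lbl q (ccw y) = (g y * (g (ccw (ccw y)))^-1)%g by rewrite lab // e1 c1 c2.
have lb2 : lbl q (ccw (ccw y)) = (g (ccw (ccw y)) * (g y)^-1)%g by rewrite lab // e2 c1 c2.
have lb3 : lbl q (ccw (ccw (ccw y))) = (g (ccw (ccw y)) * (g y)^-1)%g by rewrite lab // e3 c3 c0.
rewrite /= /loop /= e0 e1 e2 e3 ?(n01, n02, n03, n12, n13, n23, n10, n20, n30, n21, n31, n32) /=.
rewrite !eqxx lb0 lb1 lb2 lb3 mulgA mulgVK mulgV eqxx !ne' //.
by move=> h; exact/ne/esym.
Qed.

(** All crossings but one are glued first, leaving four live ends. Three facts survive the gluings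
    and determine the case: over and under alternate along arcs, both ends of an arc see the same
    region, and labels are coboundaries of corner values. *)
Lemma adequate_crossings : adequate p (crossings D o) [::].
Proof.
move=> cs1 c cs2 e; rewrite !cat0s.
have wf := wfp_pairing_of fr.
have Jp : state_A (crossings D o) = state_A cs1 ++ smoothing (sgn c) c ++ state_A cs2.
  by rewrite e /state_A map_cat flatten_cat.
have [d cE od] : exists2 d, c = Crossing o d (ccw d) (ccw (ccw d)) (ccw (ccw (ccw d))) &
    is_over D d.
  have lt : size cs1 < size (reps D).
    have := congr1 size e; rewrite size_map size_cat /= => ->; by rewrite addnS ltnS leq_addr.
  have [d0 _] : exists d0, d0 \in reps D.
    by case: (reps D) lt => // d0 r _; exists d0; rewrite mem_head.
  have cE : c = nth c (crossings D o) (size cs1) by rewrite e nth_cat ltnn subnn.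
  exists (nth d0 (reps D) (size cs1)); first by rewrite {1}cE (nth_map d0).
  have := mem_nth d0 lt; rewrite {1}/reps mem_filter /is_rep.
  by case/andP => /andP[].
set K := state_A cs1 ++ state_A cs2.
pose y := if o then d else ccw d.
have yo : is_over D y = o by rewrite /y; case: (o); rewrite ?over_ccw od.
pose Q := [:: y; ccw y; ccw (ccw y); ccw (ccw (ccw y))].
have pA : perm_eq (smoothing (sgn c) c) [:: (y, ccw y); (ccw (ccw y), ccw (ccw (ccw y)))].
  rewrite cE /smoothing /y; case: (o) => //=; by rewrite ccwK.
have pB : perm_eq (smoothing (~~ sgn c) c) [:: (ccw y, ccw (ccw y)); (ccw (ccw (ccw y)), y)].
  rewrite cE /smoothing /y; case: (o) => //=; rewrite ccwK (perm_catC [:: _] [:: _]) //.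
have permK b A : perm_eq (smoothing b c) A ->
    perm_eq (state_A cs1 ++ smoothing b c ++ state_A cs2) (K ++ A).
  by move=> h; rewrite /K -catA perm_cat2l perm_catC perm_cat2l.
have okA := okl_crossings o fr; rewrite Jp in okA.
have okK : okl p (pts K ++ Q).
  rewrite (perm_okl _ (perm_pts (permK _ _ pA))) pts_cat in okA.
  exact: okA.
have sB : perm_eq (pts (state_A cs1 ++ smoothing (~~ sgn c) c ++ state_A cs2))
    (pts (state_A cs1 ++ smoothing (sgn c) c ++ state_A cs2)).
  rewrite !pts_cat perm_cat2l perm_cat2r.
  by apply: (perm_trans (perm_smoothing _ _)); rewrite perm_sym; exact: perm_smoothing.
have okB : okl p (pts (state_A cs1 ++ smoothing (~~ sgn c) c ++ state_A cs2)).
  by rewrite (perm_okl _ sB).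
rewrite Jp (perm_loop_count wf okA (permK _ _ pA)) (perm_loop_count wf okB (permK _ _ pB)) !loop_count_cat ltn_add2l.
have KJ j : j \in K -> j \in state_A (crossings D o).
  by rewrite Jp !mem_cat => /orP[] ->; rewrite ?orbT.
have KP j : j \in K -> corner o j.1 = j.1 /\ corner o j.2 = j.1.
  by move=> /KJ/state_corner[-> jo]; have [-> ->] := corner_ccw jo.
have okK0 : okl p (pts K) := okl_catl okK.
apply: switch_decreases => //.
- exact: wfp_pjoins okK.
- exact: okl_pjoins okK.
- move=> z; rewrite live_pjoins // => /andP[_ zK].
  have : z \in pts (state_A (crossings D o)) by rewrite (perm_mem (perm_state D o)) mem_enum.
  by rewrite Jp (perm_mem (perm_pts (permK _ _ pA))) pts_cat mem_cat (negPf zK).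
- apply: (pjoins_potential wf okK) => [j /KP[-> ->] //|z _].
  by rewrite /= -(corner_potential alt) //.
- apply: (pjoins_invariant negbK wf okK) => [j /KJ/state_corner[-> jo]|z _]; first by rewrite over_ccw negbK.
  exact: over_mate.
move=> z lz; rewrite -root_connect; [apply/eqP/esym | exact/fconnect_sym/face_inj].
apply: (@pjoins_invariant _ _ _ id p K Q (fun z => froot (face D) (corner o z))) => //.
  by move=> j /KP[-> ->].
move=> x _; rewrite /= (corner_mate alt) /corner; apply/eqP.
rewrite root_connect; last exact/fconnect_sym/face_inj.
case: ifP => _; first by rewrite fconnect_sym; [exact: fconnect1 | exact: face_inj].
by rewrite -face_mate; exact: fconnect1.
Qed.

End Adequacy.

Local Open Scope ring_scope.

(** All that is kept of the universal cover: a curve through one region between opposite corners of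
    a crossing has nontrivial holonomy. *)
Definition universal_frame (G : groupType) (D : motif) (g : dart D -> G) : Prop :=
  frame D g /\
  forall d, fconnect (face D) d (ccw D (ccw D d)) -> g d <> g (ccw D (ccw D d)).

(* The degree of growth of the Jones invariant in a, resp. in a^-1. *)
Definition breadth (D : motif) (o : bool) : int :=
  (size (reps D) + (\dim (faces_of D o)).*2)%:Z + (if o then 1 else -1) * (3 * writhe D).

Lemma normrXz (x : rat) (n : int) : `|x ^ n| = `|x| ^ n.
Proof. by case: n => n; rewrite ?NegzE -?invr_expz ?normfV -!exprnP normrX. Qed.

Section Growth.

Context (G : groupType) (D : motif) (alt : alternating D) (o : bool).
Context (g : dart D -> G) (fr : frame D g).

Local Notation p := (pairing_of D g).
Local Notation s := (if o then 1 else -1 : int).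

Lemma norm_jones (a : rat) : 1 <= a ->
  `|jones (if o then a else a^-1) g| =
  a ^ (s * (3 * writhe D)) * `|bracket a p (crossings D o) [::]|.
Proof.
move=> a1; have a0 : 0 < a by lra.
rewrite /jones normrM; congr (_ * _).
  rewrite normrXz normrN normrX exprnP exprz_exp.
  by case: (o); rewrite ?mul1r ?mulN1r -?exprz_inv ger0_norm // ?invr_ge0 ltW.
congr (`| _ |); case: (o).
  congr bracket; rewrite /crossings; apply/eq_in_map => d.
  by rewrite mem_filter /crossing_at => /andP[/andP[-> _] _].
rewrite -(bracket_flip_sign a) /crossings -map_comp; congr bracket; apply/eq_in_map => d.
by rewrite mem_filter /crossing_at /= /flip /= => /andP[/andP[-> _] _].
Qed.

Lemma okb_crossings : okb p (crossings D o) [::].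
Proof.
rewrite /okb /=; have := okl_crossings o fr.
by rewrite (perm_okl _ (perm_state_A _)).
Qed.

Lemma size_crossings : size (crossings D o) = size (reps D).
Proof. exact: size_map. Qed.

Lemma breadthE (a : rat) : 1 <= a -> a ^ breadth D o =
  a ^+ (size (crossings D o) + (loop_count p ([::] ++ state_A (crossings D o))).*2)
  * a ^ (s * (3 * writhe D)).
Proof.
move=> a1; rewrite /breadth expfzDr; last by apply: lt0r_neq0; lra.
by rewrite size_crossings (dim_faces_of alt o fr) -exprnP.
Qed.

Lemma jones_upper : exists2 C : rat, 0 <= C & forall a, 1 <= a ->
  `|jones (if o then a else a^-1) g| <= C * a ^ breadth D o.
Proof.
have [C C0 B] := bracket_upper (wfp_pairing_of fr) okb_crossings.
exists C => // a a1; rewrite norm_jones // breadthE // [leRHS]mulrA [leLHS]mulrC.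
by apply: ler_wpM2r; [apply: exprz_ge0; lra | exact: B].
Qed.

Lemma jones_lower : universal_frame g -> exists2 A : rat, 1 <= A & forall a, A <= a ->
  a ^ breadth D o <= 2 * `|jones (if o then a else a^-1) g|.
Proof.
move=> [_ gU]; have ad := adequate_crossings alt (o := o) fr gU.
have [C C0 B] := bracket_dominant (wfp_pairing_of fr) okb_crossings ad.
(* Beyond this value the error in [bracket_dominant] is at most half of the main term, because a^4
   is at least [2 * C + 1]. *)
exists (2 * C + 1) => [|a Ca]; first lra.
have a1 : 1 <= a by lra.
have a0 : 0 < a by lra.
rewrite norm_jones // breadthE // [leRHS]mulrCA [leLHS]mulrC; apply: ler_wpM2l; first by apply: exprz_ge0; lra.
have := B a a1; set br := bracket _ _ _ _; set N := loop_count _ _; set n := size _ => le.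
have dl : a ^+ 2 <= `|delta a|.
  have a2 : 0 <= a ^- 2 by rewrite invr_ge0 exprn_ge0 // ltW.
  rewrite /delta normrN ger0_norm ?lerDl //.
  by rewrite addr_ge0 // exprn_ge0 // ltW.
have lo : a ^+ (n + N.*2) <= `|a ^+ n * delta a ^+ N|.
  rewrite exprD normrM !normrX (gtr0_norm a0) ler_wpM2l ?exprn_ge0 ?(ltW a0) //.
  rewrite -mul2n exprM; apply: lerXn2r => //; rewrite ?nnegrE ?exprn_ge0 ?normr_ge0 ?(ltW a0) //.
set X := a ^+ (n + N.*2) in le lo *.
have X0 : 0 <= X by rewrite exprn_ge0 ?ltW.
set Y := `|br - a ^+ n * delta a ^+ N| in le.
have tri : `|a ^+ n * delta a ^+ N| <= `|br| + Y.
  have := ler_normB br (br - a ^+ n * delta a ^+ N).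
  by rewrite opprB addrC subrK.
have Y0 : 0 <= Y by exact: normr_ge0.
have a4 : a <= a ^+ 4 by rewrite -[leLHS]expr1 ler_weXn2l.
have : Y * (2 * C + 1) <= C * X.
  apply: le_trans le; rewrite ler_wpM2l //; exact: le_trans a4.
nra.
Qed.

End Growth.

(** The partner on [D'] of a universal frame on [D] is not known to be universal, but the upper
    bound holds for every frame. *)
Lemma breadth_le (G : groupType) k (D D' : motif) (o : bool) (g : dart D -> G) :
  alternating D -> alternating D' -> motif_equiv k D D' -> universal_frame g ->
  breadth D o <= breadth D' o.
Proof.
move=> al al' eqv uf; have [fr _] := uf.
have [g' fr' je] := (transports_equiv G eqv).1 g fr.
have [C C0 up] := jones_upper al' o fr'.
have [A A1 lo] := jones_lower al o fr uf.
rewrite leNgt; apply/negP => lt.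
have [a [Aa Ca a1]] : exists a, [/\ A <= a, 2 * C < a & 1 < a].
  by exists (A + 2 * C + 1); split; lra.
have a0 : 0 < a by exact: lt_trans a1.
have e1 : a * a ^ breadth D' o <= a ^ breadth D o.
  rewrite -{1}[a]expr1z -expfzDr; last exact: lt0r_neq0.
  by rewrite ler_eXz2l // addrC lezD1.
have e0 : 0 < a ^ breadth D' o by exact: exprz_gt0.
have := lo a Aa; have := up a (ltW a1).
rewrite je; last by case: (o); rewrite ?invr_eq0; exact: lt0r_neq0.
move: (a ^ breadth D' o) (a ^ breadth D o) `|_| e1 e0 => X Y Z e1 e0 u l.
nra.
Qed.

(** * The form of an alternating motif *)

Section AlternatingForm.

Context (D : motif) (alt : alternating D) (con : connected D) (ne : (0 < #|dart D|)%N).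

Local Notation ccw := (ccw D).
Local Notation over := (faces_of D true).
Local Notation under := (faces_of D false).
Local Notation part o := (restrict_to (fun x => is_over D x == o)).

Lemma part_faces o v : v \in faces D -> part o v \in faces_of D o.
Proof.
move=> /facesP vF; apply/mem_faces_of; split=> [|x xo]; last by rewrite restrict_toE (negPf xo).
by apply/facesP => x; rewrite !restrict_toE over_face // vF.
Qed.

Lemma dim_over_under : \dim (faces D) = (\dim over + \dim under)%N.
Proof.
have sub o : (faces_of D o <= faces D)%VS by exact: capvSl.
rewrite -dimv_disjoint_sum.
  congr (\dim _); apply: subv_anti; rewrite subv_add !sub !andbT /=.
  apply/subvP => v vD; apply/memv_addP; exists (part true v); first exact: part_faces.
  exists (part false v); first exact: part_faces.
  apply/ffunP => x; rewrite ffunE !restrict_toE.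
  by case: (is_over D x); rewrite /= ?addr0 ?add0r.
apply/eqP; rewrite -subv0; apply/subvP => v; rewrite memv_cap memv0.
move=> /andP[/mem_faces_of[_ v1] /mem_faces_of[_ v0]]; apply/eqP/ffunP => x; rewrite ffunE.
by case: (boolP (is_over D x)) => xo; [apply: v0 | apply: v1]; rewrite ?xo // (negPf xo).
Qed.

Lemma reps_over d : d \in reps D -> is_over D d.
Proof. by rewrite mem_filter => /andP[/andP[]]. Qed.

Lemma over_form v : v \in over ->
  form D v = \sum_(d <- reps D) ((v d : rat) - v (ccw (ccw d))) ^+ 2.
Proof.
move=> /mem_faces_of[_ v0]; apply: eq_big_seq => d /reps_over od.
by rewrite /local_form (v0 (ccw d)) ?(v0 (ccw (ccw (ccw d)))) ?subrr ?expr0n ?subr0 //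
  !over_ccw od.
Qed.

(** Vanishing squares equate the two over-corners of each crossing, and each edge borders one
    over-region; so the value depends only on the crossing and is constant along walks. *)
Lemma over_constant v : v \in over -> form D v = 0 ->
  forall x y, is_over D x -> is_over D y -> v x = v y.
Proof.
move=> vo; rewrite over_form // => f0; have /mem_faces_of[/facesP vF v0] := vo.
have opp x : is_over D x -> v x = v (ccw (ccw x)).
  move=> xo; have [e re ex] := rep_exists D x.
  have eR : e \in reps D by rewrite mem_filter re mem_enum.
  have /eqP := f0; rewrite psumr_eq0; last by move=> d _; exact: sqr_ge0.
  move=> /allP/(_ e eR); rewrite /= sqrf_eq0 subr_eq0 => /eqP ve.
  have eo := reps_over eR.
  move: ex; rewrite quad_sym !inE => /or4P[] /eqP xE; move: xo; rewrite xE ?over_ccw ?eo // => _.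
  by rewrite ccwK ve.
pose u x : rat := v (corner true x).
have uc x : u (ccw x) = u x.
  rewrite /u /corner over_ccw; case: (boolP (is_over D x)) => xo /=; first by rewrite ccwK.
  have := opp (ccw (ccw (ccw x))); rewrite ccwK !over_ccw negbK (negPf xo) => -> //.
have um x : u (mate D x) = u x.
  rewrite /u corner_mate // /corner; case: ifP => _; first exact: vF.
  by rewrite -face_mate vF.
have us x y : same_crossing D x y -> u y = u x.
  by case=> k ->; elim: k => //= k IH; rewrite uc.
have uw w x y : walk D x w y -> u x = u y.
  elim: w x => [|d w IH] x /=; first by move/us.
  by move=> [/us xd /IH]; rewrite um xd.
move=> x y xo yo; have [w /uw] := con x y.
by rewrite /u /corner xo yo.
Qed.

Lemma over_dart : exists d, is_over D d.
Proof.
have /card_gt0P[d _] := ne.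
by case: (boolP (is_over D d)) => od; [exists d | exists (ccw d); rewrite over_ccw].
Qed.

Let unit_over : fspace (dart D) := [ffun x => (is_over D x)%:R].

Lemma unit_over_in : unit_over \in over.
Proof.
apply/mem_faces_of; split=> [|x xo]; last by rewrite ffunE; move: xo; case: (is_over D x).
by apply/facesP => x; rewrite !ffunE over_face.
Qed.

Lemma unit_over_neq0 : unit_over != 0.
Proof.
have [d od] := over_dart; apply/eqP => /ffunP/(_ d); rewrite !ffunE od => /eqP.
by rewrite (negPf (oner_neq0 _)).
Qed.

(** Functions on the over-regions that vanish on one of them are positive definite. Functions on the
    under-regions plus the constants on the over-regions have no positive value, so they meet a
    positive definite subspace in 0. The maximal index is thus s_A - 1. *)
Lemma form_index_alternating n :
  form_index D n <-> n <= (\dim over)%:Z - (\dim under)%:Z + writhe D - 2.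
Proof.
have [d0 od0] := over_dart.
have s1 : (0 < \dim over)%N.
  rewrite lt0n dimv_eq0; apply: contraTneq unit_over_in => ->.
  by rewrite memv0 unit_over_neq0.
split=> [[k [W [WV kW pd]] nk]|nk]; last first.
  exists (\dim over).-1; last by rewrite dim_over_under; lia.
  exists (over :&: lker (ev d0))%VS; split.
  - by apply: subv_trans (capvSl _ _) _; exact: capvSl.
  - by rewrite -ltnS prednK //; exact: dim_lker_cap.
  move=> v; rewrite mem_capker evE => /andP[vo /eqP v0] nz; rewrite lt_def; apply/andP; split.
    apply: contraNneq nz => /(over_constant vo) vc.
    apply/eqP/ffunP => x; rewrite ffunE; case: (boolP (is_over D x)) => xo.
      by rewrite (vc x d0).
    have /mem_faces_of[_] := vo; apply; by move: xo; case: (is_over D x).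
  by rewrite over_form // sumr_ge0 // => d _; exact: sqr_ge0.
have subo o : (faces_of D o <= faces D)%VS by exact: capvSl.
pose N := (under + <[unit_over]>)%VS.
have dN : \dim N = (\dim under).+1.
  rewrite dimv_disjoint_sum ?dim_vline ?unit_over_neq0 ?addn1 //.
  apply/eqP; rewrite -subv0; apply/subvP => v; rewrite memv_cap memv0.
  move=> /andP[/mem_faces_of[_ v0] /vlineP[c vc]].
  have := v0 d0; rewrite od0 => /(_ isT) e.
  have : c = v d0 :> rat by rewrite vc fspaceZ ffunE od0 mulr1.
  by rewrite e => c0; rewrite vc c0 scale0r.
have WN : (W :&: N = 0)%VS.
  apply/eqP; rewrite -subv0; apply/subvP => v; rewrite memv_cap memv0 => /andP[vW].
  move=> /memv_addP[b /mem_faces_of[_ b0] [_ /vlineP[c ->] vE]].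
  apply: contraT => /(pd v vW); rewrite ltNge => /negP; case.
  have ov x : is_over D x -> v x = c :> rat.
    by move=> xo; rewrite vE fspaceD fspaceZ b0 ?xo // ffunE xo mulr1 add0r.
  rewrite /form big_seq; apply: sumr_le0 => d /reps_over od.
  by rewrite /local_form (ov d) // (ov (ccw (ccw d))) ?over_ccw2 // subrr expr0n sub0r oppr_le0 sqr_ge0.
have := dimv_sum_cap W N; rewrite WN dimv0 addn0 dN => dWN.
have sWN : (W + N <= faces D)%VS.
  rewrite subv_add WV subv_add subo; apply/subvP => _ /vlineP[c ->].
  by rewrite memvZ // (subvP (subo true)) // unit_over_in.
have := dimvS sWN; rewrite dWN dim_over_under => le; move: nk; rewrite dim_over_under; lia.
Qed.

End AlternatingForm.

(** * The frame of the universal cover *)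

Local Close Scope ring_scope.

Section LiftFrame.

Context (T : Type) (U : diagram T) (D : motif) (p : T -> dart D) (lp : Defs.lift U p).
Context (con : connected D) (d0 : dart D).

Let pm : diagram_morphism U D p. Proof. by case: lp. Qed.

Lemma lift_ccw t : p (ccw U t) = ccw D (p t). Proof. by have [] := pm t. Qed.
Lemma lift_mate t : p (mate U t) = mate D (p t). Proof. by have [] := pm t. Qed.
Lemma lift_face t : p (face U t) = face D (p t).
Proof. by rewrite /face /= !lift_ccw lift_mate. Qed.

Lemma iter_inj (S : Type) (h : S -> S) n : injective h -> injective (iter n h).
Proof. by move=> hI; elim: n => //= n IH x y /hI/IH. Qed.

Lemma lift_face_iter a b t : iter a (face D) (p t) = iter b (face D) (p t) ->
  iter a (face U) t = iter b (face U) t.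
Proof.
wlog ab : a b / a <= b.
  by move=> H e; case: (leqP a b) => [ab|/ltnW ba]; [exact: H | apply/esym/H].
rewrite -(subnKC ab) !iterD => /(iter_inj (@face_inj _ D)) h.
have [_ _ _ /(_ t (b - a) (esym h)) e] := lp.
by rewrite e.
Qed.

Lemma iter_ccw_mod (S : Type) (E : diagram S) n x : iter n (ccw E) x = iter (n %% 4) (ccw E) x.
Proof.
rewrite {1}(divn_eq n 4) addnC iterD; congr (iter _ _ _).
by elim: (n %/ 4) => // k IH; rewrite mulSn iterD IH; exact: ccwK.
Qed.

Lemma lift_ccw_iter a b t : iter a (ccw D) (p t) = iter b (ccw D) (p t) ->
  iter a (ccw U) t = iter b (ccw U) t.
Proof.
rewrite !(iter_ccw_mod _ a) !(iter_ccw_mod _ b) => e; congr (iter _ _ _).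
have qE n : n < 4 -> iter n (ccw D) (p t) = nth (p t) (quad D (p t)) n.
  by case: n => [|[|[|[|]]]].
apply/eqP; rewrite -(nth_uniq (p t) _ _ (uniq_quad D (p t))) -?qE ?ltn_pmod //.
by rewrite e.
Qed.

Definition ccw_bij : bijection T := @Bijection T (ccw U) (iter 3 (ccw U)) (@ccwK _ U) (@ccwK _ U).
Definition mate_bij : bijection T := @Bijection T (mate U) (mate U) (mateK U) (mateK U).

Lemma face_invK : cancel (face U) (fun t => mate U (ccw U t)).
Proof. by move=> t; rewrite ccw_face mateK. Qed.
Lemma face_funK : cancel (fun t => mate U (ccw U t)) (face U).
Proof. by move=> t; rewrite face_mate ccwK. Qed.
Definition face_bij : bijection T := Bijection face_invK face_funK.

(** [s] restricts to a bijection between the fibres over [x] and [y] and is arbitrary elsewhere, so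
    that all these bijections compose in one group. *)
Definition carries (x y : dart D) (s : bijection T) : Prop :=
  (forall t, p t = x -> p (s t) = y) /\ (forall t, p t = y -> p (bij_inv s t) = x).

Lemma carriesM x y z s t : carries x y t -> carries y z s -> carries x z (s * t)%g.
Proof. by move=> [h1 h2] [h3 h4]; split=> u /= hu; [exact/h3/h1 | exact/h2/h4]. Qed.

Lemma carriesV x y s : carries x y s -> carries y x s^-1%g.
Proof. by case. Qed.

Lemma carries_ccw x : carries x (ccw D x) ccw_bij.
Proof. by split=> t /=; rewrite ?lift_ccw => ->; rewrite ?ccwK. Qed.

Lemma carries_mate x : carries x (mate D x) mate_bij.
Proof. by split=> t /=; rewrite lift_mate => ->; rewrite ?mateK. Qed.

Lemma carries_iter (h : dart D -> dart D) n x s : (forall y, carries y (h y) s) ->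
  carries x (iter n h x) (bij_iter n s).
Proof.
move=> hs; split=> t; elim: n x t => //= n IH x t tx.
  by have [h1 _] := hs (iter n h x); apply: h1; exact: IH.
rewrite -iterS iterSr; apply: IH.
by have [_ h2] := hs (iter n h x); exact: h2.
Qed.

Lemma carries_face x : carries x (face D x) face_bij.
Proof. by split=> t /=; rewrite ?lift_face ?lift_mate ?lift_ccw => ->; rewrite ?ccw_face ?mateK. Qed.

Lemma carries_exists x y : exists s, carries x y s.
Proof.
have sc u v : same_crossing D u v -> exists s, carries u v s.
  by case=> k ->; exists (bij_iter k ccw_bij); apply: carries_iter; exact: carries_ccw.
have [w] := con x y; elim: w x => [|d w IH] x /=; first exact: sc.
move=> [/sc[s sP] /IH[s' sP']]; exists (s' * (mate_bij * s))%g.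
by apply: carriesM sP'; apply: carriesM sP _; exact: carries_mate.
Qed.

(* The boundaries of the regions lift to closed curves, so the covering can be
   trivialized along them. *)
Lemma lift_trivialization : exists theta : dart D -> bijection T,
  (forall d, carries d0 d (theta d)) /\
  (forall d t, p t = d0 -> theta (face D d) t = face U (theta d t)).
Proof.
have [psi psiP] := choice (carries_exists d0).
exists (fun d => (bij_iter (findex (face D) (froot (face D) d) d) face_bij * psi (froot (face D) d))%g).
have rd d : fconnect (face D) (froot (face D) d) d.
  by rewrite fconnect_sym ?connect_root //; exact: face_inj.
split=> [d|d t pt].
  apply: carriesM (psiP _) _.
  by rewrite -{2}(iter_findex (rd d)); apply: carries_iter => y; exact: carries_face.
have fr : froot (face D) (face D d) = froot (face D) d.
  apply/esym/eqP; rewrite root_connect; [exact: fconnect1 | exact/fconnect_sym/face_inj].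
rewrite /= fr -[RHS]iterS; apply: lift_face_iter.
have [h _] := psiP (froot (face D) d); rewrite (h _ pt) /= iter_findex.
  by rewrite iter_findex.
by rewrite -fr.
Qed.

(** [xi d] compares two trivializations of the covering: along the region at the corner [d], and at
    the crossing, based at a chosen dart of it. Equal values at opposite corners of one region would
    lead, around the lift of that region, from a corner to the opposite corner of the same lifted
    crossing, which is nugatory then. *)
Lemma lift_universal_frame : no_nugatory_crossing U ->
  exists g : dart D -> bijection T, universal_frame g.
Proof.
move=> nn; have [th [thC thF]] := lift_trivialization.
pose k d := findex (ccw D) d (froot (ccw D) d).
have kE d : iter (k d) (ccw D) d = froot (ccw D) d by rewrite iter_findex // connect_root.
have rc d : froot (ccw D) (ccw D d) = froot (ccw D) d.
  by apply/esym/eqP; rewrite root_connect; [exact: fconnect1 | exact/fconnect_sym/ccw_inj].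
pose xi d : bijection T := ((th (froot (ccw D) d))^-1 * (bij_iter (k d) ccw_bij * th d))%g.
have xiC d : carries d0 d0 (xi d).
  apply: carriesM (carriesV (thC _)); apply: carriesM (thC d) _.
  rewrite -kE; apply: carries_iter; exact: carries_ccw.
(* Off the fibre over [d0] nothing is known about [xi]; there [g] becomes the identity, so that the
   frame condition holds on all of [T]. *)
have masked d : exists s : bijection T, (forall t, p t = d0 -> s t = xi d t /\ bij_inv s t = bij_inv (xi d) t) /\
    (forall t, p t <> d0 -> s t = t /\ bij_inv s t = t).
  have [h1 h2] := xiC d.
  have c1 : cancel (fun t => if p t == d0 then xi d t else t)
     (fun t => if p t == d0 then bij_inv (xi d) t else t).
    move=> t; case: (p t =P d0) => [pt|pt]; last by rewrite (introF eqP pt).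
    by rewrite (h1 _ pt) eqxx bij_funK.
  have c2 : cancel (fun t => if p t == d0 then bij_inv (xi d) t else t)
     (fun t => if p t == d0 then xi d t else t).
    move=> t; case: (p t =P d0) => [pt|pt]; last by rewrite (introF eqP pt).
    by rewrite (h2 _ pt) eqxx bij_invK.
  by exists (Bijection c1 c2); split=> t /eqP pt /=; rewrite ?pt ?(negPf pt).
have [g gP] := choice masked; exists g.
(* The trivialization at the crossing cancels, as both corners belong to the same crossing; the
   transition between the regions beside the edge remains. *)
have sideE d t : (p t = d0 -> side D g d t = bij_inv (th d) (mate U (th (mate D d) t))) /\
    (p t <> d0 -> side D g d t = t).
  split=> pt; last first.
    have [_ h] := gP d; have [_ h'] := gP (iter 3 (ccw D) d).
    rewrite /side /=; have [-> _] := h' t pt; by have [_ ->] := h t pt.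
  have [h _] := gP d; have [h' _] := gP (iter 3 (ccw D) d).
  have [c1 c2] := xiC (iter 3 (ccw D) d).
  rewrite /side [LHS]/=; have [-> _] := h' t pt; have [_ ->] := h _ (c1 t pt).
  set d3 := iter 3 (ccw D) d.
  have r3 : froot (ccw D) d3 = froot (ccw D) d by rewrite /d3 /= !rc.
  rewrite /xi /= r3 bij_invK; congr (bij_inv (th d) _).
  apply: (can_inj (iter_funK ccw_bij (k d))); rewrite iter_invK.
  have [t1 _] := thC d3; have [t2 _] := thC (mate D d).
  have d3E : face D (mate D d) = d3 by rewrite face_mate.
  have e3 : th d3 t = iter 3 (ccw U) (mate U (th (mate D d) t)).
    by rewrite -d3E thF.
  have -> : mate U (th (mate D d) t) = ccw U (th d3 t) by rewrite e3 /= ccwK.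
  change (iter (k d3) (ccw U) (th d3 t) = iter (k d) (ccw U) (ccw U (th d3 t))).
  rewrite -iterSr; apply: lift_ccw_iter.
  rewrite (t1 _ pt) kE iterSr {2}/d3 -iterS -[iter 4 _ _]/(ccw D (ccw D (ccw D (ccw D d)))) ccwK kE.
  exact: r3.
split.
  move=> d; suff h : (side D g (mate D d) * side D g d)%g = 1%g.
    by rewrite -[LHS](mulgK (side D g d)) h mul1g.
  apply: bijectionP => t; rewrite -[LHS]/(side D g (mate D d) (side D g d t)).
  have [e1 e2] := sideE d t; have [e3 e4] := sideE (mate D d) (side D g d t).
  case: (pselect (p t = d0)) => pt; last by rewrite e4 e2.
  have [h1 _] := thC (mate D d); have [_ h2] := thC d.
  have pu : p (side D g d t) = d0.
    by rewrite e1 // h2 // lift_mate h1 // mateK.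
  by rewrite e3 // mateK e1 // bij_invK mateK bij_funK.
move=> d fc gE; pose d2 := ccw D (ccw D d).
have [_ _ /(_ d0)[t pt] _] := lp.
have [td _] := thC d; have {}td := td t pt.
have fE n : th (iter n (face D) d) t = iter n (face U) (th d t).
  by elim: n => //= n IH; rewrite thF // IH.
apply: (nn (th d t)); exists 2 => //; exists (findex (face D) d d2).
rewrite -fE iter_findex // -/d2.
have [/(_ t pt)[x1 _] _] := gP d; have [/(_ t pt)[x2 _] _] := gP d2.
have r2 : froot (ccw D) d2 = froot (ccw D) d by rewrite /d2 !rc.
have xe : xi d t = xi d2 t by rewrite -x1 -x2 gE.
rewrite /xi /= r2 in xe; have e := can_inj (@bij_invK _ _) xe.
apply: (@iter_inj _ (ccw U) (k d2)); first exact: ccw_inj.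
transitivity (iter (k d) (ccw U) (th d t)); last exact: e.
rewrite -iterD; apply: lift_ccw_iter.
by rewrite td iterD -[iter 2 _ d]/d2 !kE r2.
Qed.

End LiftFrame.

(** * Invariance of the writhe *)

Lemma motif_equiv_on_surface g D D' : motif_equiv g D D' -> on_surface g D <-> on_surface g D'.
Proof.
elim=> {D D'} [D D' [sD sD' _]|D|D D' _ IH|D D' D'' _ IH _ IH'] //.
- exact: iff_sym.
exact: iff_trans IH IH'.
Qed.

Lemma quotient_isomorphism T (W : diagram T) (D D' : motif) (p : T -> dart D) (p' : T -> dart D') :
  diagram_morphism W D p -> diagram_morphism W D' p' ->
  (forall x, exists t, p t = x) -> (forall x, exists t, p' t = x) ->
  (forall t u, p t = p u <-> p' t = p' u) -> exists f : dart D -> dart D', isomorphism D D' f.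
Proof.
move=> pm pm' ps ps' pp.
have [s sK] := choice ps; have [s' s'K] := choice ps'.
have fp t : p' (s (p t)) = p' t by apply/pp; rewrite sK.
have fp' t : p (s' (p' t)) = p t by apply/pp; rewrite s'K.
exists (fun x => p' (s x)); split.
  by exists (fun y => p (s' y)) => x; rewrite ?fp' ?fp ?sK ?s'K.
move=> x; rewrite -[x]sK; have [h1 h2 h3 h4] := pm (s x); have [k1 k2 k3 k4] := pm' (s x).
by rewrite -h1 -h2 !fp k1 k2 k3 k4 h3 h4.
Qed.

Lemma minimal_motif_equiv g T (W : diagram T) D1 D2 :
  minimal_motif g W D1 -> minimal_motif g W D2 ->
  motif_equiv g D1 D2 /\ on_surface g D1.
Proof.
move=> [L1 [per1 min1] [E1 [p1 [s1 q1 eq1]]]] [L2 [per2 min2] [E2 [p2 [s2 q2 eq2]]]].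
have [[_ m1 su1 _] _ k1] := q1; have [[_ m2 su2 _] _ k2] := q2.
have pp t u : p1 t = p1 u <-> p2 t = p2 u.
  split=> [/k1[l lL e]|/k2[l lL e]].
    by apply/k2; exists l => //; exact: (min2 _ _ per1).
  by apply/k1; exists l => //; exact: (min1 _ _ per2).
have [f iso] := quotient_isomorphism m1 m2 su1 su2 pp.
split; last by apply/(motif_equiv_on_surface eq1).
apply: rst_trans (rst_sym _ _ _ _ eq1) _; apply: rst_trans eq2.
by apply: rst_step; split=> //; exact: move_homeo iso.
Qed.

Lemma reduced_breadth_le g D D' o : reduced D -> on_surface g D -> alternating D -> alternating D' ->
  motif_equiv g D D' -> (breadth D o <= breadth D' o)%R.
Proof.
move=> [T [U [p [lp nn]]]] [/card_gt0P[d0 _] con _] al al' eqv.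
have [h uf] := lift_universal_frame lp con d0 nn.
exact: breadth_le al al' eqv uf.
Qed.

Theorem theorem5p9 (R : realType) (g : nat) (T : Type) (W : diagram T)
    (D1 D2 : motif) (hg : 1 <= g)
    (hW : periodic_weave R g W) (hWalt : alternating_weave W)
    (hmin1 : minimal_motif g W D1) (hred1 : reduced D1) (halt1 : alternating D1)
    (hmin2 : minimal_motif g W D2) (hred2 : reduced D2) (halt2 : alternating D2) :
  writhe D1 = writhe D2.
Proof.
have [eqv sD1] := minimal_motif_equiv hmin1 hmin2; have [_ sD2] := minimal_motif_equiv hmin2 hmin1.
have eqv' : motif_equiv g D2 D1 by exact: rst_sym.
have b o : breadth D1 o = breadth D2 o.
  apply/eqP; rewrite eq_le (reduced_breadth_le o hred1 sD1 halt1 halt2 eqv).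
  exact: (reduced_breadth_le o hred2 sD2 halt2 halt1 eqv').
have [ne1 con1 _] := sD1; have [ne2 con2 _] := sD2.
have fi n := form_index_equiv n eqv.
have f1 n := form_index_alternating halt1 con1 ne1 n.
have f2 n := form_index_alternating halt2 con2 ne2 n.
(* The largest [n] of each motif is admissible for the other, so s_A - s_B + w is invariant. The
   difference of the breadths is 2 (s_A - s_B) + 6 w; removing twice the former leaves 4 w. *)
have := (f2 _).1 ((fi _).1 ((f1 _).2 (lexx _))).
have := (f1 _).1 ((fi _).2 ((f2 _).2 (lexx _))).
have := b true; have := b false; rewrite /breadth /= => b0 b1 i1 i2.
lia.
Qed.
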